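(* Let $\hat S_n$ and $\check S_n$ be the positively and negatively step-reinforced random walks with parameter $p\in[0,1)$ built from i.i.d. real random variables $X_1,X_2,\dots$ (see context). Assume that $\mathbb{E}(X_1^2)<\infty$, and let $f:\mathbb{R}\to\mathbb{R}$ be bounded and continuous. Assume $\sigma>0$ in parts 1 and 2, and $\check\sigma>0$ in part 3. As $n\to\infty$: 1. If $p\in[0,1/2)$, then $$\frac1{\log n}\sum_{k=1}^n\frac1k f\left(\frac{\sqrt{1-2p}}{\sigma\sqrt k}(\hat S_k-km_1)\right)\to\mathbb{E}f(\mathbf{Z})\quad\text{almost surely.}$$ 2. If $p=1/2$, then $$\frac1{\log\log n}\sum_{k=2}^n\frac1{k\log k} f\left(\frac{\hat S_k-km_1}{\sigma\sqrt{k\log k}}\right)\to\mathbb{E}f(\mathbf{Z})\quad\text{almost surely.}$$ 3. If $p\in[0,1)$, then $$\frac1{\log n}\sum_{k=1}^n\frac1k f\left(\frac{\sqrt{1+2p}}{\check\sigma\sqrt k}(\check S_k-k\check\mu)\right)\to\mathbb{E}f(\mathbf{Z})\quad\text{almost surely.}$$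
   Context: $\mathbf{Z}$ denotes a standard normal random variable. Step-reinforced random walks: let $\{X_n,n\ge1\}$ be i.i.d. real random variables, $\{\varepsilon_n,n\ge2\}$ i.i.d. Bernoulli variables with parameter $p\in[0,1)$ (i.e. $\mathbb{P}(\varepsilon_n=1)=p$), and for each $n\ge2$ let $U_n$ be uniformly distributed on $\{1,\dots,n-1\}$; all the variables $X_1,X_2,\varepsilon_2,U_2,X_3,\varepsilon_3,U_3,\dots$ are mutually independent. Set $\hat X_1=\check X_1=X_1$ and, recursively for $n\ge2$: $\hat X_n=X_n$ if $\varepsilon_n=0$ and $\hat X_n=\hat X_{U_n}$ if $\varepsilon_n=1$; $\check X_n=X_n$ if $\varepsilon_n=0$ and $\check X_n=-\check X_{U_n}$ if $\varepsilon_n=1$. Put $\hat S_n=\hat X_1+\cdots+\hat X_n$ and $\check S_n=\check X_1+\cdots+\check X_n$ for $n\ge1$. Notation: $m_i=\mathbb{E}(X_1^i)$ for $i=1,2$; $\sigma^2=m_2-m_1^2$; $\check\mu=\frac{(1-p)m_1}{1+p}$; $\check\sigma^2=m_2-\check\mu^2$ (with $\sigma,\check\sigma\ge0$). *)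

(* Defs.v *)
From HB Require Import structures.
From mathcomp Require Import all_boot all_order all_algebra.
From mathcomp Require Import all_classical all_reals all_analysis.

Set Implicit Arguments.
Unset Strict Implicit.
Unset Printing Implicit Defensive.

Import Order.TTheory GRing.Theory Num.Theory.
Import numFieldNormedType.Exports.

Local Open Scope classical_set_scope.
Local Open Scope ring_scope.

Section independence.
Context {d : measure_display} {T : measurableType d} {R : realType}.
Variable P : probability T R.

Definition mutually_independent (I : eqType) (D : set I)
    (F : I -> set (set T)) : Prop :=
  forall (s : seq I) (A : I -> set T), uniq s ->
    (forall i, i \in s -> D i /\ F i (A i)) ->
    P (\bigcap_(i in [set` s]) A i) = (\prod_(i <- s) P (A i))%E.

End independence.

Section steps.
Context {R : realType}.

(* Time indices start at 1; the values of x at 0 and of e, u at 0 and 1 are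
   never used. [history g x e u n] maps j to the j-th step for 1 <= j <= n and
   to 0 otherwise, so 0 is used if u n falls outside {1, ..., n - 1}, which has
   probability 0 in the model below. *)
Fixpoint history (g : R -> R) (x : nat -> R) (e : nat -> bool)
    (u : nat -> nat) (n : nat) : nat -> R :=
  if n is n'.+1 then
    let h := history g x e u n' in
    fun j => if j == n then
               (if (0 < n')%N && e n then g (h (u n)) else x n)
             else h j
  else fun=> 0.

Definition reinforced_step g x e u n : R := history g x e u n n.

Lemma history_step g x e u n j : (0 < j <= n)%N ->
  history g x e u n j = reinforced_step g x e u j.
Proof.
elim: n => [|n IH] /andP[j0 jn]; first by move: (leq_trans j0 jn).
have [->//|jn1] := eqVneq j n.+1.
by rewrite /= (negbTE jn1) IH// j0 -ltnS ltn_neqAle jn1.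
Qed.

Lemma reinforced_step1 g x e u : reinforced_step g x e u 1 = x 1%N.
Proof. by []. Qed.

Lemma reinforced_stepE g x e u n : (2 <= n)%N -> (0 < u n < n)%N ->
  reinforced_step g x e u n =
    if e n then g (reinforced_step g x e u (u n)) else x n.
Proof.
case: n => [//|[//|n]] _ /andP[u0 un].
transitivity (if e n.+2 then g (history g x e u n.+1 (u n.+2)) else x n.+2).
  by rewrite /reinforced_step /= eqxx.
by rewrite history_step// u0.
Qed.

End steps.

Section model.
Context {d : measure_display} {T : measurableType d} {R : realType}.
Variable P : probability T R.
Variables (X : nat -> {RV P >-> R}) (eps : nat -> {RV P >-> bool})
  (U : nat -> {RV P >-> nat}).

(* Indices: inl (inl n) for X n, inl (inr n) for eps n, inr n for U n. *)
Definition input_index : set (nat + nat + nat) := [set i | match i with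
  | inl (inl n) => (1 <= n)%N
  | inl (inr n) => (2 <= n)%N
  | inr n => (2 <= n)%N
  end].

Definition input_sigma (i : nat + nat + nat) : set (set T) := match i with
  | inl (inl n) => g_sigma_algebra_preimage (X n)
  | inl (inr n) => g_sigma_algebra_preimage (eps n)
  | inr n => g_sigma_algebra_preimage (U n)
  end.

Record reinforcement_inputs (p : R) : Prop := {
  X_identically_distributed : forall n, (1 <= n)%N ->
    forall A, measurable A -> distribution P (X n) A = distribution P (X 1%N) A;
  eps_bernoulli : forall n, (2 <= n)%N ->
    forall A, measurable A -> distribution P (eps n) A = bernoulli_prob p A;
  U_uniform : forall n, (2 <= n)%N -> forall j, (1 <= j <= n.-1)%N ->
    P [set w | U n w = j] = ((n.-1)%:R^-1)%:E;
  inputs_independent : mutually_independent P input_index input_sigma }.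

Definition Xhat (n : nat) (w : T) : R :=
  reinforced_step id (X ^~ w) (eps ^~ w) (U ^~ w) n.

Definition Xcheck (n : nat) (w : T) : R :=
  reinforced_step -%R (X ^~ w) (eps ^~ w) (U ^~ w) n.

Definition Shat (n : nat) (w : T) : R := \sum_(1 <= k < n.+1) Xhat k w.

Definition Scheck (n : nat) (w : T) : R := \sum_(1 <= k < n.+1) Xcheck k w.

End model.

Section constants.
Context {d : measure_display} {T : measurableType d} {R : realType}.
Variables (P : probability T R) (X : T -> R).

Definition moment (i : nat) : R := fine 'E_P[fun w => X w ^+ i].

Definition sigma : R := Num.sqrt (moment 2 - moment 1 ^+ 2).

Definition mucheck (p : R) : R := (1 - p) * moment 1 / (1 + p).

Definition sigmacheck (p : R) : R := Num.sqrt (moment 2 - mucheck p ^+ 2).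

End constants.

Definition gaussian_mean {R : realType} (f : R -> R) : R :=
  fine 'E_(normal_prob (0 : R) 1)[f].

(* Main.v *)
From HB Require Import structures.
Require Import Defs.
From mathcomp Require Import all_boot all_order all_algebra.
From mathcomp Require Import all_classical all_reals all_analysis.
From mathcomp Require Import measurable_realfun ring lra zify.
Import Order.TTheory GRing.Theory Num.Theory.
Import numFieldNormedType.Exports.
Local Open Scope classical_set_scope.
Local Open Scope ring_scope.
Set Implicit Arguments.
Unset Strict Implicit.
Unset Printing Implicit Defensive.

(** Both walks are treated at once: a repeated step is multiplied by [s = 1] or
    [s = -1]. With [q = s * p], [mu = (1 - p) m1 / (1 - q)] and
    [W k = S k - k mu], the choice of a uniform earlier step gives
    [W (k + 1) = (1 + q / k) W k + D k] with martingale differences [D]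
    ([centered_sum], [innovation], [innovation_mdiff]).

    Put [Y k = W k / b k] with [b k] proportional to [sqrt k] if [q < 1 / 2] and
    to [sqrt (k ln k)] if [q = 1 / 2]. Given the past, the increment of [Y] at
    time [k] has mean close to [- theta w k Y k] and variance close to
    [2 theta w k], where [w k] is [1 / k] or [1 / (k ln k)] ([normalization]). So
    [Y] is a discretised Ornstein-Uhlenbeck process in the time
    [Lam n = sum of w k for k < n], which is [ln n] or [ln (ln n)] up to a bounded
    error, and the claim is the ergodic theorem for this process: time averages
    of [f (Y k)] converge to the mean of [f] under the stationary law, the
    standard normal law.

    The ergodic theorem is proved with Stein's equation. For [f] of compact support
    there is [g] with [g'' - y g' = f - E f(Z)], [g'] and [g''] bounded and
    uniformly continuous ([stein_test_function]; Mills' ratio controls the solution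
    at infinity). Summing the second order expansions of
    [g (Y (k + 1)) - g (Y k)] expresses [theta * sum of w k (f (Y k) - E f(Z))]
    through a boundary term, martingale transforms and an error
    ([step_error], [stein_average_le]):

    - the boundary term and the martingale transforms have second moments of order
      [Lam n]; along times with [Lam] close to [j ^ 2] they are almost surely
      [o(Lam)] ([negligible_second_moment]), and since [f] is bounded the times in
      between follow ([interpolate]);

    - as only second moments of the steps are finite, the squared steps are cut at
      a level [c]. Squares and other even functions of the steps do not see the sign
      [s], so they form a reinforced sequence with parameter [p] and again give
      martingale transforms; the part above [c] is dominated by a weighted law of
      large numbers ([weighted_average_le]) applied to a function of small mean;

    - the remaining errors are almost surely summable, because
      [E (W k ^ 2) / k ^ 3] is summable for every [q < 1]
      ([centered_second_summable]).

    Conditional expectations are expressed throughout by testing against square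
    integrable variables determined by the past. Cutting off [f] outside a large
    interval extends the result from compact support to bounded continuous [f]
    ([almost_sure_clt]); it remains to verify the properties of the two scalings
    ([sqrt_normalization], [diffusive_walk_clt], [critical_walk_clt]). *)

(** * Calculus on the real line *)

Section calculus.
Context {R : realType}.
Implicit Types (f df u : R -> R).

Lemma derive_continuous f df : (forall x : R, is_derive x 1 f (df x)) ->
  continuous f.
Proof.
by move=> dfP x; apply: differentiable_continuous; apply/derivable1_diffP;
  case: (dfP x).
Qed.

Lemma MVT_le (a b : R) f df : a <= b ->
  (forall x : R, a <= x <= b -> is_derive x 1 f (df x)) ->
  exists2 c, a <= c <= b & f b - f a = df c * (b - a).
Proof.
move=> ab dfP.
have [||c] := @MVT_segment R f df a b ab.
- by move=> x; rewrite in_itv /= => /andP[ax xb]; apply: dfP; rewrite !ltW.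
- apply: derivable_within_continuous => x; rewrite in_itv /= => /dfP.
  by case.
- by rewrite in_itv /= => ? ?; exists c.
Qed.

Lemma MVT_between (a b : R) f df : (forall x : R, is_derive x 1 f (df x)) ->
  exists2 c, `|c - a| <= `|b - a| & f b - f a = df c * (b - a).
Proof.
move=> dfP; case: (leP a b) => [ab|/ltW ba].
  have [c /andP[ac cb] E] := @MVT_le a b f df ab (fun x _ => dfP x).
  by exists c => //; rewrite !ger0_norm ?subr_ge0 // lerD2r.
have [c /andP[ac cb] E] := @MVT_le b a f df ba (fun x _ => dfP x).
exists c; first by rewrite !ler0_norm ?subr_le0 // lerN2 lerD2r.
by rewrite -opprB E -mulrN opprB.
Qed.

(** If [h'] never moves by more than [B] on the way from [y] to [y + t], two
    applications of the mean value theorem bound the error of the second order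
    expansion by [B * t ^+ 2]. *)
Lemma taylor2 (g h h' : R -> R) (y t B : R) : (forall x : R, is_derive x 1 g (h x)) ->
  (forall x : R, is_derive x 1 h (h' x)) ->
  (forall z, `|z| <= `|t| -> `|h' (y + z) - h' y| <= B) ->
  `|g (y + t) - g y - h y * t - h' y * t ^+ 2 / 2| <= B * t ^+ 2.
Proof.
move=> dg dh hB.
pose r z := g (y + z) - h y * z - h' y * z ^+ 2 / 2.
have dr : forall z : R, is_derive z 1 r (h (y + z) - h y - h' y * z).
  move=> z.
  have Dg := is_derive1_comp (dg (y + z)) (is_deriveD (is_derive_cst y z 1) (is_derive_id z 1)).
  rewrite /r; apply: is_derive_eq; rewrite /GRing.scale /=; by field.
have [c ct rE] := @MVT_between 0 t r _ dr.
rewrite !subr0 in ct rE.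
have -> : g (y + t) - g y - h y * t - h' y * t ^+ 2 / 2 = r t - r 0.
  by rewrite /r addr0; ring.
have [e ec hE] := @MVT_between y (y + c) h _ dh.
have yc : y + c - y = c by ring.
rewrite yc in ec hE; rewrite rE hE -mulrBl !normrM -mulrA.

apply: le_trans (_ : B * (`|t| * `|t|) <= _); last by rewrite -expr2 real_normK ?num_real.
have B0 : 0 <= B by apply: le_trans (hB 0 _); rewrite ?normr0.
apply: ler_pM; rewrite ?mulr_ge0 //; last by apply: ler_pM.
rewrite -[e](subrKC y) hB //; exact: le_trans ec ct.
Qed.

Lemma heine_segment (k : R -> R) (M e : R) : continuous k -> 0 < e ->
  exists2 eta, 0 < eta &
    forall y z, `|y| <= M -> `|z - y| <= eta -> `|k z - k y| <= e.
Proof.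
move=> ck e0.
have cpt : compact `[- M, M]%classic := @segment_compact R (- M) M.
have e20 : 0 < e / 2 by rewrite divr_gt0.
have := (iffLR (compact_near_coveringP `[- M, M]%classic) cpt) R (0^'+)
  (fun i y => forall z, `|z - y| <= i -> `|k z - k y| <= e) _.
case=> [x _|eta /= eta0 H].
  have /cvgrPdist_le /(_ _ e20) [d /= d0 kd] := ck x.
  exists (ball x (d / 2), `](0:R), (d / 2)[%classic); last first.
    move=> [x' i] /= [xx']; rewrite in_itv /= => /andP[_ id] z zx'.
    have h1 : `|k x - k x'| <= e / 2.
      by apply: kd => /=; rewrite (lt_le_trans xx')// ler_pdivrMr// ler_peMr ?ltW ?ltr1n.
    have h2 : `|k x - k z| <= e / 2.
      apply: kd => /=; rewrite (le_lt_trans (ler_distD x' _ _))//.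
      by rewrite [ltRHS]splitr ltr_leD// (distrC x' z) (le_trans zx')// ltW.
    by rewrite (le_trans (ler_distD (k x) _ _))// [leRHS]splitr lerD// distrC.
  split; first by apply: nbhsx_ballx; rewrite divr_gt0.
  exists (d / 2) => /=; first by rewrite divr_gt0.
  move=> i /=; rewrite sub0r normrN => id i0; rewrite in_itv /= i0 /=.
  by apply: le_lt_trans id; rewrite ler_norm.
exists (eta / 2); first by rewrite divr_gt0.
move=> y z yM zy; apply: (H (eta / 2)) => //=.
- by rewrite sub0r normrN gtr0_norm ?divr_gt0// ltr_pdivrMr// ltr_pMr// ltr1n.
- by rewrite divr_gt0.
- by rewrite in_itv /= -ler_norml.
Qed.

Definition vanishes_at_infinity (k : R -> R) :=
  forall e : R, 0 < e -> exists M : R, forall y, M <= `|y| -> `|k y| <= e.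

(** Compactness handles the points near the origin, smallness of [k] the
    others. *)
Lemma vanishing_unif_continuous (k : R -> R) (e : R) : continuous k ->
  vanishes_at_infinity k -> 0 < e ->
  exists2 eta, 0 < eta & forall y z, `|z - y| <= eta -> `|k z - k y| <= e.
Proof.
move=> ck k0 e0; have e20 : 0 < e / 2 by rewrite divr_gt0.
have [M kM] := k0 _ e20.
have [eta eta0 H] := heine_segment (M + 1) ck e0.
exists (Num.min eta 1); first by rewrite lt_min eta0 ltr01.
move=> y z; rewrite le_min => /andP[zy1 zy2].
have [yM|/ltW yM] := leP `|y| (M + 1); first exact: H.
rewrite (le_trans (ler_normB _ _))// [leRHS]splitr lerD// kM//.
  rewrite -(lerD2r 1) (le_trans yM)// -[in leLHS](subKr z y).
  by rewrite (le_trans (ler_normB _ _)) // lerD2l.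
by rewrite (le_trans _ yM)// lerDl.
Qed.

Lemma vanishing_bounded (k : R -> R) : continuous k ->
  vanishes_at_infinity k -> exists2 C, 0 < C & forall y, `|k y| <= C.
Proof.
move=> ck k0; have [M0 kM0] := k0 _ ltr01.
pose M := Num.max M0 0.
have kM y : M <= `|y| -> `|k y| <= 1.
  by move=> My; apply: kM0; rewrite (le_trans _ My)// le_max lexx.
have MM : - M <= M by rewrite ge0_cp// le_max lexx orbT.
have ckn : {within `[- M, M], continuous (fun y => `|k y|)}.
  apply: continuous_subspaceT => y; apply: continuous_comp; first exact: ck.
  exact: norm_continuous.
have [c _ kc] := EVT_max MM ckn.
exists (1 + `|k c|); first by rewrite ltr_pwDl.
move=> y; have [yM|yM] := leP `|y| M.
  by rewrite (le_trans (kc _ _)) ?lerDr// in_itv /= -ler_norml.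
by rewrite (le_trans (kM _ (ltW yM)))// lerDl.
Qed.

End calculus.

(** * Gaussian tails *)

Section gaussian.
Context {R : realType}.
Local Notation phi := (normal_pdf (0 : R) 1).
Local Notation mu := (@lebesgue_measure R).

Lemma phiE (x : R) : phi x = normal_peak 1 * expR (- (x ^+ 2) / 2).
Proof.
by rewrite normal_pdfE ?oner_eq0// /normal_fun subr0 expr1n.
Qed.

Lemma phi_gt0 (x : R) : 0 < phi x.
Proof. by rewrite phiE mulr_gt0 ?expR_gt0// normal_peak_gt0 ?oner_eq0. Qed.

Lemma is_derive_phi (x : R) : is_derive x 1 phi (- x * phi x).
Proof.
have -> : phi = (fun x => normal_peak 1 * expR (- (x ^+ 2) / 2)).
  by apply/funext => y; rewrite phiE.
have De : is_derive x 1 (fun x : R => - (x ^+ 2) / 2) (- x).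
  by apply: is_derive_eq; rewrite /GRing.scale /=; field.
have := is_derive1_comp (is_derive_expR _) De => Dc.
apply: is_derive_eq; rewrite /GRing.scale /=; ring.
Qed.

Lemma continuous_phi : continuous phi.
Proof. by apply: continuous_normal_pdf; exact: oner_neq0. Qed.

(** A nondecreasing function with nonpositive limit is nonpositive. *)
Lemma le_tail_vanish (u du : R -> R) (a : R) :
  (forall x : R, a <= x -> is_derive x 1 u (du x)) ->
  (forall x, a <= x -> 0 <= du x) ->
  (forall e : R, 0 < e -> exists M : R, forall x, M <= x -> u x <= e) ->
  u a <= 0.
Proof.
move=> Du du0 u0; rewrite leNgt; apply/negP => ua.
have [M uM] := u0 _ (divr_gt0 ua (ltr0Sn R 1)).
pose b := Num.max a M.
have ab : a <= b by rewrite le_max lexx.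
have [c /andP[ac cb] E] := MVT_le ab (fun x xab => Du x (proj1 (andP xab))).
have : u a <= u b.
  by rewrite -subr_ge0 E mulr_ge0 ?subr_ge0// du0.
have : u b <= u a / 2 by apply: uM; rewrite le_max lexx orbT.
by lra.
Qed.

(** Mills' ratio: both bounds compare derivatives, as all three functions vanish
    at infinity. *)
Lemma mills (u : R -> R) : (forall x : R, is_derive x 1 u (- phi x)) ->
  (forall e : R, 0 < e -> exists M : R, forall x, M <= x -> `|u x| <= e) ->
  forall y, 0 < y -> y / (1 + y ^+ 2) * phi y <= u y <= phi y / y.
Proof.
move=> Du u0 y y0.
(* This crude bound suffices for [phi x / x] to vanish at infinity. *)
pose K : R := normal_peak 1.
have phiK x : 0 <= phi x <= K.
  by rewrite normal_pdf_ge0 normal_pdf_ub// oner_neq0.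
have K0 : 0 < K by rewrite normal_peak_gt0 ?oner_eq0.
have vanish e : 0 < e -> exists M : R, forall x, M <= x -> 0 < x /\ phi x / x <= e.
  move=> e0; exists (K / e) => x xM.
  have x0 : 0 < x by apply: lt_le_trans xM; rewrite divr_gt0.
  split=> //; rewrite ler_pdivrMr//; apply: le_trans (_ : K <= _).
    by case/andP: (phiK x).
  by rewrite mulrC -ler_pdivrMr.
apply/andP; split; rewrite -subr_le0.
- apply: (@le_tail_vanish (fun x => x / (1 + x ^+ 2) * phi x - u x)
    (fun x => phi x * (2 / (1 + x ^+ 2) ^+ 2))).
  + move=> x _; have x2 : 1 + x ^+ 2 != 0 by rewrite gt_eqF// ltr_pwDl// sqr_ge0.
    have Dp := is_derive_phi x; have Dx := Du x.
    have Di : is_derive x 1 (fun x : R => (1 + x ^+ 2)^-1) (- (2 * x) / (1 + x ^+ 2) ^+ 2).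
      have D1 : is_derive x 1 (fun x : R => 1 + x ^+ 2) (2 * x).
        by apply: is_derive_eq; rewrite /GRing.scale /=; ring.
      have D2 := @is_deriveV R (fun x => 1 + x ^+ 2) x (2 * x) 1 x2 D1.
      by apply: is_derive_eq; rewrite /GRing.scale /=; field.
    apply: is_derive_eq; rewrite /GRing.scale /=; field.
    by rewrite x2.
  + move=> x _; rewrite mulr_ge0 ?normal_pdf_ge0// divr_ge0// sqr_ge0//.
  + move=> e e0.
    have [M1 uM] := u0 _ (divr_gt0 e0 (ltr0Sn R 1)).
    have [M2 pM] := vanish _ (divr_gt0 e0 (ltr0Sn R 1)).
    exists (Num.max M1 M2) => x; rewrite ge_max => /andP[/uM ux /pM [x0 px]].
    rewrite [leRHS]splitr lerD//; last first.
      by rewrite (le_trans _ ux)// -normrN ler_norm.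
    rewrite (le_trans _ px)// mulrC ler_wpM2l ?normal_pdf_ge0//.
    rewrite ler_pdivrMr ?ltr_pwDl// ?sqr_ge0// ler_pdivlMl// -expr2 lerDr//.
- apply: (@le_tail_vanish (fun x => u x - phi x / x) (fun x => phi x / x ^+ 2)).
  + move=> x yx; have x0 : x != 0 by rewrite gt_eqF// (lt_le_trans y0).
    have Dp := is_derive_phi x; have Dx := Du x.
    have Dv : is_derive x 1 (fun x : R => x^-1) (- x ^- 2).
      have D1 := is_derive_id x (1 : R).
      have D2 := @is_deriveV R id x 1 1 x0 D1.
      by apply: is_derive_eq; rewrite /GRing.scale /=; field.
    apply: is_derive_eq; rewrite /GRing.scale /=; by field.
  + by move=> x _; rewrite divr_ge0 ?normal_pdf_ge0// sqr_ge0.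
  + move=> e e0; have [M1 uM] := u0 _ e0; exists (Num.max M1 1) => x.
    rewrite ge_max => /andP[/uM ux x1].
    rewrite lerBlDr (le_trans (ler_norm _))// (le_trans ux)// lerDl.
    by rewrite divr_ge0 ?normal_pdf_ge0// (le_trans ler01).
Qed.

End gaussian.

(** * Stein's equation *)

Section stein.
Context {R : realType}.
Local Notation phi := (normal_pdf (0 : R) 1).
Local Notation mu := (@lebesgue_measure R).

Definition gauss_primitive (k : R -> R) (y : R) : R :=
  (\int[mu]_(t in `]-oo, y]) (k t * phi t)).

Lemma integrable_bounded_phi (k : R -> R) : continuous k -> bounded_fun (k : R -> R^o) ->
  mu.-integrable setT (EFin \o (fun t => k t * phi t)).
Proof.
move=> ck bk; have := @integrable_normal_pdf R 0 1 => ip.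
apply: eq_integrable (@integrableMr _ _ _ mu setT measurableT k _ _ _ ip) => //.
  exact: continuous_measurable_fun.
Qed.

Lemma is_derive_gauss_primitive (k : R -> R) (x : R) :
  continuous k -> bounded_fun (k : R -> R^o) ->
  is_derive x 1 (gauss_primitive k) (k x * phi x).
Proof.
move=> ck bk.
have [] := @continuous_FTC1 R (fun t => k t * phi t) -oo%O x (x + 1).
- by rewrite ltrDl.
- by apply: integrableS (integrable_bounded_phi ck bk).
- by rewrite ltNyr.
- by apply: cvgM; [exact: ck|exact: continuous_phi].
rewrite derive1E => d1 d2; exact: DeriveDef d1 d2.
Qed.

Lemma bounded_cst1 : bounded_fun ((fun=> 1) : R -> R^o).
Proof. exists 1; split=> // M M1 x _ /=. by rewrite normr1 ltW. Qed.

Local Notation Phi := (gauss_primitive (fun=> 1)).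

(** As a distribution function, the primitive of the density has the limits
    [0] and [1] at infinity. *)
Lemma Phi_cdf (y : R) : (Phi y)%:E = normal_prob (0 : R) 1 `]-oo, y]%classic.
Proof.
rewrite /gauss_primitive /Rintegral /normal_prob.
under eq_integral do rewrite mul1r.
rewrite fineK// ge0_fin_numE; last first.
  by apply: integral_ge0 => x _; rewrite lee_fin normal_pdf_ge0.
apply: le_lt_trans (ltry 1); rewrite -(@integral_normal_pdf R 0 1).
apply: ge0_subset_integral => //; first by apply/measurable_EFinP; exact: measurable_normal_pdf.
by move=> x _; rewrite lee_fin normal_pdf_ge0.
Qed.

Let idR : measurableTypeR R -> R := idfun.

#[local] HB.instance Definition _ :=
  @isMeasurableFun.Build _ _ _ _ idR (@measurable_id _ _ setT).

Lemma Phi_left_tail (e : R) : 0 < e -> exists M : R, forall x, M <= x -> `|Phi (- x)| <= e.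
Proof.
move=> e0.
have H := @cvg_cdfNy0 _ _ R (normal_prob (0 : R) 1) idR.
have {H} /fine_cvgP[_ /= H] : (Phi x)%:E @[x --> -oo] --> (0 : R)%:E.
  by apply: cvg_trans H; apply: near_eq_cvg; near=> x; exact/esym/Phi_cdf.
move: H => /cvgNy_compNP /cvgrPdist_le /(_ _ e0) [M [_ HM]].
exists (M + 1) => x xM; have /= := HM x; rewrite sub0r normrN; apply.
by rewrite (lt_le_trans _ xM)// ltrDl.
Unshelve. all: by end_near. Qed.

Lemma Phi_right_tail (e : R) : 0 < e -> exists M : R, forall x, M <= x -> `|1 - Phi x| <= e.
Proof.
move=> e0.
have H := @cvg_cdfy1 _ _ R (normal_prob (0 : R) 1) idR.
have {H} /fine_cvgP[_ /= H] : (Phi x)%:E @[x --> +oo] --> (1 : R)%:E.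
  by apply: cvg_trans H; apply: near_eq_cvg; near=> x; exact/esym/Phi_cdf.
move: H => /cvgrPdist_le /(_ _ e0) [M [_ HM]].
exists (M + 1) => x xM; have /= := HM x; apply.
by rewrite (lt_le_trans _ xM)// ltrDl.
Unshelve. all: by end_near. Qed.

Lemma bounded_compact_support (f : R -> R) (K : R) : continuous f ->
  (forall y, K <= `|y| -> f y = 0) -> exists2 C, 0 < C & forall y, `|f y| <= C.
Proof.
move=> cf f0; apply: vanishing_bounded cf _ => e e0.
by exists K => y /f0 ->; rewrite normr0 ltW.
Qed.

Lemma bounded_funP (f : R -> R) (C : R) : (forall y, `|f y| <= C) ->
  bounded_fun (f : R -> R^o).
Proof.
move=> fC; exists C; split=> [|M CM x _ /=]; first exact: num_real.
by rewrite (le_trans (fC x))// ltW.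
Qed.

Definition gauss_mean (f : R -> R) : R := (\int[mu]_t (f t * phi t)).

Lemma gauss_mean_cst c : gauss_mean (fun=> c) = c.
Proof.
rewrite /gauss_mean; rewrite RintegralZl//; last exact: integrable_normal_pdf.
by rewrite /Rintegral integral_normal_pdf mulr1.
Qed.

Lemma gauss_meanB (f g : R -> R) : continuous f -> continuous g ->
  bounded_fun (f : R -> R^o) -> bounded_fun (g : R -> R^o) ->
  gauss_mean (fun t => f t - g t) = gauss_mean f - gauss_mean g.
Proof.
move=> cf cg bf bg; rewrite /gauss_mean -RintegralB//.
- by apply: eq_Rintegral => t _; rewrite mulrBl.
- exact: integrable_bounded_phi.
- exact: integrable_bounded_phi.
Qed.

(** For [y] to the left (right) of the support of [f], the primitive of
    [(f - c) * phi] is [- c] ([c]) times a Gaussian tail, so that Mills' ratio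
    controls the solution of Stein's equation at infinity. *)
Lemma stein_solution (f : R -> R) (K : R) : continuous f ->
  (forall y, K <= `|y| -> f y = 0) ->
  exists h : R -> R,
    let dh x := f x - gauss_mean f + x * h x in
    [/\ forall x : R, is_derive x 1 h (dh x),
        vanishes_at_infinity h & vanishes_at_infinity dh].
Proof.
move=> cf f0; set c := gauss_mean f.
have [C C0 fC] := bounded_compact_support cf f0.
have bf := bounded_funP fC.
pose F x := f x - c.
have cF : continuous F by move=> x; apply: cvgB; [exact: cf|exact: cvg_cst].
have bF : bounded_fun (F : R -> R^o).
  apply: (@bounded_funP _ (C + `|c|)) => y.
  by rewrite (le_trans (ler_normB _ _))// lerD2r.
pose H := gauss_primitive F.
have DH (x : R) := is_derive_gauss_primitive x cF bF.
(* The integrating factor of [h' - x h] is the density, as [phi' = - x phi]. *)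
pose h x := H x / phi x.
have phi0 x : phi x != 0 by rewrite gt_eqF// phi_gt0.
have Dh : forall x : R, is_derive x 1 h (f x - c + x * h x).
  move=> x; have DHx := DH x.
  have Dv := @is_deriveV R phi x (- x * phi x) 1 (phi0 x) (is_derive_phi x).
  by apply: is_derive_eq; rewrite /GRing.scale /= /h /F -/H; field.
have one_bd := bounded_cst1.
have c1 : continuous ((fun=> 1) : R -> R) by move=> x; exact: cvg_cst.
have DPhi (x : R) : is_derive x 1 Phi (1 * phi x) by exact: is_derive_gauss_primitive.
have Fint := integrable_bounded_phi cF bF.
have pint := integrable_bounded_phi c1 one_bd.
(* Centering makes the primitive vanish on the right as well as on the left. *)
have Fphi0 : \int[mu]_t (F t * phi t) = 0.
  rewrite -[LHS]/(gauss_mean (fun t => f t - c)) gauss_meanB// ?gauss_mean_cst ?subrr//.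
    by move=> x; exact: cvg_cst.
  by apply: (@bounded_funP _ `|c|).
have itvT : [set` Interval -oo%O +oo%O] = [set: R] by rewrite set_itvE.
have FK y : K <= `|y| -> F y = - c by move=> /f0 Fy; rewrite /F Fy sub0r.
have Hleft y : K <= y -> H (- y) = - c * Phi (- y).
  move=> Ky; rewrite /H /gauss_primitive -RintegralZl//; last first.
    exact: integrableS pint.
  apply: eq_Rintegral => t; rewrite inE /= in_itv /= => ty.
  by rewrite FK ?mul1r//; rewrite (le_trans Ky)// ler_normr; apply/orP; right; lra.
have tailE k y : mu.-integrable setT (EFin \o (fun t => k t * phi t)) ->
    \int[mu]_(t in `]y, +oo[) (k t * phi t) = \int[mu]_t (k t * phi t) - gauss_primitive k y.
  move=> ki; rewrite /gauss_primitive -itvT Rintegral_itvB//.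
  by rewrite itvT.
have Hright y : K <= y -> H y = c * (1 - Phi y).
  move=> Ky; have := tailE _ y Fint; rewrite Fphi0 sub0r -/H => /eqP.
  rewrite eq_sym eqr_oppLR => /eqP ->.
  have := tailE _ y pint; rewrite -/(gauss_mean _) gauss_mean_cst => <-.
  have -> : \int[mu]_(t in `]y, +oo[) (F t * phi t) =
      - c * \int[mu]_(t in `]y, +oo[) (1 * phi t).
    rewrite -RintegralZl//; last by apply: integrableS pint.
    apply: eq_Rintegral => t; rewrite inE /= in_itv /= andbT => ty.
    by rewrite FK ?mul1r// (le_trans Ky)// ler_normr (ltW ty).
  by rewrite mulNr opprK.
have DR : forall x : R, is_derive x 1 (fun y => 1 - Phi y) (- phi x).
  move=> x; have D1 := DPhi x; apply: is_derive_eq; rewrite /GRing.scale /=; ring.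
have DL : forall x : R, is_derive x 1 (fun y => Phi (- y)) (- phi x).
  move=> x; have Dn : is_derive x 1 (fun y : R => - y) (-1) by apply: is_derive_eq.
  have D1 := is_derive1_comp (DPhi (- x)) Dn.
  apply: is_derive_eq; rewrite mul1r mulrN1; congr (- _).
  by rewrite !phiE sqrrN.
have mR := mills DR (@Phi_right_tail).
have mL := mills DL (@Phi_left_tail).
have phiN y : phi (- y) = phi y by rewrite !phiE sqrrN.
pose L := Num.max K 1.
(* [T] is a Gaussian tail at [t]. Both ends of Mills' ratio are required: the
   upper one bounds [h], the lower one bounds the cancellation [1 - t * T / phi t]
   in the derivative of [h]. *)
have bnd t T : 1 <= t -> t / (1 + t ^+ 2) * phi t <= T <= phi t / t ->
   `|T / phi t| <= t^-1 /\ `|1 - t * (T / phi t)| <= t^-1.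
  move=> t1 /andP[Tl Tu]; have t0 : 0 < t by apply: lt_le_trans t1.
  have p0 := phi_gt0 t.
  have l : t / (1 + t ^+ 2) <= T / phi t by rewrite ler_pdivlMr.
  have u : T / phi t <= t^-1 by rewrite ler_pdivrMr// mulrC.
  have t2 : 0 < 1 + t ^+ 2 by rewrite ltr_pwDl// sqr_ge0.
  have l0 : 0 <= t / (1 + t ^+ 2) by rewrite divr_ge0// ltW.
  split; first by rewrite ger0_norm// (le_trans l0).
  have tu : t * (T / phi t) <= 1 by rewrite mulrC -ler_pdivlMr// mul1r.
  rewrite ger0_norm ?subr_ge0//.
  apply: (@le_trans _ _ (1 - t * (t / (1 + t ^+ 2)))).
    by rewrite lerD2l lerN2 ler_wpM2l// ltW.
  have -> : 1 - t * (t / (1 + t ^+ 2)) = (1 + t ^+ 2)^-1 by field; rewrite gt_eqF.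
  rewrite lef_pV2 ?posrE// expr2; apply: (@le_trans _ _ (t * t)); last by rewrite lerDr.
  by rewrite ler_peMr// ltW.
have hbnd y : L <= `|y| -> `|h y| <= `|c| / `|y| /\ `|f y - c + y * h y| <= `|c| / `|y|.
  rewrite ge_max => /andP[Ky y1]; rewrite f0// sub0r.
  have y0 : y != 0 by rewrite -normr_gt0 (lt_le_trans _ y1).
  have [yp|yn] := leP 0 y.
    rewrite !(ger0_norm yp) in Ky y1 *.
    have [b1 b2] := bnd _ _ y1 (mR _ (lt_le_trans ltr01 y1)).
    have hE : h y = c * ((1 - Phi y) / phi y) by rewrite /h Hright// mulrA.
    rewrite hE; split; first by rewrite normrM ler_wpM2l.
    set T := (1 - Phi y) / phi y in b1 b2 *.
    rewrite (_ : - c + y * (c * T) = - c * (1 - y * T)); last by ring.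
    by rewrite normrM normrN ler_wpM2l.
  rewrite !(ltr0_norm yn) in Ky y1 *.
  have [b1 b2] := bnd _ _ y1 (mL _ (lt_le_trans ltr01 y1)).
  have hE : h y = - c * (Phi y / phi y).
    by rewrite /h -{1}(opprK y) (Hleft _ Ky) opprK mulrA.
  rewrite phiN opprK in b1 b2; rewrite hE.
  split; first by rewrite normrM normrN ler_wpM2l.
  set T := Phi y / phi y in b1 b2 *.
  rewrite (_ : - c + y * (- c * T) = - c * (1 - - y * T)); last by ring.
  by rewrite normrM normrN ler_wpM2l.
have vanish k : (forall y, L <= `|y| -> `|k y| <= `|c| / `|y|) -> vanishes_at_infinity k.
  move=> kc e e0; exists (Num.max L (`|c| / e)) => y; rewrite ge_max => /andP[Ly cy].
  have y0 : 0 < `|y| by apply: lt_le_trans Ly; rewrite lt_max ltr01 orbT.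
  by rewrite (le_trans (kc _ Ly))// ler_pdivrMr// -ler_pdivrMl// mulrC.
exists h; split=> //.
- by apply: vanish => y /hbnd[].
- by apply: vanish => y /hbnd[].
Qed.

(** A primitive on the right half line, from an integrand frozen at its value
    [0] on the left. Two of these glue to a primitive on the line. *)
Let right_primitive (k : R -> R) : continuous k -> k 0 = 0 ->
  exists g : R -> R, forall x : R, is_derive x 1 g (k (Num.max x 0)).
Proof.
move=> ck k0; pose k1 t := k (Num.max t 0).
have ck1 : continuous k1.
  move=> t; apply: (@continuous_comp _ _ _ (fun t : R => Num.max t 0)); last exact: ck.
  by apply: continuous_max; [exact: cvg_id|exact: cvg_cst].
exists (fun x => \int[mu]_(t in `]-oo, x]) k1 t) => x.
have [] := @continuous_FTC1 R k1 -oo%O x (x + 1).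
- by rewrite ltrDl.
- apply/integrable_mkcond => //.
  have := @continuous_compact_integrable R k1 `[0, x + 1]%classic (@segment_compact _ _ _)
    (continuous_subspaceT ck1).
  move=> /(integrable_mkcond _ _) => /(_ (measurable_itv _)).
  apply: eq_integrable => // t _; rewrite !patchE /= !mem_setE !in_itv /=.
  have [t0|t0] := leP 0 t => //=.
  by case: ifP => // _; rewrite /k1 (max_idPr (ltW t0)) k0.
- by rewrite ltNyr.
- exact: ck1.
by rewrite derive1E => d1 d2; exact: DeriveDef d1 d2.
Qed.

Lemma antiderivative (h : R -> R) : continuous h ->
  exists g : R -> R, forall x : R, is_derive x 1 g (h x).
Proof.
move=> ch.
have cr : continuous (fun t => h t - h 0).
  by move=> t; apply: cvgB; [exact: ch|exact: cvg_cst].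
have cl : continuous (fun t => h (- t) - h 0).
  move=> t; apply: cvgB; last exact: cvg_cst.
  apply: (@continuous_comp _ _ _ (fun t : R => - t)); last exact: ch.
  exact: opp_continuous.
have [|gr Dr] := right_primitive cr; first by rewrite subrr.
have [|gl Dl] := right_primitive cl; first by rewrite oppr0 subrr.
exists (fun x => gr x - gl (- x) + h 0 * x) => x.
have D1 := Dr x.
have Dn : is_derive x 1 (fun y : R => - y) (-1) by apply: is_derive_eq.
have D2 := is_derive1_comp (Dl (- x)) Dn.
apply: is_derive_eq; rewrite /GRing.scale /=.
have [x0|x0] := leP 0 x.
  by rewrite max_r ?oppr_le0// oppr0; ring.
by rewrite max_l ?oppr_ge0 ?ltW// opprK; ring.
Qed.

(** A test function [g] with [g' = h] for the generator [g'' - y g'] of the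
    Ornstein-Uhlenbeck process. The Taylor bound has a remainder [o(t ^+ 2)],
    uniform in [y], for small [t] and [O(t ^+ 2)] for large [t]: this is what
    finite second moments of the increments can control. *)
Lemma stein_test_function (f : R -> R) (K : R) : continuous f ->
  (forall y, K <= `|y| -> f y = 0) ->
  exists g h dh : R -> R, exists2 C, 0 < C &
    [/\ [/\ continuous g, continuous h & continuous dh],
        forall x, `|g x| <= C * (1 + `|x|),
        forall x, `|h x| <= C /\ `|dh x| <= C,
        forall x, dh x - x * h x = f x - gauss_mean f &
        forall e, 0 < e -> exists2 eta, 0 < eta & forall y t,
          `|g (y + t) - g y - h y * t - dh y * t ^+ 2 / 2|
            <= e * t ^+ 2 + C * t ^+ 2 * (eta < `|t|)%R%:R].
Proof.
move=> cf f0; have [h [Dh hv dhv]] := stein_solution cf f0.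
have [Cf Cf0 fC] := bounded_compact_support cf f0.
pose dh x := f x - gauss_mean f + x * h x.
have ch : continuous h := derive_continuous Dh.
have cdh : continuous dh.
  move=> x; apply: cvgD; last by apply: cvgM; [exact: cvg_id|exact: ch].
  by apply: cvgB; [exact: cf|exact: cvg_cst].
have [g Dg] := antiderivative ch.
have [C1 C10 hC] := vanishing_bounded ch hv.
have [C2 C20 dhC] := vanishing_bounded cdh dhv.
pose c := gauss_mean f.
pose C := `|g 0| + C1 + C2 + C2 + Cf + `|c|.
have g00 := normr_ge0 (g 0); have c0 := normr_ge0 c.
have C0 : 0 < C by rewrite /C; lra.
exists g, h, dh, C => //; split.
- by split=> //; exact: derive_continuous Dg.
- move=> x; have [z _] := MVT_between 0 x Dg; rewrite subr0 => /eqP; rewrite subr_eq => /eqP ->.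
  rewrite (le_trans (ler_normD _ _))// normrM.
  have : `|h z| * `|x| <= C1 * `|x| by rewrite ler_wpM2r.
  have := normr_ge0 x; rewrite /C; nra.
- by move=> x; split; [rewrite (le_trans (hC x))// /C; lra|rewrite (le_trans (dhC x))// /C; lra].
- by move=> x; rewrite /dh addrK.
- move=> e e0; have [eta eta0 H] := vanishing_unif_continuous cdh dhv e0.
  exists eta => // y t; have [tl|tl] := leP `|t| eta.
    rewrite mulr0 addr0; apply: (taylor2 Dg Dh) => z zt; apply: H.
    by rewrite addrC addKr (le_trans zt).
  rewrite mulr1; apply: (@le_trans _ _ ((C2 + C2) * t ^+ 2)).
    apply: (taylor2 Dg Dh) => z _; rewrite (le_trans (ler_normB _ _))//; exact: lerD (dhC _) (dhC _).
  by rewrite -mulrDl ler_wpM2r ?sqr_ge0// /C; lra.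
Qed.

(** The normal law is defined through its density, which is therefore its
    Radon-Nikodym derivative. *)
Lemma integral_normal_prob (f : R -> R) : continuous f -> bounded_fun (f : R -> R^o) ->
  gaussian_mean f = gauss_mean f.
Proof.
move=> cf bf; rewrite /gaussian_mean /gauss_mean /Rintegral unlock; congr fine.
have mf := continuous_measurable_fun cf.
have dom := @normal_prob_dominates R 0 1.
have fi : (normal_prob (0 : R) 1).-integrable setT (EFin \o f).
  apply: measurable_bounded_integrable => //.
  by rewrite (le_lt_trans (probability_le1 _ _))// ltry.
rewrite -(Radon_Nikodym_change_of_variables dom)//=.
apply: ae_eq_integral => //.
- apply: emeasurable_funM; first exact/measurable_EFinP.
  by apply: measurable_int; apply: Radon_Nikodym_integrable.
- apply/measurable_EFinP; apply: measurable_funM => //; exact: measurable_normal_pdf.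
- under [X in ae_eq _ _ _ X]eq_fun do rewrite EFinM.
  apply: ae_eqe_mul2l => /=.
  rewrite Radon_NikodymE//= ; case: cid => /= k [k1 k2 k3].
  apply: integral_ae_eq => //=.
  + apply/measurable_EFinP; exact: measurable_normal_pdf.
  + by move=> E _ mE; rewrite -k3.
Qed.

End stein.

(** * Independence of generated sigma-algebras *)

Section independence.
Context {d : measure_display} {T : measurableType d} {R : realType}.
Variable P : probability T R.

(** Both sides are finite measures in [A], so they agree on the sigma-algebra as
    soon as they agree on a generating pi-system. *)
Lemma pi_system_independent (G : set (set T)) (B : set T) :
  G `<=` measurable -> setI_closed G -> G setT -> measurable B ->
  (forall A, G A -> P (A `&` B) = (P A * P B)%E) ->
  forall A, <<s G >> A -> P (A `&` B) = (P A * P B)%E.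
Proof.
move=> Gm GI GT mB GB A sA.
have PB0 : (0 <= fine (P B)) by rewrite fine_ge0.
pose r : {nonneg R} := NngNum PB0.
have Er E : mscale r P E = (P E * P B)%E.
  by rewrite /mscale /= muleC fineK// fin_num_measure.
rewrite -Er.
apply: (@g_sigma_algebra_measure_unique _ _ _ G Gm (fun=> setT) (fun=> GT) _
   (mrestr P mB) (mscale r P)) => //.
- by apply/seteqP; split=> // x _; exists 0%N.
- by move=> E GE; rewrite /= Er /mrestr GB.
- by move=> _; rewrite (le_lt_trans (probability_le1 _ _)) ?ltry//; exact: measurableI.
Qed.

Variables (I : eqType) (D : set I) (F : I -> set (set T)).
Hypothesis indep : mutually_independent P D F.
Hypothesis Fm : forall i, D i -> F i `<=` measurable.
Hypothesis FT : forall i, D i -> F i setT.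
Hypothesis FI : forall i, D i -> setI_closed (F i).

(** The finite intersections of events of the indices in [E]: a pi-system
    generating their joint sigma-algebra, to which mutual independence applies
    directly. *)
Definition cylinders (E : set I) : set (set T) := [set B | exists (s : seq I) (A : I -> set T),
  [/\ uniq s, forall i, i \in s -> E i /\ F i (A i) & B = \bigcap_(i in [set` s]) A i]].

Lemma cylinders_setT E : cylinders E setT.
Proof. by exists [::], (fun=> setT); split=> //; apply/seteqP; split. Qed.
Lemma cylinders_measurable E : E `<=` D -> cylinders E `<=` measurable.
Proof.
move=> ED _ [s [A [us sA ->]]]; elim: s us sA => [|i s IH] /=.
  move=> _ _; rewrite (_ : \bigcap_(_ in _) _ = setT)//.
  by apply/seteqP; split.
move=> /andP[_ us] sA; rewrite (_ : \bigcap_(_ in _) _ = A i `&` \bigcap_(j in [set` s]) A j).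
  apply: measurableI; last by apply: IH => // j js; apply: sA; rewrite inE js orbT.
  have [Ei Fi] := sA i (mem_head _ _); exact: Fm (ED _ Ei) _ Fi.
apply/seteqP; split=> x.
  move=> H; split; first by apply: H => /=; rewrite mem_head.
  by move=> j /= js; apply: H; rewrite /= inE js orbT.
by move=> [Aix H] j /=; rewrite inE => /predU1P[->//|/H].
Qed.

Lemma cylinders_setI E : E `<=` D -> setI_closed (cylinders E).
Proof.
move=> ED _ _ [s [A [us sA ->]]] [t [B [ut tB ->]]].
exists (undup (s ++ t)), (fun i => (if i \in s then A i else setT) `&` (if i \in t then B i else setT)).
split; first exact: undup_uniq.
- move=> i; rewrite mem_undup mem_cat => ist.
  have Ei : E i by move: ist => /orP[/sA[]|/tB[]].
  split=> //; apply: FI; first exact: ED.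
  + by case: ifPn => [/sA[]//|_]; apply: FT; exact: ED.
  + by case: ifPn => [/tB[]//|_]; apply: FT; exact: ED.
- apply/seteqP; split=> x.
  + move=> [Ax Bx] i /= _; split.
      by case: ifPn => // is_; exact: Ax.
    by case: ifPn => // it; exact: Bx.
  + move=> ABx; split=> i /= ii.
      by have := ABx i; rewrite /= mem_undup mem_cat ii /= => /(_ isT)[].
    by have := ABx i; rewrite /= mem_undup mem_cat ii orbT /= => /(_ isT)[].
Qed.

(** Both cylinders are made of distinct indices, so the product rule applies
    to their concatenation. *)
Lemma cylinders_independent (E1 E2 : set I) : E1 `<=` D -> E2 `<=` D ->
  (forall i, E1 i -> ~ E2 i) -> forall A B, cylinders E1 A -> cylinders E2 B ->
  P (A `&` B) = (P A * P B)%E.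
Proof.
move=> E1D E2D E12 _ _ [s [A [us sA ->]]] [t [B [ut tB ->]]].
pose C i := if i \in s then A i else B i.
have st i : i \in t -> i \in s = false.
  by move=> /tB[E2i _]; apply/negP => /sA[E1i _]; exact: E12 E2i.
have -> : \bigcap_(i in [set` s]) A i `&` \bigcap_(i in [set` t]) B i =
    \bigcap_(i in [set` s ++ t]) C i.
  apply/seteqP; split=> x.
    move=> [Ax Bx] i /=; rewrite mem_cat /C; case: ifPn => [is_ _|_ /= it]; [exact: Ax|exact: Bx].
  move=> Cx; split=> i /= ii; have := Cx i; rewrite /= mem_cat /C.
    by rewrite ii => /(_ isT).
  by rewrite ii orbT st// => /(_ isT).
rewrite (indep (s := s ++ t)); first last.
- move=> i; rewrite mem_cat /C; case: ifPn => [/sA[/E1D]//|_ /= /tB[/E2D]//].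
- rewrite cat_uniq us ut andbT; apply/hasPn => i /= /st -> //.
rewrite big_cat /= (indep us); last by move=> i /sA[/E1D].
rewrite (indep ut); last by move=> i /tB[/E2D].
congr (_ * _)%E; apply: eq_big_seq => i ii; rewrite /C ?ii ?st//.
Qed.

End independence.

Section product_expectation.
Context {d : measure_display} {T : measurableType d} {R : realType}.
Variable P : probability T R.

(** Fubini's theorem for the joint law, which is a product measure because it
    agrees with it on rectangles. *)
Lemma independent_expectation_mul (X Y : T -> R) :
  measurable_fun setT X -> measurable_fun setT Y ->
  (forall w, 0 <= X w) -> (forall w, 0 <= Y w) ->
  (forall A B, measurable A -> measurable B ->
     P (X @^-1` A `&` Y @^-1` B) = (P (X @^-1` A) * P (Y @^-1` B))%E) ->
  (\int[P]_w (X w * Y w)%:E = (\int[P]_w (X w)%:E) * (\int[P]_w (Y w)%:E))%E.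
Proof.
move=> mX mY X0 Y0 XY.
pose X' : {mfun T >-> R} := mfun_Sub (mem_set mX).
pose Y' : {mfun T >-> R} := mfun_Sub (mem_set mY).
have mXY : measurable_fun setT (fun w => (X w, Y w)) by apply: measurable_fun_pair.
pose XY' : {mfun T >-> (R * R)%type} := mfun_Sub (mem_set mXY).
pose m1 := distribution P X'; pose m2 := distribution P Y'.
pose f (z : R * R) : \bar R := (Num.max 0 z.1 * Num.max 0 z.2)%:E.
have mf : measurable_fun setT f.
  apply/measurable_EFinP; apply: measurable_funM; apply: measurable_maxr.
  - exact: measurable_cst.
  - exact: measurable_fst.
  - exact: measurable_cst.
  - exact: measurable_snd.
have f0 z : (0 <= f z)%E by rewrite lee_fin mulr_ge0 ?le_max ?lexx.
have E1 : (\int[distribution P XY']_z f z = \int[P]_w (X w * Y w)%:E)%E.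
  rewrite ge0_integral_distribution//; apply: eq_integral => w _ /=.
  by rewrite /f /= !max_r.
have E2 : (\int[distribution P XY']_z f z = \int[m1 \x m2]_z f z)%E.
  apply: eq_measure_integral => A mA _; apply/esym.
  apply: (@product_measure_unique _ _ _ _ _ m1 m2) => //.
rewrite -E1 E2 fubini_tonelli1//.
have g0 r : (0 <= (Num.max 0 r)%:E :> \bar R)%E by rewrite lee_fin le_max lexx.
have mg : measurable_fun setT (fun r : R => (Num.max 0 r)%:E).
  by apply/measurable_EFinP; apply: measurable_maxr.
transitivity (\int[m1]_x ((Num.max 0 x)%:E * \int[m2]_y (Num.max 0 y)%:E))%E.
  apply: eq_integral => x _; rewrite /fubini_F /f /=.
  under eq_integral do rewrite EFinM.
  by rewrite ge0_integralZl.
rewrite ge0_integralZr//; last by apply: integral_ge0.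
by congr (_ * _)%E; rewrite ge0_integral_distribution//; apply: eq_integral => w _ /=;
  rewrite max_r.
Qed.

End product_expectation.

(** * One reinforced step given the past *)

Section sigma_independence.
Context {d : measure_display} {T : measurableType d} {R : realType}.
Variable P : probability T R.
Variables (I : eqType) (D : set I) (F : I -> set (set T)).
Hypothesis indep : mutually_independent P D F.
Hypothesis Fm : forall i, D i -> F i `<=` measurable.
Hypothesis FT : forall i, D i -> F i setT.
Hypothesis FI : forall i, D i -> setI_closed (F i).

Definition adapted_to (E : set I) (Phi : T -> R) :=
  measurable_fun (setT : set (g_sigma_algebraType (cylinders F E))) (Phi : g_sigma_algebraType (cylinders F E) -> R).

Lemma cylinders1 (E : set I) i : E i -> F i `<=` cylinders F E.
Proof.
move=> Ei A FA; exists [:: i], (fun=> A); split=> //.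
- by move=> j; rewrite inE => /eqP ->.
- by apply/seteqP; split=> x; [move=> Ax j _|apply; rewrite /= inE].
Qed.

Lemma sigma_cylinders_measurable E : E `<=` D -> <<s cylinders F E >> `<=` measurable.
Proof.
move=> ED; apply: smallest_sub; first exact: sigma_algebra_measurable.
exact: cylinders_measurable ED.
Qed.

Lemma cylindersS E1 E2 : E1 `<=` E2 -> cylinders F E1 `<=` cylinders F E2.
Proof.
move=> E12 _ [s [A [us sA ->]]]; exists s, A; split=> // i /sA[/E12 ? ?]; by split.
Qed.

Lemma adapted_toS E1 E2 Phi : E1 `<=` E2 -> adapted_to E1 Phi -> adapted_to E2 Phi.
Proof.
move=> E12 mPhi _ B mB; have := mPhi measurableT B mB.
by apply: sub_sigma_algebra2; exact: cylindersS.
Qed.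

Lemma adapted_measurable E Phi : E `<=` D -> adapted_to E Phi -> measurable_fun setT Phi.
Proof.
by move=> ED mPhi _ B mB; apply: sigma_cylinders_measurable ED _ _; exact: mPhi.
Qed.

(** Two applications of uniqueness of measures, one for each factor. *)
Lemma sigma_independent E1 E2 A B : E1 `<=` D -> E2 `<=` D ->
  (forall i, E1 i -> ~ E2 i) -> <<s cylinders F E1 >> A -> <<s cylinders F E2 >> B ->
  P (A `&` B) = (P A * P B)%E.
Proof.
move=> E1D E2D E12 sA sB.
have cT E := cylinders_setT F E.
have cI := cylinders_setI FT FI; have cm := cylinders_measurable Fm.
apply: (pi_system_independent (cm _ E1D) (cI _ E1D) (cT E1)) sA.
  exact: sigma_cylinders_measurable sB.
move=> {}A cA; rewrite setIC muleC.
apply: (pi_system_independent (cm _ E2D) (cI _ E2D) (cT E2)) sB; first exact: cm cA.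
move=> {}B cB; rewrite setIC muleC.
exact: (cylinders_independent indep E1D E2D E12).
Qed.

Lemma adapted_expectation_mul E1 E2 (X Y : T -> R) : E1 `<=` D -> E2 `<=` D ->
  (forall i, E1 i -> ~ E2 i) -> adapted_to E1 X -> adapted_to E2 Y ->
  (forall w, 0 <= X w) -> (forall w, 0 <= Y w) ->
  (\int[P]_w (X w * Y w)%:E = (\int[P]_w (X w)%:E) * (\int[P]_w (Y w)%:E))%E.
Proof.
move=> E1D E2D E12 aX aY X0 Y0; apply: independent_expectation_mul => //.
- exact: adapted_measurable aX.
- exact: adapted_measurable aY.
move=> A B mA mB; apply: (sigma_independent E1D E2D E12).
  by have := aX measurableT A mA; rewrite setTI.
by have := aY measurableT B mB; rewrite setTI.
Qed.

End sigma_independence.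

Section history.
Context {R : realType}.

Lemma history_out (g : R -> R) x e u n j : ~~ (0 < j <= n)%N -> history g x e u n j = 0.
Proof.
elim: n => [//|n IH] /=; case: eqVneq => [->|jn nj]; first by rewrite leqnn.
by apply: IH; apply: contra nj => /andP[-> /leqW ->].
Qed.

(** The recursion with the random index spelled out as a sum over its values;
    it holds surely as [psi 0 = 0]. *)
Lemma reinforced_step_sum (psi g : R -> R) x e u k : (1 <= k)%N -> psi 0 = 0 -> g 0 = 0 ->
  psi (reinforced_step g x e u k.+1) = (~~ e k.+1)%:R * psi (x k.+1) +
   \sum_(1 <= j < k.+1) (e k.+1 && (u k.+1 == j))%:R * psi (g (reinforced_step g x e u j)).
Proof.
move=> k1 psi0 g0; rewrite /reinforced_step -/(reinforced_step g x e u) /= eqxx k1 /=.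
case: (e k.+1) => /=; last first.
  by rewrite mul1r big1 ?addr0// => j _; rewrite mul0r.
rewrite mul0r add0r.
have [uk|uk] := boolP (0 < u k.+1 <= k)%N.
  rewrite (bigD1_seq (u k.+1)) ?iota_uniq ?mem_index_iota ?ltnS//= eqxx mul1r.
  rewrite history_step// big1 ?addr0// => j; rewrite eq_sym => /negbTE ->.
  by rewrite mul0r.
rewrite history_out// g0 psi0 big_nat_cond big1// => j /andP[jk _].
case: eqVneq => [uj|]; last by rewrite mul0r.
by move: uk; rewrite uj -ltnS jk.
Qed.

End history.

Lemma measurable_sum_in d (T : measurableType d) (R : realType) (D : set T)
    (I : eqType) (r : seq I) (h : I -> T -> R) :
  (forall i, i \in r -> measurable_fun D (h i)) ->
  measurable_fun D (fun x => \sum_(i <- r) h i x).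
Proof.
elim: r => [|i r IH] hm.
  by under eq_fun do rewrite big_nil; exact: measurable_cst.
under eq_fun do rewrite big_cons; apply: measurable_funD.
  by apply: hm; rewrite mem_head.
by apply: IH => j jr; apply: hm; rewrite inE jr orbT.
Qed.

Section reinforced_model.
Context {d : measure_display} {T : measurableType d} {R : realType}.
Variables (P : probability T R) (X : nat -> {RV P >-> R})
  (eps : nat -> {RV P >-> bool}) (U : nat -> {RV P >-> nat}) (p : R).
Hypotheses (hp : 0 <= p < 1) (hin : reinforcement_inputs X eps U p).
Variables (g : R -> R) (s : R).
Hypothesis gE : forall x, g x = s * x.

Definition input_time (i : nat + nat + nat) : nat :=
  match i with inl (inl n) => n | inl (inr n) => n | inr n => n end.

Definition past (k : nat) : set (nat + nat + nat) :=
  [set i | input_index i /\ (input_time i <= k)%N].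

Definition present (k : nat) : set (nat + nat + nat) :=
  [set i | input_index i /\ input_time i = k].

Local Notation F := (input_sigma X eps U).

Definition step (n : nat) (w : T) : R := reinforced_step g (X ^~ w) (eps ^~ w) (U ^~ w) n.

Lemma input_sigma_measurable i : F i `<=` measurable.
Proof.
case: i => [[n|n]|n] _ [B mB <-] /=; rewrite setTI -[X in measurable X]setTI;
  exact: measurable_funPT.
Qed.

Lemma input_sigmaT i : F i setT.
Proof. by case: i => [[n|n]|n]; exists setT => //; rewrite preimage_setT setTI. Qed.

Lemma input_sigmaI i : setI_closed (F i).
Proof.
by case: i => [[n|n]|n] _ _ [A mA <-] [B mB <-]; exists (A `&` B) => //;
  rewrite ?setTI ?preimage_setI//; exact: measurableI.
Qed.

Lemma past_index k : past k `<=` input_index. Proof. by move=> i []. Qed.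
Lemma present_index k : present k `<=` input_index. Proof. by move=> i []. Qed.
Lemma past_present k i : past k i -> ~ present k.+1 i.
Proof. by move=> [_ ik] [_ ik1]; move: ik; rewrite ik1 ltnn. Qed.

Definition adapted k (Phi : T -> R) := adapted_to F (past k) Phi.

Lemma adaptedS j k Phi : (j <= k)%N -> adapted j Phi -> adapted k Phi.
Proof.
by move=> jk; apply: adapted_toS => i [ii ij]; split=> //; exact: leq_trans jk.
Qed.

Lemma adapted_meas k Phi : adapted k Phi -> measurable_fun setT Phi.
Proof.
apply: adapted_measurable; last exact: past_index.
by move=> i _; exact: input_sigma_measurable.
Qed.

Lemma adapted_X E n : E (inl (inl n)) -> adapted_to F E (X n).
Proof.
move=> En _ B mB; apply: sub_sigma_algebra; apply: cylinders1 En _ _.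
by exists B.
Qed.

Lemma adapted_eps E n (h : bool -> R) : E (inl (inr n)) -> adapted_to F E (fun w => h (eps n w)).
Proof.
move=> En _ B mB; apply: sub_sigma_algebra; apply: cylinders1 En _ _.
by exists (h @^-1` B).
Qed.

Lemma adapted_U E n (h : nat -> R) : E (inr n) -> adapted_to F E (fun w => h (U n w)).
Proof.
move=> En _ B mB; apply: sub_sigma_algebra; apply: cylinders1 En _ _.
by exists (h @^-1` B).
Qed.

Let g0 : g 0 = 0. Proof. by rewrite gE mulr0. Qed.

(** Each summand is a function of the past times a function of the inputs at
    time [k.+1], so that independence applies to it. *)
Lemma step_sum (psi : R -> R) k w : (1 <= k)%N -> psi 0 = 0 ->
  psi (step k.+1 w) = (~~ eps k.+1 w)%:R * psi (X k.+1 w) +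
   \sum_(1 <= j < k.+1) (eps k.+1 w)%:R * (U k.+1 w == j)%:R * psi (s * step j w).
Proof.
move=> k1 psi0; rewrite /step (reinforced_step_sum _ _ _ k1 psi0 g0).
by congr (_ + _); apply: eq_bigr => j _; rewrite gE -mulnb natrM.
Qed.

Lemma adapted_step k : (1 <= k)%N -> adapted k (step k).
Proof.
elim/ltn_ind: k => -[//|[|k]] IH _.
  by apply: adapted_X; split.
have -> : step k.+2 = (fun w => (~~ eps k.+2 w)%:R * X k.+2 w +
   \sum_(1 <= j < k.+2) (eps k.+2 w)%:R * (U k.+2 w == j)%:R * (s * step j w)).
  by apply/funext => w; rewrite -[LHS]/(id (step k.+2 w)) step_sum.
rewrite /adapted /adapted_to; apply: measurable_funD.
  apply: measurable_funM; last by apply: adapted_X; split.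
  by apply: (adapted_eps (fun b => (~~ b)%:R)); split.
apply: measurable_sum_in => j; rewrite mem_index_iota => /andP[j1 jk].
apply: measurable_funM; last first.
  by apply: measurable_funM => //; apply: adaptedS (IH _ jk j1); exact: ltnW.
apply: measurable_funM.
  by apply: (adapted_eps (fun b => b%:R)); split.
by apply: (adapted_U (fun b => (b == j)%:R)); split.
Qed.

Lemma integral_bool (b : T -> bool) : measurable [set w | b w] ->
  (\int[P]_w ((b w)%:R : R)%:E)%E = P [set w | b w].
Proof.
move=> mb; rewrite -[in RHS](setIT [set w | b w]) -integral_indic//.
by apply: eq_integral => w _; rewrite indicE mem_setE.
Qed.

Let distribution_eps n b : (2 <= n)%N ->
  P [set w | eps n w == b] = (if b then p else 1 - p)%:E.
Proof.
move=> n2; have -> : [set w | eps n w == b] = eps n @^-1` [set b].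
  by apply/seteqP; split=> w /= /eqP.
have := eps_bernoulli hin n2 (A := [set b]) I; rewrite /distribution /pushforward => ->.
rewrite bernoulli_probE; last by case/andP: hp => -> /ltW ->.
rewrite !diracE; case: b.
  by rewrite (mem_set (erefl true : [set true] true)) memNset// mule1 mule0 adde0.
by rewrite (mem_set (erefl false : [set false] false)) memNset// mule1 mule0 add0e.
Qed.

Lemma integral_eps n : (2 <= n)%N -> (\int[P]_w ((eps n w)%:R : R)%:E)%E = p%:E.
Proof.
move=> n2; rewrite -(distribution_eps true n2) integral_bool.
  by congr (P _); apply/seteqP; split=> w /= /eqP.
by rewrite -[X in measurable X]setTI; exact: measurable_funPT.
Qed.

Lemma integral_neps n : (2 <= n)%N -> (\int[P]_w ((~~ eps n w)%:R : R)%:E)%E = (1 - p)%:E.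
Proof.
move=> n2; rewrite -(distribution_eps false n2) integral_bool.
  by congr (P _); apply/seteqP; split=> w /=; case: (eps n w).
rewrite (_ : [set w | _] = eps n @^-1` [set false]).
  by rewrite -[X in measurable X]setTI; exact: measurable_funPT.
by apply/seteqP; split=> w /=; case: (eps n w).
Qed.

Lemma integral_U n j : (2 <= n)%N -> (1 <= j <= n.-1)%N ->
  (\int[P]_w ((U n w == j)%:R : R)%:E)%E = ((n.-1)%:R^-1)%:E.
Proof.
move=> n2 jn; rewrite -(U_uniform hin n2 jn) integral_bool.
  by congr (P _); apply/seteqP; split=> w /= /eqP.
rewrite (_ : [set w | _] = U n @^-1` [set j]).
  by rewrite -[X in measurable X]setTI; exact: measurable_funPT.
by apply/seteqP; split=> w /= /eqP.
Qed.

Lemma integral_X (psi : R -> R) n : (1 <= n)%N -> measurable_fun setT psi ->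
  (forall x, 0 <= psi x) ->
  (\int[P]_w (psi (X n w))%:E = \int[P]_w (psi (X 1%N w))%:E)%E.
Proof.
move=> n1 mpsi psi0.
have H m : (\int[P]_w (psi (X m w))%:E = \int[distribution P (X m)]_x (psi x)%:E)%E.
  by rewrite ge0_integral_distribution//; exact/measurable_EFinP.
rewrite !H; apply: eq_measure_integral => A mA _.
exact: (X_identically_distributed hin).
Qed.

Let Fm i : input_index i -> F i `<=` measurable := fun _ => @input_sigma_measurable i.
Let FTi i : input_index i -> F i setT := fun _ => @input_sigmaT i.
Let FIi i : input_index i -> setI_closed (F i) := fun _ => @input_sigmaI i.

Let expectation_mul := adapted_expectation_mul (inputs_independent hin) Fm FTi FIi.

Lemma integral_past_present k (Phi Y : T -> R) : adapted k Phi ->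
  adapted_to F (present k.+1) Y -> (forall w, 0 <= Phi w) -> (forall w, 0 <= Y w) ->
  (\int[P]_w (Phi w * Y w)%:E = (\int[P]_w (Phi w)%:E) * (\int[P]_w (Y w)%:E))%E.
Proof.
move=> aP aY; apply: (expectation_mul _ _ _ aP aY).
- exact: past_index.
- exact: present_index.
- exact: past_present.
Qed.

Lemma integral_two_inputs i j (Y1 Y2 : T -> R) : input_index i -> input_index j ->
  i <> j -> adapted_to F [set i] Y1 -> adapted_to F [set j] Y2 ->
  (forall w, 0 <= Y1 w) -> (forall w, 0 <= Y2 w) ->
  (\int[P]_w (Y1 w * Y2 w)%:E = (\int[P]_w (Y1 w)%:E) * (\int[P]_w (Y2 w)%:E))%E.
Proof.
move=> ii jj ij a1 a2; apply: (expectation_mul _ _ _ a1 a2).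
- by move=> _ ->.
- by move=> _ ->.
- by move=> _ /= -> /esym ji; apply: ij.
Qed.

(** With probability [1 - p] the step is new, and with probability [p] it is
    [s] times a uniformly chosen earlier step; [Phi] is any weight determined
    by the past. Nonnegativity makes the identity meaningful in the extended
    reals without integrability. *)
Lemma step_expectation_ge0 k (Phi : T -> R) (psi : R -> R) : (1 <= k)%N ->
  adapted k Phi -> (forall w, 0 <= Phi w) -> measurable_fun setT psi ->
  (forall x, 0 <= psi x) -> psi 0 = 0 ->
  (\int[P]_w (Phi w * psi (step k.+1 w))%:E =
   (1 - p)%:E * (\int[P]_w (Phi w)%:E * \int[P]_w (psi (X 1%N w))%:E) +
   \sum_(1 <= j < k.+1) (p / k%:R)%:E * \int[P]_w (Phi w * psi (s * step j w))%:E)%E.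
Proof.
move=> k1 aP Phi0 mpsi psi_ge0 psi0.
have k2 : (2 <= k.+1)%N by [].
have mX : measurable_fun setT (fun w => psi (X k.+1 w)).
  by apply: measurableT_comp => //; exact: measurable_funPT.
have mP := adapted_meas aP.
have mneps : measurable_fun setT (fun w => (~~ eps k.+1 w)%:R : R).
  apply: (@adapted_meas k.+1); apply: (adapted_eps (fun b => (~~ b)%:R)); by split.
have meps : measurable_fun setT (fun w => (eps k.+1 w)%:R : R).
  apply: (@adapted_meas k.+1); apply: (adapted_eps (fun b => b%:R)); by split.
have mU j : measurable_fun setT (fun w => (U k.+1 w == j)%:R : R).
  apply: (@adapted_meas k.+1); apply: (adapted_U (fun b => (b == j)%:R)); by split.
have apsi j : (1 <= j < k.+1)%N -> adapted k (fun w => Phi w * psi (s * step j w)).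
  move=> /andP[j1 jk]; apply: measurable_funM => //.
  apply: (measurableT_comp mpsi); apply: measurable_funM => //.
  by apply: adaptedS (adapted_step j1); rewrite -ltnS.
have b0 (b : bool) : (0 <= b%:R :> R) by rewrite ler0n.
pose A0 w := Phi w * ((~~ eps k.+1 w)%:R * psi (X k.+1 w)).
pose A1 j w := (Phi w * psi (s * step j w)) * ((eps k.+1 w)%:R * (U k.+1 w == j)%:R).
have mstep j : measurable_fun setT (step j).
  case: j => [|j]; last exact: (adapted_meas (adapted_step (ltn0Sn j))).
  by rewrite (_ : step 0 = cst 0).
have mA1 j : measurable_fun setT (fun w => (A1 j w)%:E).
  apply/measurable_EFinP; apply: measurable_funM; last exact: measurable_funM.
  apply: measurable_funM => //; apply: (measurableT_comp mpsi).
  exact: measurable_funM.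
have A1_ge0 j w : (0 <= (A1 j w)%:E)%E by rewrite lee_fin !mulr_ge0.
transitivity (\int[P]_w ((A0 w)%:E + \sum_(1 <= j < k.+1) (A1 j w)%:E))%E.
  apply: eq_integral => w _; rewrite (step_sum _ k1 psi0) mulrDr EFinD; congr (_ + _)%E.
  rewrite mulr_sumr -sumEFin; apply: eq_bigr => j _; rewrite /A1; congr (_%:E); ring.
rewrite ge0_integralD//; first last.
- by apply: emeasurable_sum => j; exact: mA1.
- by move=> w _; apply: sume_ge0.
- apply/measurable_EFinP; apply: measurable_funM => //; exact: measurable_funM.
- by move=> w _; rewrite lee_fin !mulr_ge0.
rewrite ge0_integral_sum//; congr (_ + _)%E.
  rewrite (integral_past_present aP)//; last by move=> w; rewrite mulr_ge0.
    rewrite muleCA; congr (_ * _)%E.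
    rewrite (@integral_two_inputs (inl (inr k.+1)) (inl (inl k.+1)))//.
    + by rewrite integral_neps// integral_X.
    + by apply: (adapted_eps (fun b => (~~ b)%:R)).
    + by apply: (measurableT_comp mpsi); exact: adapted_X.
  apply: measurable_funM; first by apply: (adapted_eps (fun b => (~~ b)%:R)); split.
  by apply: (measurableT_comp mpsi); apply: adapted_X; split.
apply: eq_big_nat => j jk; have /andP[j1 jk1] := jk.
rewrite (integral_past_present (apsi _ jk)); first last.
- by move=> w; rewrite mulr_ge0.
- by move=> w; rewrite mulr_ge0.
- apply: measurable_funM; first by apply: (adapted_eps (fun b => b%:R)); split.
  by apply: (adapted_U (fun b => (b == j)%:R)); split.
rewrite (@integral_two_inputs (inl (inr k.+1)) (inr k.+1)
  (fun w => (eps k.+1 w)%:R) (fun w => (U k.+1 w == j)%:R))//.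
+ by rewrite integral_eps// integral_U//= muleC EFinM.
+ by apply: (adapted_eps (fun b => b%:R)).
+ by apply: (adapted_U (fun b => (b == j)%:R)).
Qed.

End reinforced_model.

(** * Square integrable martingale differences *)

Section square_integrable.
Context {d : measure_display} {T : measurableType d} {R : realType}.
Variable P : probability T R.
Implicit Types X Y : T -> R.
Local Notation E := (Rintegral P setT).
Local Notation integrable X := (P.-integrable setT (EFin \o X)).

Definition sqint X := measurable_fun setT X /\ integrable (fun w => X w ^+ 2).

Lemma integrable_le X Y : measurable_fun setT X -> integrable Y ->
  (forall w, `|X w| <= `|Y w|) -> integrable X.
Proof.
move=> mX iY XY; apply: le_integrable iY => //; first exact/measurable_EFinP.
by move=> w _; rewrite /= lee_fin.
Qed.

Lemma integrable_add X Y : integrable X -> integrable Y -> integrable (fun w => X w + Y w).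
Proof. by move=> iX iY; apply: eq_integrable (integrableD _ iX iY). Qed.

Lemma integrable_scale (c : R) X : integrable X -> integrable (fun w => c * X w).
Proof. by move=> iX; apply: eq_integrable (integrableZl _ c iX). Qed.

Lemma integrable_sub X Y : integrable X -> integrable Y -> integrable (fun w => X w - Y w).
Proof. by move=> iX iY; apply: eq_integrable (integrableB _ iX iY). Qed.

Lemma integrable_cst (c : R) : integrable (fun=> c).
Proof. exact: finite_measure_integrable_cst. Qed.

Lemma integrable_big (I : eqType) (r : seq I) (X : I -> T -> R) :
  (forall i, i \in r -> integrable (X i)) -> integrable (fun w => \sum_(i <- r) X i w).
Proof.
elim: r => [|i r IH] iX.
  by under eq_fun do rewrite big_nil; exact: integrable_cst.
under eq_fun do rewrite big_cons; apply: integrable_add.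
  by apply: iX; rewrite mem_head.
by apply: IH => j jr; apply: iX; rewrite inE jr orbT.
Qed.

Lemma ExD X Y : integrable X -> integrable Y -> E (fun w => X w + Y w) = E X + E Y.
Proof. by move=> iX iY; rewrite RintegralD. Qed.

Lemma ExB X Y : integrable X -> integrable Y -> E (fun w => X w - Y w) = E X - E Y.
Proof. by move=> iX iY; rewrite RintegralB. Qed.

Lemma ExZ (c : R) X : integrable X -> E (fun w => c * X w) = c * E X.
Proof. by move=> iX; rewrite RintegralZl. Qed.

Lemma Ex_cst (c : R) : E (fun=> c) = c.
Proof.
rewrite Rintegral_cst// -[RHS]mulr1; congr (_ * _).
exact: (congr1 fine (probability_setT P)).
Qed.

Lemma Ex_sum (I : eqType) (r : seq I) (X : I -> T -> R) :
  (forall i, i \in r -> integrable (X i)) ->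
  E (fun w => \sum_(i <- r) X i w) = \sum_(i <- r) E (X i).
Proof.
elim: r => [|i r IH] iX.
  by rewrite big_nil; under eq_Rintegral do rewrite big_nil; exact: Ex_cst.
rewrite big_cons; under eq_Rintegral do rewrite big_cons.
rewrite ExD ?IH//.
- by move=> j jr; apply: iX; rewrite inE jr orbT.
- by apply: iX; rewrite mem_head.
- by apply: integrable_big => j jr; apply: iX; rewrite inE jr orbT.
Qed.

Lemma Ex_le X Y : integrable X -> integrable Y -> (forall w, X w <= Y w) -> E X <= E Y.
Proof. by move=> iX iY XY; apply: le_Rintegral. Qed.

Lemma Ex_ge0 X : (forall w, 0 <= X w) -> 0 <= E X.
Proof. by move=> X0; apply: Rintegral_ge0. Qed.

Lemma EFin_Ex X : integrable X -> (E X)%:E = (\int[P]_w (X w)%:E)%E.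
Proof. by move=> iX; rewrite /Rintegral fineK//; exact: integrable_fin_num. Qed.

Lemma sqint_meas X : sqint X -> measurable_fun setT X. Proof. by case. Qed.
Lemma sqint_sq X : sqint X -> integrable (fun w => X w ^+ 2). Proof. by case. Qed.

Lemma sqint_le X Y : measurable_fun setT X -> sqint Y -> (forall w, `|X w| <= `|Y w|) ->
  sqint X.
Proof.
move=> mX [mY iY] XY; split=> //; apply: integrable_le iY _.
  exact: measurable_funX.
by move=> w; rewrite !normrX ler_pXn2r ?nnegrE.
Qed.

Lemma sqint_mul X Y : sqint X -> sqint Y -> integrable (fun w => X w * Y w).
Proof.
move=> [mX iX] [mY iY]; apply: integrable_le (integrable_add iX iY) _.
  exact: measurable_funM.
move=> w; rewrite (ger0_norm (addr_ge0 (sqr_ge0 _) (sqr_ge0 _))) normrM.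
rewrite -(real_normK (num_real (X w))) -(real_normK (num_real (Y w))).
have := sqr_ge0 (`|X w| - `|Y w|); have := normr_ge0 (X w); have := normr_ge0 (Y w).
nra.
Qed.

Lemma sqint_cst c : sqint (fun=> c).
Proof. by split=> //; exact: integrable_cst. Qed.

Lemma sqint_integrable X : sqint X -> integrable X.
Proof.
move=> sX; have := sqint_mul sX (sqint_cst 1).
by under eq_fun do rewrite mulr1.
Qed.

Lemma sqint_scale c X : sqint X -> sqint (fun w => c * X w).
Proof.
move=> [mX iX]; split; first exact: measurable_funM.
by under eq_fun do rewrite exprMn; exact: integrable_scale.
Qed.

Lemma sqint_add X Y : sqint X -> sqint Y -> sqint (fun w => X w + Y w).
Proof.
move=> sX sY; split; first by apply: measurable_funD; exact: sqint_meas.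
under eq_fun do rewrite sqrrD -mulr_natl.
apply: integrable_add; last exact: sqint_sq.
by apply: integrable_add; [exact: sqint_sq|apply: integrable_scale; exact: sqint_mul].
Qed.

Lemma sqint_sub X Y : sqint X -> sqint Y -> sqint (fun w => X w - Y w).
Proof.
move=> sX /(sqint_scale (-1)) sY; have := sqint_add sX sY.
by under eq_fun do rewrite mulN1r.
Qed.

Lemma sqint_sum (I : eqType) (r : seq I) (X : I -> T -> R) :
  (forall i, i \in r -> sqint (X i)) -> sqint (fun w => \sum_(i <- r) X i w).
Proof.
elim: r => [|i r IH] iX.
  by under eq_fun do rewrite big_nil; exact: sqint_cst.
under eq_fun do rewrite big_cons; apply: sqint_add.
  by apply: iX; rewrite mem_head.
by apply: IH => j jr; apply: iX; rewrite inE jr orbT.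
Qed.

Lemma sqint_bounded_mul X Y (C : R) : measurable_fun setT X -> (forall w, `|X w| <= C) ->
  sqint Y -> sqint (fun w => X w * Y w).
Proof.
move=> mX XC sY; apply: sqint_le (sqint_scale C sY) _.
  by apply: measurable_funM => //; exact: sqint_meas.
by move=> w; rewrite !normrM ler_wpM2r// (le_trans (XC w))// ler_norm.
Qed.

Lemma sqint_bounded X (C : R) : measurable_fun setT X -> (forall w, `|X w| <= C) -> sqint X.
Proof.
move=> mX XC; have := sqint_bounded_mul mX XC (sqint_cst 1).
by under eq_fun do rewrite mulr1.
Qed.

Lemma Ex_bounded_mul_sq X Y (C : R) : measurable_fun setT X -> (forall w, `|X w| <= C) ->
  sqint Y -> E (fun w => (X w * Y w) ^+ 2) <= C ^+ 2 * E (fun w => Y w ^+ 2).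
Proof.
move=> mX XC sY; rewrite -ExZ; last exact: sqint_sq.
apply: Ex_le.
- exact: sqint_sq (sqint_bounded_mul mX XC sY).
- by apply: integrable_scale; exact: sqint_sq.
- move=> w; rewrite exprMn ler_wpM2r ?sqr_ge0//.
  by rewrite -real_normK ?num_real// ler_pXn2r ?nnegrE// (le_trans _ (XC w)).
Qed.

End square_integrable.

Section martingale_differences.
Context {d : measure_display} {T : measurableType d} {R : realType}.
Variable P : probability T R.
Variable G : nat -> set (set T).
Hypothesis Gm : forall k, <<s G k >> `<=` measurable.
Hypothesis GS : forall j k, (j <= k)%N -> G j `<=` G k.
Local Notation E := (Rintegral P setT).

(** Measurable for the sigma-algebra of the past at time [k], of which [G k]
    is a generating class. *)
Definition filtered k (Phi : T -> R) :=
  measurable_fun (setT : set (g_sigma_algebraType (G k))) (Phi : g_sigma_algebraType (G k) -> R).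

Lemma filteredS j k Phi : (j <= k)%N -> filtered j Phi -> filtered k Phi.
Proof.
move=> jk mPhi _ B mB; have := mPhi measurableT B mB.
by apply: sub_sigma_algebra2; exact: GS.
Qed.

Lemma filtered_meas k Phi : filtered k Phi -> measurable_fun setT Phi.
Proof. by move=> mPhi _ B mB; apply: (@Gm k); exact: mPhi. Qed.

(** [D k] is the increment from time [k] to time [k.+1]; being orthogonal to
    all square integrable variables of the past at time [k] says that its
    conditional expectation vanishes. *)
Record martingale_difference (D : nat -> T -> R) (N : nat) := {
  mdiff_filtered : forall k, (N <= k)%N -> filtered k.+1 (D k);
  mdiff_sqint : forall k, (N <= k)%N -> sqint P (D k);
  mdiff_orthogonal : forall k Phi, (N <= k)%N -> filtered k Phi -> sqint P Phi ->
    E (fun w => Phi w * D k w) = 0 }.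

Lemma mdiff_mul D N (Phi : nat -> T -> R) (C : R) : martingale_difference D N ->
  (forall k, (N <= k)%N -> filtered k (Phi k)) ->
  (forall k w, (N <= k)%N -> `|Phi k w| <= C) ->
  martingale_difference (fun k w => Phi k w * D k w) N.
Proof.
move=> [Df Ds Do] Pf PC; split=> k.
- move=> Nk; apply: measurable_funM; last exact: Df.
  by apply: filteredS (leqnSn k) _; exact: Pf.
- move=> Nk; apply: (@sqint_bounded_mul _ _ _ _ _ _ C) => [||]; last exact: Ds.
    by apply: filtered_meas; exact: Pf.
  by move=> w; exact: PC.
- move=> Psi Nk fPsi sPsi.
  under eq_Rintegral do rewrite mulrA.
  apply: Do => //; first by apply: measurable_funM => //; exact: Pf.
  have := sqint_bounded_mul (filtered_meas (Pf _ Nk)) (fun w => PC k w Nk) sPsi.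
  by congr sqint; apply/funext => w; rewrite mulrC.
Qed.

Lemma mdiff_sum D N n : martingale_difference D N -> (N <= n)%N ->
  filtered n (fun w => \sum_(N <= k < n) D k w) /\
  sqint P (fun w => \sum_(N <= k < n) D k w).
Proof.
move=> [Df Ds Do] Nn; split.
  elim: n Nn => [|n IH].
    rewrite leqn0 => /eqP ->; under eq_fun do rewrite big_geq//.
    exact: measurable_cst.
  rewrite leq_eqVlt => /predU1P[->|]; first by under eq_fun do rewrite big_geq//; exact: measurable_cst.
  rewrite ltnS => Nn; under eq_fun do rewrite big_nat_recr//=.
  apply: measurable_funD; last exact: Df.
  by apply: filteredS (leqnSn n) _; exact: IH.
by apply: sqint_sum => k; rewrite mem_index_iota => /andP[Nk _]; exact: Ds.
Qed.

(** Increments of a martingale are orthogonal: the earlier sum is determined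
    by the past of the last increment. *)
Lemma mdiff_sum_sq D N n : martingale_difference D N ->
  E (fun w => (\sum_(N <= k < n) D k w) ^+ 2) = \sum_(N <= k < n) E (fun w => D k w ^+ 2).
Proof.
move=> mD; have [Df Ds Do] := mD.
elim: n => [|n IH].
  rewrite !big_geq//; under eq_Rintegral do rewrite big_geq// expr0n.
  exact: Ex_cst.
have [Nn|nN] := leqP N n; last first.
  rewrite !big_geq//; under eq_Rintegral do rewrite big_geq// expr0n.
  exact: Ex_cst.
rewrite big_nat_recr//= -IH.
under eq_Rintegral do rewrite big_nat_recr//= sqrrD -mulr_natl.
have [fS sS] := mdiff_sum mD Nn.
have sD := Ds _ Nn; have iSD := sqint_mul sS sD.
rewrite ExD; [|apply: integrable_add|exact: sqint_sq].
- rewrite ExD; [|exact: sqint_sq|exact: integrable_scale].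
  by rewrite ExZ// Do// mulr0 addr0.
- exact: sqint_sq.
- exact: integrable_scale.
Qed.

End martingale_differences.

(** * Moments of reinforced steps *)

Section step_expectation.
Context {d : measure_display} {T : measurableType d} {R : realType}.
Variables (P : probability T R) (X : nat -> {RV P >-> R})
  (eps : nat -> {RV P >-> bool}) (U : nat -> {RV P >-> nat}) (p : R).
Hypotheses (hp : 0 <= p < 1) (hin : reinforcement_inputs X eps U p).
Variables (g : R -> R) (s : R).
Hypothesis gE : forall x, g x = s * x.
Local Notation E := (Rintegral P setT).
Local Notation Z := (step X eps U g).

(** A function insensitive to the sign [s] has the same mean on a repeated
    step as on the original one; induction on [k] then shows that it has the
    same mean on all steps. *)
Lemma step_law (psi : R -> R) k : (1 <= k)%N -> measurable_fun setT psi ->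
  (forall x, 0 <= psi x) -> psi 0 = 0 -> (forall x, psi (s * x) = psi x) ->
  (\int[P]_w (psi (Z k w))%:E = \int[P]_w (psi (X 1%N w))%:E)%E.
Proof.
elim/ltn_ind: k => -[//|[|k]] IH _ mpsi psi_ge0 psi0 psis; first by [].
have H := @step_expectation_ge0 _ _ _ P X eps U p hp hin g s gE k.+1 (fun=> 1) psi (ltn0Sn _).
have {H} := H (measurable_cst _) (fun=> ler01) mpsi psi_ge0 psi0.
under eq_integral do rewrite mul1r.
have -> : (\int[P]_w (1%:E : \bar R) = 1)%E.
  by rewrite integral_cst// mul1e; exact: (probability_setT P).
move=> ->; rewrite mul1e.
have m0 : (0 <= \int[P]_w (psi (X 1%N w))%:E)%E by apply: integral_ge0 => w _; rewrite lee_fin.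
set m := (\int[P]_w (psi (X 1%N w))%:E)%E in m0 *.
rewrite (eq_big_nat _ _ (F2 := fun=> ((p / k.+1%:R)%:E * m)%E)) => [|j /andP[j1 jk]]; last first.
  congr (_ * _)%E; rewrite /m -(IH j jk j1 mpsi psi_ge0 psi0 psis).
  by apply: eq_integral => w _; rewrite mul1r psis.
have /andP[p0 p1] := hp.
rewrite -ge0_sume_distrl; last by move=> j _; rewrite lee_fin divr_ge0.
rewrite sumEFin sumr_const_nat subn1 /= -[X in (_ + X%:E * _)%E]mulr_natr.
rewrite divfK ?pnatr_eq0// -ge0_muleDl ?lee_fin ?subr_ge0 ?(ltW p1)//.
by rewrite -EFinD subrK mul1e.
Qed.

Lemma step_measurable j : measurable_fun setT (Z j).
Proof.
case: j => [|j]; last by exact: (adapted_meas (adapted_step gE (ltn0Sn j))).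
by rewrite (_ : Z 0 = cst 0).
Qed.

(** [psi ^+ 2] is insensitive to the sign, so [step_law] applies to it. *)
Lemma step_sqint (psi : R -> R) t k : (1 <= k)%N -> measurable_fun setT psi ->
  psi 0 = 0 -> (t = 1 \/ t = -1) -> (forall x, psi (s * x) = t * psi x) ->
  sqint P (fun w => psi (X 1%N w)) ->
  sqint P (fun w => psi (Z k w)) /\
  E (fun w => psi (Z k w) ^+ 2) = E (fun w => psi (X 1%N w) ^+ 2).
Proof.
move=> k1 mpsi psi0 tt psis [mX iX].
have mpsi2 : measurable_fun setT (fun x => psi x ^+ 2) by exact: measurable_funX.
have law : (\int[P]_w (psi (Z k w) ^+ 2)%:E = \int[P]_w (psi (X 1%N w) ^+ 2)%:E)%E.
  rewrite (@step_law (fun x => psi x ^+ 2))//.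
  - by move=> x; rewrite sqr_ge0.
  - by rewrite psi0 expr0n.
  - by move=> x; rewrite psis exprMn; case: tt => ->; rewrite ?sqrrN expr1n mul1r.
have mZ : measurable_fun setT (fun w => psi (Z k w)).
  by apply: measurableT_comp => //; exact: step_measurable.
split; last by rewrite /Rintegral law.
split=> //; apply/integrableP; split.
  by apply/measurable_EFinP; exact: measurable_funX.
under eq_integral do rewrite /= ger0_norm ?sqr_ge0//.
move/integrableP : iX => [_]; rewrite law; congr (_ < _)%E.
by apply: eq_integral => w _; rewrite /= ger0_norm ?sqr_ge0.
Qed.

(** The conditional law of a step in a form that is additive both in [Phi] and
    in [psi]. *)
Let key_identity k (Phi : T -> R) (psi : R -> R) :=
  E (fun w => Phi w * psi (Z k.+1 w)) = (1 - p) * (E Phi * E (fun w => psi (X 1%N w))) +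
    \sum_(1 <= j < k.+1) p / k%:R * E (fun w => Phi w * psi (s * Z j w)).

Let admissible (psi : R -> R) := [/\ measurable_fun setT psi, psi 0 = 0,
  sqint P (fun w => psi (X 1%N w)), forall j, (1 <= j)%N -> sqint P (fun w => psi (Z j w)) &
  forall j, (1 <= j)%N -> sqint P (fun w => psi (s * Z j w))].

Let key_ge0 k Phi psi : (1 <= k)%N -> adapted X eps U k Phi -> sqint P Phi ->
  (forall w, 0 <= Phi w) -> admissible psi -> (forall x, 0 <= psi x) -> key_identity k Phi psi.
Proof.
move=> k1 aP sP P0 [mpsi psi0 s1 s2 s3] psi_ge0.
have := step_expectation_ge0 hp hin gE k1 aP P0 mpsi psi_ge0 psi0.
have i1 := sqint_mul sP (s2 k.+1 (ltn0Sn k)).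
have i2 j (j1 : (1 <= j)%N) := sqint_mul sP (s3 j j1).
have i3 := sqint_integrable sP; have i4 := sqint_integrable s1.
rewrite -(EFin_Ex i1) -(EFin_Ex i3) -(EFin_Ex i4).
rewrite (eq_big_nat _ _ (F2 := fun j => (p / k%:R * E (fun w => Phi w * psi (s * Z j w)))%:E)) => [|j /andP[j1 _]].
  by rewrite sumEFin -!EFinM -EFinD => -[].
by rewrite [RHS]EFinM (EFin_Ex (i2 j j1)).
Qed.

Let key_sub_psi k Phi psi1 psi2 : (1 <= k)%N -> sqint P Phi ->
  admissible psi1 -> admissible psi2 -> key_identity k Phi psi1 -> key_identity k Phi psi2 ->
  key_identity k Phi (fun x => psi1 x - psi2 x).
Proof.
move=> k1 sP [_ _ a1 a2 a3] [_ _ b1 b2 b3]; rewrite /key_identity => K1 K2.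
under eq_Rintegral do rewrite mulrBr.
rewrite (ExB (sqint_mul sP (a2 k.+1 (ltn0Sn k))) (sqint_mul sP (b2 k.+1 (ltn0Sn k)))).
rewrite K1 K2 (ExB (sqint_integrable a1) (sqint_integrable b1)).
rewrite [X in _ = _ + X](eq_big_nat _ _ (F2 := fun j => p / k%:R * E (fun w => Phi w * psi1 (s * Z j w)) -
   p / k%:R * E (fun w => Phi w * psi2 (s * Z j w)))) => [|j /andP[j1 _]].
  by rewrite sumrB; ring.
under eq_Rintegral do rewrite mulrBr.
by rewrite (ExB (sqint_mul sP (a3 j j1)) (sqint_mul sP (b3 j j1))) mulrBr.
Qed.

Let key_sub_Phi k Phi1 Phi2 psi : (1 <= k)%N -> sqint P Phi1 -> sqint P Phi2 ->
  admissible psi -> key_identity k Phi1 psi -> key_identity k Phi2 psi ->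
  key_identity k (fun w => Phi1 w - Phi2 w) psi.
Proof.
move=> k1 s1 s2 [_ _ a1 a2 a3]; rewrite /key_identity => K1 K2.
under eq_Rintegral do rewrite mulrBl.
rewrite (ExB (sqint_mul s1 (a2 k.+1 (ltn0Sn k))) (sqint_mul s2 (a2 k.+1 (ltn0Sn k)))).
rewrite K1 K2 (ExB (sqint_integrable s1) (sqint_integrable s2)).
rewrite [X in _ = _ + X](eq_big_nat _ _ (F2 := fun j => p / k%:R * E (fun w => Phi1 w * psi (s * Z j w)) -
   p / k%:R * E (fun w => Phi2 w * psi (s * Z j w)))) => [|j /andP[j1 _]].
  by rewrite sumrB; ring.
under eq_Rintegral do rewrite mulrBl.
by rewrite (ExB (sqint_mul s1 (a3 j j1)) (sqint_mul s2 (a3 j j1))) mulrBr.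
Qed.

(** Signed version of the conditional step formula: split both factors into
    positive and negative parts. *)
Lemma step_expectation (Phi : T -> R) (psi : R -> R) t k : (1 <= k)%N ->
  adapted X eps U k Phi -> sqint P Phi -> measurable_fun setT psi ->
  psi 0 = 0 -> (t = 1 \/ t = -1) -> (forall x, psi (s * x) = t * psi x) ->
  sqint P (fun w => psi (X 1%N w)) ->
  E (fun w => Phi w * psi (Z k.+1 w)) = (1 - p) * (E Phi * E (fun w => psi (X 1%N w))) +
    t * p / k%:R * \sum_(1 <= j < k.+1) E (fun w => Phi w * psi (Z j w)).
Proof.
move=> k1 aP sP mpsi psi0 tt psis sX.
have sZ j (j1 : (1 <= j)%N) := proj1 (step_sqint j1 mpsi psi0 tt psis sX).
have sZs j : (1 <= j)%N -> sqint P (fun w => psi (s * Z j w)).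
  by move=> j1; under eq_fun do rewrite psis; apply: sqint_scale; exact: sZ.
have adm (k' : R -> R) : measurable_fun setT k' -> (forall x, `|k' x| <= `|psi x|) -> admissible k'.
  move=> mk kpsi; have mZ := step_measurable.
  split=> //.
  - by have := kpsi 0; rewrite psi0 normr0 normr_le0 => /eqP.
  - apply: sqint_le sX _ => //; apply: measurableT_comp => //; exact: measurable_funPT.
  - by move=> j /sZ /sqint_le; apply => //; apply: measurableT_comp.
  - move=> j /sZs /sqint_le; apply => //; apply: measurableT_comp => //.
    by apply: measurable_funM.
pose psi1 x := Num.max (psi x) 0; pose psi2 x := Num.max (- psi x) 0.
pose Phi1 x := Num.max (Phi x) 0; pose Phi2 x := Num.max (- Phi x) 0.
have maxn0 (x : R) : [/\ `|Num.max x 0| <= `|x|, 0 <= Num.max x 0 & x = Num.max x 0 - Num.max (- x) 0].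
  have [x0|x0] := leP 0 x.
    by split=> //; rewrite max_r ?oppr_le0// subr0.
  by split; rewrite ?normr0// max_l ?oppr_ge0 ?(ltW x0)// sub0r opprK.
have A1 : admissible psi1.
  by apply: adm => [|x]; [apply: measurable_maxr|case: (maxn0 (psi x))].
have A2 : admissible psi2.
  apply: adm => [|x]; last by case: (maxn0 (- psi x)); rewrite normrN.
  by apply: measurable_maxr => //; exact: measurableT_comp.
have aP1 : adapted X eps U k Phi1 by apply: measurable_maxr.
have aP2 : adapted X eps U k Phi2.
  by apply: measurable_maxr => //; exact: measurableT_comp.
have sP1 : sqint P Phi1.
  by apply: sqint_le sP _; [exact: adapted_meas aP1|move=> w; case: (maxn0 (Phi w))].
have sP2 : sqint P Phi2.
  apply: sqint_le sP _; first exact: adapted_meas aP2.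
  by move=> w; case: (maxn0 (- Phi w)); rewrite normrN.
have P10 w : 0 <= Phi1 w by case: (maxn0 (Phi w)).
have P20 w : 0 <= Phi2 w by case: (maxn0 (- Phi w)).
have p10 w : 0 <= psi1 w by case: (maxn0 (psi w)).
have p20 w : 0 <= psi2 w by case: (maxn0 (- psi w)).
have EPhi : Phi = (fun w => Phi1 w - Phi2 w).
  by apply/funext => w; case: (maxn0 (Phi w)).
have Epsi : psi = (fun w => psi1 w - psi2 w).
  by apply/funext => w; case: (maxn0 (psi w)).
have Apsi : admissible psi by apply: adm.
have : key_identity k Phi psi.
  rewrite EPhi; apply: key_sub_Phi => //; rewrite Epsi; apply: key_sub_psi => //; exact: key_ge0.
rewrite /key_identity => ->; congr (_ + _); rewrite mulr_sumr; apply: eq_big_nat => j /andP[j1 _].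
under eq_Rintegral do rewrite psis mulrCA.
by rewrite ExZ; [ring|apply: sqint_mul => //; exact: sZ].
Qed.

End step_expectation.

(** * Second moments of reinforced sums *)

Section reinforced_sequence.
Context {d : measure_display} {T : measurableType d} {R : realType}.
Variable P : probability T R.
Variable G : nat -> set (set T).
Hypothesis GS : forall j k, (j <= k)%N -> G j `<=` G k.
Local Notation E := (Rintegral P setT).

(** Given the past up to time [k], the next term is drawn afresh with mean [m]
    with probability [1 - p], and is otherwise an earlier term, with a sign
    absorbed in [q]. *)
Record reinforced (zeta : nat -> T -> R) (p q m M2 : R) := {
  reinf_filtered : forall k, (1 <= k)%N -> filtered G k (zeta k);
  reinf_sqint : forall k, (1 <= k)%N -> sqint P (zeta k);
  reinf_second : forall k, (1 <= k)%N -> E (fun w => zeta k w ^+ 2) = M2;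
  reinf_step : forall k Phi, (1 <= k)%N -> filtered G k Phi -> sqint P Phi ->
    E (fun w => Phi w * zeta k.+1 w) = (1 - p) * (E Phi * m) +
      q / k%:R * \sum_(1 <= j < k.+1) E (fun w => Phi w * zeta j w) }.

Variables (zeta : nat -> T -> R) (p q m M2 : R).
Hypothesis Hz : reinforced zeta p q m M2.
Hypotheses (q1 : q < 1).

(** The fixed point of the averaged dynamics: if all earlier steps have mean
    [mu] then so has the next one, as [mu = (1 - p) m + q mu]. *)
Definition limit_mean : R := (1 - p) * m / (1 - q).
Definition centered_sum (k : nat) (w : T) : R := \sum_(1 <= j < k.+1) (zeta j w - limit_mean).
(** The step minus its conditional expectation [(1 - p) m + q / k * (sum of
    the first k terms)], rewritten in terms of the centered sum. *)
Definition innovation (k : nat) (w : T) : R :=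
  zeta k.+1 w - limit_mean - q / k%:R * centered_sum k w.
Local Notation mu := limit_mean.
Local Notation W := centered_sum.
Local Notation D := innovation.

Lemma centered_sum_next k w : W k.+1 w = W k w + (zeta k.+1 w - mu).
Proof. by rewrite /W big_nat_recr. Qed.

Lemma centered_sum_filtered k : filtered G k (W k).
Proof.
apply: measurable_sum_in => j; rewrite mem_index_iota => /andP[j1 jk].
apply: measurable_funB; last exact: measurable_cst.
by apply: (filteredS GS (j := j)); [rewrite -ltnS|exact: (reinf_filtered Hz)].
Qed.

Lemma centered_sum_sqint k : sqint P (W k).
Proof.
apply: sqint_sum => j; rewrite mem_index_iota => /andP[j1 jk].
by apply: sqint_sub; [exact: (reinf_sqint Hz)|exact: sqint_cst].
Qed.

Lemma innovation_mdiff : martingale_difference P G D 1.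
Proof.
split=> k.
- move=> k1; apply: measurable_funB.
    by apply: measurable_funB; [exact: (reinf_filtered Hz)|exact: measurable_cst].
  by apply: measurable_funM => //; apply: (filteredS GS (leqnSn k)); exact: centered_sum_filtered.
- move=> k1; apply: sqint_sub; last by apply: sqint_scale; exact: centered_sum_sqint.
  by apply: sqint_sub; [exact: (reinf_sqint Hz)|exact: sqint_cst].
- move=> Phi k1 fP sP.
  have sz j (j1 : (1 <= j)%N) := sqint_mul sP (reinf_sqint Hz j1).
  have sPi := sqint_integrable sP.
  have sW := sqint_mul sP (centered_sum_sqint k).
  have EW : E (fun w => Phi w * W k w) =
      \sum_(1 <= j < k.+1) E (fun w => Phi w * zeta j w) - k%:R * (mu * E Phi).
    rewrite (_ : (fun w => _) = (fun w => \sum_(1 <= j < k.+1) (Phi w * zeta j w - mu * Phi w))); last first.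
      by apply/funext => w; rewrite mulr_sumr; apply: eq_bigr => j _; ring.
    rewrite Ex_sum => [|j]; last first.
      rewrite mem_index_iota => /andP[j1 _].
      by apply: integrable_sub; [exact: sz|exact: integrable_scale].
    rewrite (eq_big_nat _ _ (F2 := fun j => E (fun w => Phi w * zeta j w) - mu * E Phi)); last first.
      by move=> j /andP[j1 _]; rewrite (ExB (sz j j1) (integrable_scale mu sPi)) (ExZ mu sPi).
    by rewrite sumrB sumr_const_nat subn1 /= -[X in _ - X]mulr_natl.
  rewrite (_ : (fun w => _) = (fun w => Phi w * zeta k.+1 w - mu * Phi w - q / k%:R * (Phi w * W k w))); last first.
    by apply/funext => w; rewrite /D; ring.
  have i1 := integrable_sub (sz k.+1 (ltn0Sn k)) (integrable_scale mu sPi).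
  rewrite (ExB i1 (integrable_scale _ sW)) (ExB (sz k.+1 (ltn0Sn k)) (integrable_scale mu sPi)).
  rewrite (ExZ mu sPi) (ExZ _ sW) (reinf_step Hz k1 fP sP) EW /mu.
  field; rewrite pnatr_eq0 -lt0n k1 andbT subr_eq0 gt_eqF//.
Qed.

(** Subtracting the conditional expectation decreases the second moment. *)
Lemma innovation_second k : (1 <= k)%N -> E (fun w => D k w ^+ 2) <= M2.
Proof.
move=> k1; have mD := innovation_mdiff.
have sD := mdiff_sqint mD k1.
pose C w := mu + q / k%:R * W k w.
have sC : sqint P C by apply: sqint_add; [exact: sqint_cst|apply: sqint_scale; exact: centered_sum_sqint].
have fC : filtered G k C.
  by apply: measurable_funD => //; apply: measurable_funM => //; exact: centered_sum_filtered.
rewrite -(reinf_second Hz (ltn0Sn k)).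
have -> : (fun w => zeta k.+1 w ^+ 2) = (fun w => D k w ^+ 2 + 2 * (C w * D k w) + C w ^+ 2).
  by apply/funext => w; rewrite /D /C; ring.
have i1 := sqint_mul sC sD; have i2 := integrable_scale 2 i1.
have i3 := sqint_sq sD; have i4 := sqint_sq sC.
rewrite (ExD (integrable_add i3 i2) i4) (ExD i3 i2) (ExZ 2 i1) (mdiff_orthogonal mD k1 fC sC).
by rewrite mulr0 addr0 lerDl Ex_ge0// => w; rewrite sqr_ge0.
Qed.

Definition step_bound : R := 2 * M2 + 2 * mu ^+ 2.
Local Notation K := step_bound.

Lemma step_bound_ge0 : 0 <= K.
Proof.
have : 0 <= M2.
  by rewrite -(reinf_second Hz (leqnn 1)) Ex_ge0// => w; rewrite sqr_ge0.
by have := sqr_ge0 mu; rewrite /step_bound; lra.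
Qed.

(** The cross term of [W k] with the next step is [q / k * W k ^+ 2] on
    average; the square of the step is bounded in mean. *)
Lemma centered_second_next k : (1 <= k)%N ->
  E (fun w => W k.+1 w ^+ 2) <= (1 + 2 * q / k%:R) * E (fun w => W k w ^+ 2) + K.
Proof.
move=> k1; have mD := innovation_mdiff; have sD := mdiff_sqint mD k1.
have sW := centered_sum_sqint k; have fW : filtered G k (W k) by exact: centered_sum_filtered.
have sz := reinf_sqint Hz (ltn0Sn k).
have sx : sqint P (fun w => zeta k.+1 w - mu) by apply: sqint_sub => //; exact: sqint_cst.
have -> : (fun w => W k.+1 w ^+ 2) = (fun w => (1 + 2 * q / k%:R) * W k w ^+ 2 +
    2 * (W k w * D k w) + (zeta k.+1 w - mu) ^+ 2).
  by apply/funext => w; rewrite centered_sum_next /D; ring.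
have i1 := integrable_scale (1 + 2 * q / k%:R) (sqint_sq sW).
have i2 := sqint_mul sW sD.
rewrite (ExD (integrable_add i1 (integrable_scale 2 i2)) (sqint_sq sx)).
rewrite (ExD i1 (integrable_scale 2 i2)) (ExZ _ (sqint_sq sW)) (ExZ _ i2).
rewrite (mdiff_orthogonal mD k1 fW sW) mulr0 addr0 lerD2l.
apply: (@le_trans _ _ (E (fun w => 2 * zeta k.+1 w ^+ 2 + 2 * mu ^+ 2))).
  apply: Ex_le; first exact: sqint_sq.
    apply: integrable_add; last exact: integrable_cst.
    by apply: integrable_scale; exact: sqint_sq.
  by move=> w; have := sqr_ge0 (zeta k.+1 w + mu); rewrite !expr2; nra.
rewrite (ExD (integrable_scale 2 (sqint_sq sz)) (integrable_cst _ _)) (ExZ _ (sqint_sq sz)).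
by rewrite (reinf_second Hz (ltn0Sn k)) Ex_cst.
Qed.

Lemma centered_second_ge0 k : 0 <= E (fun w => W k w ^+ 2).
Proof. by apply: Ex_ge0 => w; rewrite sqr_ge0. Qed.

Lemma centered_second1 : E (fun w => W 1 w ^+ 2) <= K.
Proof.
have sz := reinf_sqint Hz (leqnn 1).
apply: (@le_trans _ _ (E (fun w => 2 * zeta 1%N w ^+ 2 + 2 * mu ^+ 2))).
  apply: Ex_le; first exact: sqint_sq (centered_sum_sqint 1).
    apply: integrable_add; last exact: integrable_cst.
    by apply: integrable_scale; exact: sqint_sq.
  by move=> w; rewrite /W big_nat1; have := sqr_ge0 (zeta 1%N w + mu); rewrite !expr2; nra.
rewrite (ExD (integrable_scale 2 (sqint_sq sz)) (integrable_cst _ _)) (ExZ _ (sqint_sq sz)).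
by rewrite (reinf_second Hz (leqnn 1)) Ex_cst.
Qed.

(** [v k = E (W k ^+ 2) / k ^+ 2] satisfies
    [v k.+1 <= v k - 2 (1 - q) k / (k + 1) ^+ 2 * v k + K / (k + 1) ^+ 2],
    and the negative terms telescope. *)
Lemma centered_second_summable n :
  \sum_(1 <= k < n) E (fun w => W k w ^+ 2) / k%:R ^+ 3 <= 4 * K / (1 - q).
Proof.
pose v k := E (fun w => W k w ^+ 2) / k%:R ^+ 2.
have v0 k : 0 <= v k by rewrite divr_ge0 ?centered_second_ge0 ?sqr_ge0.
have K0 := step_bound_ge0.
have q10 : 0 < 1 - q by rewrite subr_gt0.
(* [2 - 1 / n] bounds the sum of [1 / k ^ 2]; the term [v n] absorbs the
   telescoping part. *)
suff H : (1 <= n)%N -> (1 - q) / 2 * \sum_(1 <= k < n) E (fun w => W k w ^+ 2) / k%:R ^+ 3 +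
    v n <= K * (2 - n%:R^-1).
  have [n0|n1] := leqP n 0.
    by move: n0; rewrite leqn0 => /eqP ->; rewrite big_geq// divr_ge0 ?mulr_ge0 ?(ltW q10).
  rewrite ler_pdivlMr//; have := H n1; have := v0 n.
  have : 0 <= n%:R^-1 :> R by rewrite invr_ge0.
  set S := \sum_(_ <= _ < _) _; nra.
elim: n => [//|n IH] _; have [->|n1] := posnP n.
  rewrite big_geq// mulr0 add0r /v expr1n divr1 invr1.
  by have := centered_second1; lra.
rewrite big_nat_recr//=; move: (IH n1).
set S := \sum_(_ <= _ < _) _.
have x1 : 1 <= n%:R :> R by rewrite ler1n.
have := centered_second_next n1; rewrite {1}(_ : E (fun w => W n.+1 w ^+ 2) = v n.+1 * n.+1%:R ^+ 2); last first.
  by rewrite divfK// expf_neq0// pnatr_eq0.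
have -> : E (fun w => W n w ^+ 2) = v n * n%:R ^+ 2.
  by rewrite divfK// expf_neq0// pnatr_eq0 -lt0n.
move: (v0 n) (v0 n.+1); rewrite -natr1; move: n%:R x1 (v n) (v n.+1) => x x1 a b a0 b0 H1 H2.
have x0 : 0 < x by lra.
have xn : x != 0 by rewrite gt_eqF.
have y0 : 0 < x + 1 by lra.
have yn : x + 1 != 0 by rewrite gt_eqF.
have Hb : b <= ((x ^+ 2 + 2 * q * x) * a + K) / (x + 1) ^+ 2.
  rewrite ler_pdivlMr ?exprn_gt0//; apply: le_trans H1 _; rewrite le_eqVlt; apply/orP; left; apply/eqP; by field.
have -> : a * x ^+ 2 / x ^+ 3 = a / x by field.
apply: (@le_trans _ _ ((1 - q) / 2 * (S + a / x) + ((x ^+ 2 + 2 * q * x) * a + K) / (x + 1) ^+ 2)).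
  by rewrite lerD2l.
have c1 : (1 - q) / 2 * (a / x) + (x ^+ 2 + 2 * q * x) * a / (x + 1) ^+ 2 <= a.
  rewrite -subr_ge0.
  have -> : a - ((1 - q) / 2 * (a / x) + (x ^+ 2 + 2 * q * x) * a / (x + 1) ^+ 2) =
    a * ((1 - q) * (4 * x ^+ 2 - (x + 1) ^+ 2) + 2 * x) / (2 * x * (x + 1) ^+ 2).
    by field; rewrite xn yn.
  apply: divr_ge0; last by rewrite !mulr_ge0 ?exprn_ge0 ?(ltW x0) ?(ltW y0).
  apply: mulr_ge0 => //; have : 0 <= 4 * x ^+ 2 - (x + 1) ^+ 2 by nra.
  nra.
have c2 : K / (x + 1) ^+ 2 <= K * (x^-1 - (x + 1)^-1).
  rewrite ler_wpM2l// -subr_ge0.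
  have -> : x^-1 - (x + 1)^-1 - ((x + 1) ^+ 2)^-1 = (x * (x + 1) ^+ 2)^-1 by field; rewrite xn yn.
  by rewrite invr_ge0 mulr_ge0 ?exprn_ge0 ?(ltW x0) ?(ltW y0).
lra.
Qed.

End reinforced_sequence.

(** * Almost sure convergence from summable expectations *)

Section almost_sure.
Context {d : measure_display} {T : measurableType d} {R : realType}.
Variable P : probability T R.
Local Notation E := (Rintegral P setT).
Local Notation integrable X := (P.-integrable setT (EFin \o X)).

Lemma ae_mp (A B : T -> Prop) : (forall w, A w -> B w) ->
  {ae P, forall w, A w} -> {ae P, forall w, B w}.
Proof. by move=> AB; apply: filterS. Qed.

Lemma ae_and (A B : T -> Prop) : {ae P, forall w, A w} -> {ae P, forall w, B w} ->
  {ae P, forall w, A w /\ B w}.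
Proof. by apply: filterS2. Qed.

(** The sum of the series has finite expectation, hence is almost surely
    finite. *)
Lemma ae_summable (f : nat -> T -> R) (N : nat) (C : R) :
  (forall k, (N <= k)%N -> integrable (f k)) ->
  (forall k w, (N <= k)%N -> 0 <= f k w) ->
  (forall n, \sum_(N <= k < n) E (f k) <= C) ->
  {ae P, forall w, exists B, forall n, \sum_(N <= k < n) f k w <= B}.
Proof.
move=> fi f0 fC.
pose h k w := if (N <= k)%N then f k w else 0.
have hi k : integrable (h k).
  by rewrite /h; case: (leqP N k) => Nk; [exact: fi|exact: integrable_cst].
have h0 k w : 0 <= h k w by rewrite /h; case: (leqP N k) => // Nk; exact: f0.
have mh k : measurable_fun setT (EFin \o h k) by case/integrableP: (hi k).
have hsum n w : (N <= n)%N -> \sum_(N <= k < n) f k w = \sum_(0 <= k < n) h k w.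
  move=> Nn; rewrite (@big_cat_nat _ _ _ N 0 n)//=.
  rewrite [X in _ = X + _](_ : _ = 0); last first.
    by rewrite big_nat big1// => k /andP[_ kN]; rewrite /h leqNgt kN.
  by rewrite add0r; apply: eq_big_nat => k /andP[Nk _]; rewrite /h Nk.
pose g w := (\sum_(k <oo) (h k w)%:E)%E.
have gC : (\int[P]_w g w <= C%:E)%E.
  rewrite integral_nneseries//; last by move=> k w _; rewrite lee_fin.
  apply: lime_le.
    by apply: is_cvg_nneseries => n _ _; apply: integral_ge0 => w _; rewrite lee_fin.
  near=> n; have Nn : (N <= n)%N by near: n; exact: nbhs_infty_ge.
  apply: (@le_trans _ _ (\sum_(N <= k < n) E (f k))%:E); last by rewrite lee_fin.
  rewrite (@big_cat_nat _ _ _ N 0 n)//= [X in (X + _)%E](_ : _ = 0%E); last first.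
    rewrite big_nat big1// => k /andP[_ kN].
    by apply: integral0_eq => w _; rewrite /h leqNgt kN.
  rewrite add0e -sumEFin big_nat [leRHS]big_nat; apply: lee_sum => k /andP[Nk _].
  by rewrite EFin_Ex ?fi// /h Nk.
have mg : measurable_fun setT g.
  apply: (@ge0_emeasurable_sum _ _ _ setT (fun k => EFin \o h k) xpredT) => // k w _ _.
  by rewrite lee_fin.
have g0 w : (0 <= g w)%E by apply: nneseries_ge0 => k _ _; rewrite lee_fin.
have gi : P.-integrable setT g.
  apply/integrableP; split=> //; under eq_integral do rewrite gee0_abs//.
  exact: le_lt_trans gC (ltry _).
have := integrable_ae measurableT gi; apply: ae_mp => w /(_ I) gw.
exists (fine (g w)) => n; have [Nn|nN] := leqP N n; last first.
  by rewrite big_geq ?(ltnW nN)// fine_ge0.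
rewrite hsum// -lee_fin fineK// -sumEFin; apply: nneseries_lim_ge => k _ _.
by rewrite lee_fin.
Unshelve. all: by end_near. Qed.

Lemma bounded_series_terms (u : nat -> R) (N : nat) (B e : R) : (forall k, (N <= k)%N -> 0 <= u k) ->
  (forall n, \sum_(N <= k < n) u k <= B) -> 0 < e -> exists J, forall j, (J <= j)%N -> u j <= e.
Proof.
move=> u0 uB e0; pose S n := \sum_(N <= k < n + N) u k.
have ndS : nondecreasing_seq S.
  apply/nondecreasing_seqP => n; rewrite /S addSn big_nat_recr ?leq_addl//= lerDl.
  by apply: u0; rewrite leq_addl.
have cS : cvgn S.
  by apply: nondecreasing_is_cvgn => //; exists B => _ [n _ <-]; exact: uB.
have /cvgrPdist_lt /(_ _ (divr_gt0 e0 (ltr0Sn R 1))) [J _ HJ] := cS.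
exists (J + N)%N => j Jj.
have Nj : (N <= j)%N by apply: leq_trans Jj; rewrite leq_addl.
have SE : S (j - N).+1 = S (j - N)%N + u j.
  by rewrite /S addSn big_nat_recr ?leq_addl//= subnK.
have J1 : (J <= j - N)%N by lia.
have := HJ _ J1; have := HJ _ (leqW J1); rewrite /= SE.
by set l := lim _; rewrite !ltr_norml => /andP[a1 a2] /andP[b1 b2]; lra.
Qed.

Lemma ae_square_summable (Y : nat -> T -> R) (N : nat) (C : R) :
  (forall j, (N <= j)%N -> sqint P (Y j)) ->
  (forall n, \sum_(N <= j < n) E (fun w => Y j w ^+ 2) <= C) ->
  {ae P, forall w, forall e, 0 < e -> exists J, forall j, (J <= j)%N -> `|Y j w| <= e}.
Proof.
move=> sY YC.
have := @ae_summable (fun j w => Y j w ^+ 2) N C (fun j Nj => sqint_sq (sY j Nj))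
  (fun j w _ => sqr_ge0 _) YC.
apply: ae_mp => w [B YB] e e0.
have [J HJ] := bounded_series_terms (fun k _ => sqr_ge0 (Y k w)) YB (exprn_gt0 2 e0).
exists J => j /HJ; rewrite -(real_normK (num_real (Y j w))) ler_pXn2r ?nnegrE//; exact: ltW.
Qed.

Lemma sum_inv_square n : \sum_(1 <= k < n) (k%:R ^+ 2)^-1 <= 2 :> R.
Proof.
suff H m : \sum_(1 <= k < m.+2) (k%:R ^+ 2)^-1 <= 2 - m.+1%:R^-1 :> R.
  case: n => [|[|m]]; [by rewrite big_geq|by rewrite big_geq|].
  by apply: le_trans (H m) _; rewrite gerBl invr_ge0.
elim: m => [|m IH]; first by rewrite big_nat1 expr1n invr1; lra.
rewrite big_nat_recr//=; apply: le_trans (lerD IH (lexx _)) _.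
rewrite -[m.+2%:R]natr1.
have x0 : 0 < m.+1%:R :> R by rewrite ltr0n.
move: (m.+1%:R) x0 => x x0.
have y0 : 0 < x + 1 by lra.
rewrite -subr_ge0.
have -> : 2 - (x + 1)^-1 - (2 - x^-1 + ((x + 1) ^+ 2)^-1) = (x * (x + 1) ^+ 2)^-1.
  by field; rewrite !gt_eqF.
by rewrite invr_ge0 mulr_ge0 ?exprn_ge0 ?(ltW x0) ?(ltW y0).
Qed.

End almost_sure.

(** * The time scale of the weights *)

Section time_scale.
Context {R : realType}.
Variables (w : nat -> R) (N : nat).
Hypothesis w_gt0 : forall k, (N <= k)%N -> 0 < w k.

Definition total_weight n := \sum_(N <= k < n) w k.
Local Notation Lam := total_weight.
Hypothesis Lam_unbounded : forall M, exists n, M <= Lam n.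

Lemma total_weight_next n : (N <= n)%N -> Lam n.+1 = Lam n + w n.
Proof. by move=> Nn; rewrite /Lam big_nat_recr. Qed.

Lemma total_weight_mono m n : (m <= n)%N -> Lam m <= Lam n.
Proof.
elim: n => [|n IH]; first by rewrite leqn0 => /eqP ->.
rewrite leq_eqVlt => /predU1P[->//|]; rewrite ltnS => /IH /le_trans; apply.
have [Nn|nN] := leqP N n; first by rewrite total_weight_next// lerDl ltW// w_gt0.
by rewrite /Lam !big_geq// ltnW.
Qed.

Lemma total_weight_ge0 n : 0 <= Lam n.
Proof. by apply: le_trans (total_weight_mono (leq0n n)); rewrite /Lam big_geq. Qed.

Let reach (j : nat) : exists n, (j%:R ^+ 2 <= Lam n).
Proof. by have [n] := Lam_unbounded (j%:R ^+ 2); exists n. Qed.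

(** The first time at which the total weight reaches [j ^+ 2]: sparse enough for
    second moments to be summable, dense enough for consecutive total weights
    to have ratio tending to 1. *)
Definition times (j : nat) : nat := ex_minn (reach j).

Lemma times_ge j : j%:R ^+ 2 <= Lam (times j).
Proof. by rewrite /times; case: ex_minnP. Qed.

Lemma times_min j n : j%:R ^+ 2 <= Lam n -> (times j <= n)%N.
Proof. by move=> jn; rewrite /times; case: ex_minnP => m _; apply. Qed.

Lemma bracket n : exists j, [/\ (times j <= n)%N, j%:R ^+ 2 <= Lam n & Lam n <= j.+1%:R ^+ 2].
Proof.
have ex : exists j : nat, j%:R ^+ 2 <= Lam n by exists 0%N; rewrite expr0n total_weight_ge0.
have ub j : j%:R ^+ 2 <= Lam n -> (j <= Num.bound (Lam n))%N.
  move=> jn; rewrite -(ler_nat R); case: j jn => [//|j] jn.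
  apply: le_trans (ltW (archi_boundP (total_weight_ge0 n))); apply: le_trans jn.
  by rewrite expr2 ler_peMr// ler1n.
have [j jn jmax] := ex_maxnP ex ub.
exists j; split=> //; first exact: times_min.
by rewrite leNgt; apply/negP => /ltW /jmax; rewrite ltnn.
Qed.

(** Between consecutive [times] the sum moves by at most [C] times the
    increment of [Lam], which is of order [j] whereas [Lam] is of order
    [j ^+ 2]. *)
Lemma interpolate (a : nat -> R) (C : R) : (forall k, `|a k| <= C) ->
  (forall e, 0 < e -> exists J, forall j, (J <= j)%N ->
     `|\sum_(N <= k < times j) w k * a k| <= e * Lam (times j)) ->
  forall e, 0 < e -> exists M, forall n, (M <= n)%N ->
    `|\sum_(N <= k < n) w k * a k| <= e * Lam n.
Proof.
move=> aC HJ e e0; have [J {}HJ] := HJ _ (divr_gt0 e0 (ltr0Sn R 1)).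
have C0 : 0 <= C by rewrite (le_trans _ (aC 0%N)).
(* The gap satisfies [Lam n - Lam (times j) <= (j + 1) ^ 2 - j ^ 2 <= 3 j], and
   half of [e * Lam n] is left for it, hence the constant 6. *)
have [J' HJ'] : exists J' : nat, 6 * C / e <= J'%:R.
  by exists (Num.bound (6 * C / e)); rewrite ltW// archi_boundP// !mulr_ge0// ?invr_ge0 ltW.
exists (times ((maxn (maxn J J') 1).+1)) => n nM.
have [j [tj jn nj]] := bracket n.
have jJ : (maxn (maxn J J') 1 <= j)%N.
  have := le_trans (times_ge ((maxn (maxn J J') 1).+1)) (le_trans (total_weight_mono nM) nj).
  rewrite ler_pXn2r ?nnegrE// ler_nat ltnS.
  by [].
have Jj : (J <= j)%N by lia.
have J'j : (J' <= j)%N by lia.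
have j1 : 1 <= j%:R :> R by rewrite ler1n; lia.
have [Ntj|tjN] := leqP N (times j); last first.
  have := times_ge j; rewrite /Lam big_geq ?(ltnW tjN)//.
  by rewrite leNgt exprn_gt0// (lt_le_trans ltr01).
rewrite (@big_cat_nat _ _ _ (times j))//= (le_trans (ler_normD _ _))//.
have h1 := HJ j Jj.
have h2 : `|\sum_(times j <= k < n) w k * a k| <= C * (Lam n - Lam (times j)).
  have -> : Lam n - Lam (times j) = \sum_(times j <= k < n) w k.
    by rewrite /Lam (@big_cat_nat _ _ _ (times j) N n)//= [LHS]addrC addKr.
  rewrite (le_trans (ler_norm_sum _ _ _))// mulr_sumr big_nat [leRHS]big_nat.
  apply: ler_sum => k /andP[kt _]; have wk := w_gt0 (leq_trans Ntj kt).
  by rewrite normrM gtr0_norm// mulrC ler_wpM2r// ltW.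
have h3 : 6 * C <= e * j%:R.
  rewrite -ler_pdivrMl// mulrC; apply: le_trans HJ' _.
  by rewrite ler_nat.
have h4 := times_ge j; have h5 := total_weight_mono tj.
move: nj; rewrite -natr1 => nj.
move: h1 h2; set u := `|_|; set v := `|_| => h1 h2.
have h6 : C * (Lam n - Lam (times j)) <= C * (3 * j%:R) by rewrite ler_wpM2l//; nra.
have h7 : 2 * (C * (3 * j%:R)) <= e * j%:R ^+ 2 by rewrite expr2; nra.
have h8 : e * j%:R ^+ 2 <= e * Lam n by rewrite ler_pM2l.
have h9 : e * Lam (times j) <= e * Lam n by rewrite ler_pM2l.
lra.
Qed.

Lemma times_dominate (b e : R) : 0 < e ->
  exists J, forall j, (J <= j)%N -> b <= e * Lam (times j).
Proof.
move=> e0; exists (Num.bound (`|b| / e)).+1 => j bj.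
apply: le_trans (ler_norm _) _; rewrite mulrC -ler_pdivrMr//.
apply: le_trans (ltW (archi_boundP _)) _; first by rewrite divr_ge0// ltW.
apply: le_trans (times_ge j); apply: (@le_trans _ _ j%:R).
  by rewrite ler_nat ltnW.
by rewrite expr2 ler_peMr// ler1n (leq_trans _ bj).
Qed.

Context {d : measure_display} {T : measurableType d}.
Variable P : probability T R.
Local Notation E := (Rintegral P setT).

Definition negligible_along (Q : nat -> T -> R) := {ae P, forall x, forall e, 0 < e ->
  exists J, forall j, (J <= j)%N -> `|Q (times j) x| <= e * Lam (times j)}.

(** Divided by [Lam (times j)], the second moments are of order [1 / j ^+ 2],
    hence summable. *)
Lemma negligible_second_moment (Q : nat -> T -> R) (C : R) : 0 <= C ->
  (forall n, sqint P (Q n)) -> (forall n, E (fun x => Q n x ^+ 2) <= C * (1 + Lam n)) ->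
  negligible_along Q.
Proof.
move=> C0 sQ QC.
pose Y j x := (Lam (times j))^-1 * Q (times j) x.
have L0 j : (1 <= j)%N -> 0 < Lam (times j).
  by move=> j1; apply: lt_le_trans (times_ge j); rewrite exprn_gt0// ltr0n.
have sY j : (1 <= j)%N -> sqint P (Y j) by move=> _; exact: sqint_scale.
suff H n : \sum_(1 <= j < n) E (fun x => Y j x ^+ 2) <= 2 * C * 2.
  apply: ae_mp (ae_square_summable sY H) => x {}H e e0; have [J HJ] := H e e0.
  exists (maxn J 1) => j; rewrite geq_max => /andP[/HJ + j1].
  by rewrite /Y normrM gtr0_norm ?invr_gt0 ?L0// ler_pdivrMl ?L0// mulrC.
apply: (@le_trans _ _ (\sum_(1 <= j < n) 2 * C * (j%:R ^+ 2)^-1)); last first.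
  by rewrite -mulr_sumr ler_wpM2l ?sum_inv_square// mulr_ge0.
rewrite big_nat [leRHS]big_nat; apply: ler_sum => j /andP[j1 _].
rewrite /Y; under eq_Rintegral do rewrite exprMn.
rewrite ExZ; last exact: sqint_sq.
have l0 := L0 j j1; have lj := times_ge j; have q := QC (times j).
have x1 : 1 <= j%:R ^+ 2 :> R by rewrite exprn_ege1// ler1n.
rewrite exprVn ler_pdivrMl ?exprn_gt0//; apply: le_trans q _.
set l := Lam (times j) in l0 lj *; set x := j%:R ^+ 2 in lj x1 *.
have -> : l ^+ 2 * (2 * C * x^-1) = C * (2 * l * (l / x)) by rewrite expr2; ring.
rewrite ler_wpM2l//; have : 1 <= l / x by rewrite ler_pdivlMr ?mul1r// (lt_le_trans ltr01).
nra.
Qed.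

End time_scale.

(** * Weighted averages of functions of the steps *)

Section step_process.
Context {d : measure_display} {T : measurableType d} {R : realType}.
Variable P : probability T R.
Variable G : nat -> set (set T).
Local Notation E := (Rintegral P setT).

Record even_function (phi : R -> R) := {
  even_meas : measurable_fun setT phi;
  even0 : phi 0 = 0;
  even_opp : forall x, phi (- x) = phi x }.

(** What the almost sure limit theorem uses about the steps [Z]: they form a
    reinforced sequence, and so do their images under even functions, which
    are insensitive to the sign of the repetitions. *)
Record step_process (Z : nat -> T -> R) (p q : R) := {
  sp_p : 0 <= p < 1;
  sp_q : q < 1;
  sp_meas : forall k, measurable_fun setT (Z k);
  sp_id : reinforced P G Z p q (E (Z 1%N)) (E (fun w => Z 1%N w ^+ 2));
  sp_even : forall phi, even_function phi -> sqint P (fun w => phi (Z 1%N w)) ->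
    reinforced P G (fun k w => phi (Z k w)) p p (E (fun w => phi (Z 1%N w)))
      (E (fun w => phi (Z 1%N w) ^+ 2));
  sp_law : forall phi k, even_function phi -> (forall x, 0 <= phi x) -> (1 <= k)%N ->
    (\int[P]_w (phi (Z k w))%:E = \int[P]_w (phi (Z 1%N w))%:E)%E }.

(** The weights [1 / k] and [1 / (k ln k)]. [weights_decr] is the property of
    them on which summation by parts rests; it is sharp up to second order for
    [1 / k]. *)
Record weights (w : nat -> R) (N : nat) (C : R) := {
  weights_N : (1 <= N)%N;
  weights_gt0 : forall k, (N <= k)%N -> 0 < w k;
  weights_le : forall k, (N <= k)%N -> k.+1%:R * w k <= C;
  weights_decr : forall k, (N <= k)%N -> w k.+1 + w k.+1 / k.+1%:R <= w k;
  weights_div : forall M, exists n, M <= total_weight w N n }.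

End step_process.

Section law_of_large_numbers.
Context {d : measure_display} {T : measurableType d} {R : realType}.
Variable P : probability T R.
Variable G : nat -> set (set T).
Hypothesis GS : forall j k, (j <= k)%N -> G j `<=` G k.
Local Notation E := (Rintegral P setT).
Local Notation integrable X := (P.-integrable setT (EFin \o X)).
Variables (Z : nat -> T -> R) (p q : R).
Hypothesis HZ : step_process P G Z p q.
Variables (w : nat -> R) (N : nat) (C : R).
Hypothesis Hw : weights w N C.
Local Notation Lam := (total_weight w N).

Lemma weights_bounded k : (N <= k)%N -> w k <= C.
Proof.
move=> Nk; apply: le_trans (weights_le Hw Nk).
by rewrite ler_peMl ?ler1n// (ltW (weights_gt0 Hw Nk)).
Qed.

Local Notation times := (times (weights_div Hw)).

(** Summation by parts: [w k / k] is at most the decrement of [w], so averages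
    over the past can be moved back to single terms. *)
Lemma average_sum_le (u : nat -> R) n : (forall j, 0 <= u j) ->
  \sum_(N <= k < n) w k / k%:R * \sum_(1 <= j < k.+1) u j <=
  (w N + w N / N%:R) * \sum_(1 <= j < N.+1) u j + \sum_(N <= k < n) w k * u k.+1.
Proof.
move=> u0; pose A k := \sum_(1 <= j < k.+1) u j.
have A0 k : 0 <= A k by apply: sumr_ge0.
have Anext k : A k.+1 = A k + u k.+1 by rewrite /A big_nat_recr.
have wN := weights_gt0 Hw (leqnn N).
have c0 : 0 <= (w N + w N / N%:R) * A N.
  by rewrite mulr_ge0// addr_ge0 ?divr_ge0// ltW.
rewrite -/(A N).
have [nN|Nn] := leqP n N; first by rewrite !big_geq// addr0.
suff H : \sum_(N <= k < n) w k / k%:R * A k + w n.-1 * A n <=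
    (w N + w N / N%:R) * A N + \sum_(N <= k < n) w k * u k.+1.
  apply: le_trans H; rewrite lerDl mulr_ge0// ltW// (weights_gt0 Hw)//.
  by rewrite -ltnS (ltn_predK Nn).
elim: n Nn => [//|n IH]; rewrite ltnS leq_eqVlt => /predU1P[<-|Nn].
  by rewrite !big_nat1 /= Anext; lra.
rewrite big_nat_recr ?(ltnW Nn)//= [X in _ <= _ + X]big_nat_recr ?(ltnW Nn)//= Anext.
have := IH Nn; case: n Nn {IH} => [//|n] /= Nn.
have := weights_decr Hw (Nn : (N <= n)%N).
set S1 := \sum_(_ <= _ < _) _; set S2 := \sum_(_ <= _ < _) _.
move=> h1; have := ler_wpM2r (A0 n.+1) h1.
rewrite mulrDl mulrDr; move: (w n.+1 / _ * _) (w n.+1 * A _) (w n.+1 * u _) (w n * A _).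
by move=> *; lra.
Qed.

Lemma even_law_integrable (phi : R -> R) k : even_function phi -> (forall x, 0 <= phi x) ->
  (1 <= k)%N -> integrable (fun w => phi (Z 1%N w)) ->
  integrable (fun w => phi (Z k w)) /\ E (fun w => phi (Z k w)) = E (fun w => phi (Z 1%N w)).
Proof.
move=> ephi phi0 k1 i1; have law := sp_law HZ ephi phi0 k1.
split; last by rewrite /Rintegral law.
apply/integrableP; split.
  apply/measurable_EFinP; apply: measurableT_comp; first exact: even_meas.
  exact: sp_meas HZ _.
move/integrableP : i1 => [_]; under eq_integral do rewrite /= ger0_norm//.
by under [X in _ -> (X < _)%E]eq_integral do rewrite /= ger0_norm//; rewrite law.
Qed.

Variable phi : R -> R.
Hypotheses (ephi : even_function phi) (phi0 : forall x, 0 <= phi x).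
Hypothesis iphi : integrable (fun w => phi (Z 1%N w)).
Local Notation tau := (E (fun w => phi (Z 1%N w))).

(** Truncation at level [k] for the term of index [k]: the variances then grow
    at most like [k], as in the classical proof of the strong law. *)
Let trunc (k : nat) (x : R) : R := phi x * (phi x <= k%:R)%R%:R.

Let meas_le k : measurable_fun setT (fun x => (phi x <= k%:R)%R%:R : R).
Proof.
have mphi := even_meas ephi.
rewrite (_ : (fun x => _) = \1_(phi @^-1` `]-oo, k%:R])).
  by apply: measurable_indic; rewrite -[X in measurable X]setTI; exact: mphi.
apply/funext => x; rewrite indicE; congr (nat_of_bool _)%:R.
by apply/idP/idP => [xk|/set_mem /=]; [apply/mem_set|]; rewrite /= in_itv.
Qed.

Let trunc_even k : even_function (trunc k).
Proof.
split.
- by apply: measurable_funM; [exact: even_meas|exact: meas_le].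
- by rewrite /trunc (even0 ephi) mul0r.
- by move=> x; rewrite /trunc (even_opp ephi).
Qed.

Let trunc_ge0 k x : 0 <= trunc k x.
Proof. by rewrite mulr_ge0. Qed.

Let trunc_le k x : trunc k x <= phi x.
Proof. by rewrite ler_piMr// lern1 leq_b1. Qed.

Let trunc_bound k x : trunc k x <= k%:R.
Proof. by rewrite /trunc; case: (leP (phi x) k%:R) => h; rewrite ?mulr1 ?mulr0. Qed.

Let mZ k : measurable_fun setT (Z k) := sp_meas HZ k.

Let trunc_sqint k n : sqint P (fun w => trunc k (Z n w)).
Proof.
apply: (@sqint_bounded _ _ _ _ _ k%:R) => [|x].
  by apply: measurableT_comp; [exact: even_meas (trunc_even k)|exact: mZ].
by rewrite ger0_norm.
Qed.

Let trunc_reinf k := sp_even HZ (trunc_even k) (trunc_sqint k 1).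

Let m k := E (fun w => trunc k (Z 1%N w)).

Let m_le k : m k <= tau.
Proof. by apply: Ex_le => //; exact: sqint_integrable. Qed.

Let D k := innovation (fun n w => trunc k.+1 (Z n w)) p p (m k.+1) k.

Let p_lt1 : p < 1. Proof. by case/andP: (sp_p HZ). Qed.
Let p_ge0 : 0 <= p. Proof. by case/andP: (sp_p HZ). Qed.

Let D_mdiff : martingale_difference P G D 1.
Proof.
have H k := innovation_mdiff GS (trunc_reinf k.+1) p_lt1.
split=> k.
- by move=> k1; exact: mdiff_filtered (H k) _ k1.
- by move=> k1; exact: mdiff_sqint (H k) _ k1.
- by move=> Phi k1; exact: mdiff_orthogonal (H k) _ _ k1.
Qed.

(** A function bounded by [k.+1] has second moment at most [k.+1] times its
    mean. *)
Let D_second k : (1 <= k)%N -> E (fun w => D k w ^+ 2) <= k.+1%:R * tau.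
Proof.
move=> k1; apply: le_trans (innovation_second GS (trunc_reinf k.+1) p_lt1 k1) _.
apply: (@le_trans _ _ (E (fun w => k.+1%:R * trunc k.+1 (Z 1%N w)))).
  apply: Ex_le; first exact: sqint_sq.
    by apply: integrable_scale; exact: sqint_integrable.
  by move=> x; rewrite expr2 ler_wpM2r.
by rewrite ExZ ?ler_wpM2l ?m_le//; exact: sqint_integrable.
Qed.

(** The conditional mean of a truncated term is [(1 - p) m] plus [p] times the
    average of the past terms under the same truncation. *)
Let DE k x : (1 <= k)%N -> trunc k.+1 (Z k.+1 x) = D k x + (1 - p) * m k.+1 +
  p / k%:R * \sum_(1 <= j < k.+1) trunc k.+1 (Z j x).
Proof.
move=> k1; rewrite /D /innovation /centered_sum sumrB sumr_const_nat subn1 /=.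
rewrite -[_ *+ _]mulr_natl /limit_mean; field.
by rewrite pnatr_eq0 -lt0n k1 subr_eq0 gt_eqF.
Qed.

Let M n x := \sum_(N <= k < n) w k * D k x.

Let tau_ge0 : 0 <= tau. Proof. exact: Ex_ge0. Qed.

Let C_ge0 : 0 <= C.
Proof. by apply: le_trans (weights_bounded (leqnn N)); rewrite ltW// (weights_gt0 Hw). Qed.

Let M_negligible : negligible_along (weights_div Hw) P M.
Proof.
have wD : martingale_difference P G (fun k x => w k * D k x) N.
  have mD := D_mdiff; split=> k.
  - move=> Nk; apply: measurable_funM => //.
    by apply: (mdiff_filtered mD); exact: leq_trans (weights_N Hw) Nk.
  - move=> Nk; apply: sqint_scale.
    by apply: (mdiff_sqint mD); exact: leq_trans (weights_N Hw) Nk.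
  - move=> Phi Nk fP sP; have k1 := leq_trans (weights_N Hw) Nk.
    under eq_Rintegral do rewrite mulrCA.
    rewrite ExZ ?(mdiff_orthogonal mD k1 fP sP) ?mulr0//.
    by apply: sqint_mul => //; exact: (mdiff_sqint mD).
apply: (negligible_second_moment (weights_div Hw) (C := C * tau)).
- exact: mulr_ge0.
- move=> n; rewrite /M; apply: sqint_sum => k; rewrite mem_index_iota => /andP[Nk _].
  exact: (mdiff_sqint wD).
move=> n; rewrite /M (mdiff_sum_sq GS n wD).
apply: (@le_trans _ _ (C * tau * Lam n)); last by rewrite ler_wpM2l ?lerDr ?mulr_ge0.
rewrite mulr_sumr big_nat [leRHS]big_nat; apply: ler_sum => k /andP[Nk _].
have k1 := leq_trans (weights_N Hw) Nk.
under eq_Rintegral do rewrite exprMn.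
rewrite ExZ; last exact: sqint_sq (mdiff_sqint D_mdiff k1).
have wk := weights_gt0 Hw Nk.
apply: (@le_trans _ _ (w k ^+ 2 * (k.+1%:R * tau))).
  by rewrite ler_wpM2l ?sqr_ge0// D_second.
have -> : w k ^+ 2 * (k.+1%:R * tau) = (k.+1%:R * w k) * (tau * w k) by rewrite expr2; ring.
rewrite -[leRHS]mulrA ler_wpM2r ?mulr_ge0 ?(ltW wk)//; exact: (weights_le Hw).
Qed.

Let count_le (x : R) n : 0 <= x -> \sum_(N <= k < n) (k.+1%:R < x)%R%:R <= x :> R.
Proof.
move=> x0; suff H : \sum_(N <= k < n) (k.+1%:R < x)%R%:R <= Num.min x n%:R :> R.
  by rewrite (le_trans H)// ge_min lexx.
elim: n => [|n IH]; first by rewrite big_geq// le_min x0 lexx.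
have [Nn|nN] := leqP N n; last by rewrite big_geq// le_min x0 ler0n.
rewrite big_nat_recr//=; move: IH; rewrite !le_min => /andP[h1 h2].
rewrite -natr1; case: ltP => h; rewrite /=; last by rewrite addr0 h1 (le_trans h2)// lerDl.
apply/andP; split; last by rewrite lerD2r.
apply: le_trans (lerD h2 (lexx _)) _; exact: ltW.
Qed.

(** Borel-Cantelli: [sum_k P(phi (Z 1) > k) <= E phi (Z 1)]. *)
Let eventually_truncated : {ae P, forall x, exists J, forall k, (J <= k)%N -> phi (Z k.+1 x) <= k.+1%:R}.
Proof.
pose ind k x : R := (k.+1%:R < phi x)%R%:R.
have ind_even k : even_function (ind k).
  split; last by move=> x; rewrite /ind (even_opp ephi).
    rewrite /ind; under eq_fun do rewrite ltNge.
    rewrite (_ : (fun x => _) = (fun x => 1 - (phi x <= k.+1%:R)%R%:R)).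
      by apply: measurable_funB => //; exact: meas_le.
    by apply/funext => x; case: (_ <= _); rewrite /= ?subrr ?subr0.
  by rewrite /ind (even0 ephi) ltNge ler0n.
have ind0 k x : 0 <= ind k x by rewrite ler0n.
have sind k n : sqint P (fun x => ind k (Z n x)).
  apply: (@sqint_bounded _ _ _ _ _ 1) => [|x].
    by apply: measurableT_comp; [exact: even_meas (ind_even k)|exact: mZ].
  by rewrite ger0_norm// lern1 leq_b1.
have := @ae_summable _ _ _ P (fun k x => ind k (Z k.+1 x)) N tau.
move=> H; apply: ae_mp (H _ _ _) => {H} [x [b Hb]| | |].
- have [J HJ] := bounded_series_terms (fun k _ => ind0 k (Z k.+1 x)) Hb (divr_gt0 ltr01 (ltr0Sn R 1)).
  exists J => k /HJ; rewrite /ind [phi _ <= _]leNgt; case: (k.+1%:R < phi _) => //=.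
  by move=> h; have := h : (1 : R) <= 1 / 2; lra.
- by move=> k _; exact: sqint_integrable.
- by move=> k x _.
- move=> n; rewrite (eq_bigr (fun k => E (fun x => ind k (Z 1%N x)))); last first.
    move=> k _; have i1 := sqint_integrable (sind k 1).
    by case: (even_law_integrable (ind_even k) (ind0 k) (ltn0Sn k) i1).
  rewrite -Ex_sum => [|k _]; last exact: sqint_integrable.
  apply: Ex_le => //; first by apply: integrable_big => k _; exact: sqint_integrable.
  by move=> x; exact: count_le.
Qed.

(** The average of the past in the conditional mean of each term is, after
    summation by parts, at most the sum [S] itself, up to a constant. So
    [S <= M + (1 - p) tau Lam + p S + O(1)] with a negligible martingale [M],
    which is solved for [S]. *)
Lemma weighted_average_le : {ae P, forall x, forall e, 0 < e -> exists J, forall j, (J <= j)%N ->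
  \sum_(N <= k < times j) w k * phi (Z k.+1 x) <= (tau + e) * Lam (times j)}.
Proof.
apply: ae_mp (ae_and M_negligible eventually_truncated) => x [HM [J HJ]].
pose S n := \sum_(N <= k < n) w k * phi (Z k.+1 x).
pose u j := phi (Z j x).
pose t k := w k * (phi (Z k.+1 x) - trunc k.+1 (Z k.+1 x)).
have t0 k : (N <= k)%N -> 0 <= t k.
  by move=> Nk; rewrite mulr_ge0 ?subr_ge0// ltW// (weights_gt0 Hw).
have tJ k : (J <= k)%N -> t k = 0.
  by move=> /HJ h; rewrite /t /trunc h mulr1 subrr mulr0.
pose T0 := \sum_(N <= k < J) t k.
have tsum n : \sum_(N <= k < n) t k <= T0.
  elim: n => [|n IH].
    by rewrite big_geq// /T0 big_nat sumr_ge0// => k /andP[/t0].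
  have [Nn|nN] := leqP N n; last by rewrite big_geq// /T0 big_nat sumr_ge0// => k /andP[/t0].
  rewrite big_nat_recr//=; have [Jn|nJ] := leqP J n; first by rewrite tJ// addr0.
  rewrite /T0 (@big_cat_nat _ _ _ n.+1 N J) ?leqW//= -big_nat_recr//= lerDl.
  by rewrite big_nat sumr_ge0// => k /andP[nk _]; apply: t0; lia.
pose K0 := (w N + w N / N%:R) * \sum_(1 <= j < N.+1) u j.
have main n : (1 - p) * S n <= T0 + p * K0 + M n x + (1 - p) * tau * Lam n.
  have h1 : S n <= \sum_(N <= k < n) t k + M n x + (1 - p) * tau * Lam n +
      p * \sum_(N <= k < n) w k / k%:R * \sum_(1 <= j < k.+1) u j.
    rewrite /S /M /Lam /total_weight !mulr_sumr -!big_split /= big_nat [leRHS]big_nat.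
    apply: ler_sum => k /andP[Nk _]; have k1 := leq_trans (weights_N Hw) Nk.
    have wk := weights_gt0 Hw Nk.
    have -> : w k * phi (Z k.+1 x) = t k + w k * trunc k.+1 (Z k.+1 x) by rewrite /t; ring.
    rewrite DE// -subr_ge0.
    set A := \sum_(_ <= _ < _) trunc _ _; set A' := \sum_(_ <= _ < _) _.
    have AA : A <= A' by apply: ler_sum.
    rewrite [leRHS](_ : _ = w k * ((1 - p) * (tau - m k.+1) + p / k%:R * (A' - A))); last by ring.
    rewrite mulr_ge0 ?(ltW wk)// addr_ge0 ?mulr_ge0 ?subr_ge0 ?invr_ge0 ?(ltW p_lt1) ?m_le//.
  have h2 := @average_sum_le u n (fun j => phi0 _).
  have h3 := tsum n; rewrite -/K0 -/(S n) in h2.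
  have := ler_wpM2l p_ge0 h2; lra.
move=> e e0; have p10 : 0 < 1 - p by rewrite subr_gt0.
have e'0 : 0 < (1 - p) * e / 2 by rewrite divr_gt0// mulr_gt0.
have [J1 HJ1] := HM _ e'0.
have [J2 HJ2] := times_dominate (weights_div Hw) (T0 + p * K0) e'0.
exists (maxn J1 J2) => j; rewrite geq_max => /andP[/HJ1 h1 /HJ2 h3].
have h2 := main (times j).
have h4 : M (times j) x <= (1 - p) * e / 2 * Lam (times j) := le_trans (ler_norm _) h1.
rewrite -(ler_pM2l p10); apply: le_trans h2 _.
rewrite [leRHS](_ : _ = (1 - p) * e / 2 * Lam (times j) + (1 - p) * e / 2 * Lam (times j) +
   (1 - p) * tau * Lam (times j)); last by field.
by rewrite lerD2r lerD.
Qed.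

End law_of_large_numbers.

(** * Second order expansion over one step *)

Section one_step.
Context {R : realType}.

(** Used to trade a first moment for a small multiple of the weight and a
    large multiple of a summable second moment. *)
Lemma norm_le_eps_sq (x e : R) : 0 < e -> `|x| <= e + x ^+ 2 / e.
Proof.
move=> e0; rewrite -(ler_pM2r e0) mulrDl divfK ?gt_eqF// -(real_normK (num_real x)).
have := normr_ge0 x; have := sqr_ge0 (`|x| - e); nra.
Qed.

Lemma two_norm_le_eps_sq (a b e : R) : 0 < e -> 2 * `|a| * `|b| <= e * a ^+ 2 + b ^+ 2 / e.
Proof.
move=> e0; rewrite -(ler_pM2r e0) [leRHS]mulrDl divfK ?gt_eqF//.
rewrite -(real_normK (num_real a)) -(real_normK (num_real b)).
have := sqr_ge0 (e * `|a| - `|b|); rewrite !expr2; nra.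
Qed.

(** If [a + b] is large then either [a] is large and dominates, or [b] does. *)
Lemma large_sum_sq (a b eta : R) : 0 < eta ->
  (a + b) ^+ 2 * (eta < `|a + b|)%R%:R <=
  4 * (a ^+ 2 * (eta / 2 < `|a|)%R%:R) + 4 * b ^+ 2.
Proof.
move=> eta0; have a0 := sqr_ge0 a; have b0 := sqr_ge0 b.
have R0 : 0 <= 4 * (a ^+ 2 * (eta / 2 < `|a|)%R%:R).
  by apply: mulr_ge0 => //; apply: mulr_ge0.
have S0 : 0 <= 4 * b ^+ 2 by rewrite mulr_ge0.
case: (ltP eta `|a + b|) => h; last by rewrite mulr0; exact: addr_ge0.
rewrite mulr1; have ab := ler_normD a b.
have [le_ba|lt_ab] := leP `|b| `|a|.
  have -> : (eta / 2 < `|a|) by lra.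
  rewrite mulr1 -(real_normK (num_real (a + b))) -(real_normK (num_real a)).
  have : `|a + b| ^+ 2 <= (2 * `|a|) ^+ 2 by rewrite ler_pXn2r ?nnegrE ?mulr_ge0//; lra.
  by rewrite exprMn; lra.
apply: (@le_trans _ _ (4 * b ^+ 2)); last by rewrite lerDr.
rewrite -(real_normK (num_real (a + b))) -(real_normK (num_real b)).
have : `|a + b| ^+ 2 <= (2 * `|b|) ^+ 2 by rewrite ler_pXn2r ?nnegrE ?mulr_ge0//; lra.
by rewrite exprMn; lra.
Qed.

Variables (C e eta c mu sg2 theta p q : R).
Hypotheses (C0 : 0 < C) (e0 : 0 < e) (eta0 : 0 < eta) (c0 : 0 <= c).
Hypotheses (p1 : `|p| <= 1) (q1 : `|q| <= 1).

Definition tail_sq (z : R) := z ^+ 2 * (c < `|z|)%R%:R.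
Definition body_sq (z : R) := z ^+ 2 * (`|z| <= c)%R%:R.

Lemma body_tail_sq z : z ^+ 2 = body_sq z + tail_sq z.
Proof. by rewrite /body_sq /tail_sq -mulrDr; case: leP; rewrite ?addr0 ?add0r mulr1. Qed.

Lemma tail_sq_ge0 z : 0 <= tail_sq z.
Proof. by rewrite mulr_ge0 ?sqr_ge0. Qed.

(** When the scale [b] is large, a normalized step exceeds [eta / 2] only if
    the step exceeds [c], and then [mu] is dominated by the step. *)
Lemma big_jump (z b : R) : 0 < b -> c + 2 * `|mu| <= eta * b / 2 ->
  ((z - mu) / b) ^+ 2 * (eta / 2 < `|(z - mu) / b|)%R%:R <= 4 * (b ^+ 2)^-1 * tail_sq z.
Proof.
move=> b0 hb; have t0 := tail_sq_ge0 z; have bi : 0 < (b ^+ 2)^-1 by rewrite invr_gt0 exprn_gt0.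
case: ltP => h; last by rewrite mulr0; apply: mulr_ge0 => //; apply: mulr_ge0 => //; exact: ltW.
rewrite normrM normfV (gtr0_norm b0) ltr_pdivlMr// in h.
have zm := ler_normB z mu; have m0 := normr_ge0 mu.
have zc : c + `|mu| < `|z| by lra.
rewrite /tail_sq; have -> : c < `|z| by lra.
rewrite !mulr1 exprMn exprVn (_ : 4 * _ * _ = 4 * z ^+ 2 * (b ^+ 2)^-1); last by ring.
rewrite ler_pM2r//.
rewrite -(real_normK (num_real (z - mu))) -(real_normK (num_real z)).
have c1 : 0 <= c by exact: c0.
have h2 : `|z - mu| <= 2 * `|z| by lra.
have : `|z - mu| ^+ 2 <= (2 * `|z|) ^+ 2 by rewrite ler_pXn2r ?nnegrE ?mulr_ge0.
by rewrite exprMn; lra.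
Qed.

(** The constants [errA1] to [errA4] multiply terms whose sums are small
    multiples of the total weight, and must not depend on [e] and [c]; the
    constants [errB1] to [errB4] multiply terms that are summable along almost
    every trajectory, and may blow up as [e] tends to [0]. *)
Definition errA1 := (C / 2 + 2) * C * (2 * mu ^+ 2) + C ^+ 2 / 2 * (1 + 2 * `|mu|).
Definition errA2 := (C / 2 + 2) * C * 2.
Definition errA3 := C ^+ 2 / 2 + 16 * C ^+ 2.
Definition errA4 := C ^+ 2 / 2.
Definition errB1 := C ^+ 2 + C ^+ 2 / 2.
Definition errB2 := C ^+ 2 + (C / 2 * (e^-1 + 1) + 2 * e + 4 * C) * C ^+ 2.
Definition errB3 := C ^+ 2 / 2 * (C / e).
Definition errB4 := C ^+ 2 / 2 * (2 * `|mu|) * (C / e).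

(** Pathwise accounting for one step. Here [y] and [delta] are the normalized
    position and its increment, [W] and [V] the centered sums of the steps and
    of their truncated squares, [D] and [D'] their innovations. The first
    order term [h * delta] produces the drift and a multiple of [D]; the
    square of the normalized step is replaced by its conditional mean, which
    produces the variance [sg2 / b' ^+ 2], a multiple of [D'] and a multiple
    of [D]. *)
Lemma step_error (g0 g1 h dh y z k w b b' W V mphi mtau : R) :
  let r := b / b' in
  let delta := (z - mu) / b' + (r - 1) * y in
  let D := z - mu - q / k * W in
  let D' := body_sq z - mphi - p / k * V in
  1 <= k -> 0 < w -> w <= C / k -> 0 < b -> 0 < b' -> y = W / b ->
  sg2 = mphi + mtau - mu ^+ 2 -> 0 <= mtau ->
  `|h| <= C -> `|dh| <= C ->
  `|r * (1 + q / k) - 1 + theta * w| <= C / k ^+ 2 ->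
  `|sg2 / b' ^+ 2 - 2 * theta * w| <= C / k ^+ 2 ->
  (b' ^+ 2)^-1 <= C * w -> `|r - 1| <= C / k ->
  c + 2 * `|mu| <= eta * b' / 2 ->
  `|g1 - g0 - h * delta - dh * delta ^+ 2 / 2| <=
     e * delta ^+ 2 + C * delta ^+ 2 * (eta < `|delta|)%R%:R ->
  `|g1 - g0 - theta * w * (dh - y * h) - h / b' * D - dh / (2 * b' ^+ 2) * D' + mu * dh / b' ^+ 2 * D| <=
    errA1 * (e * w) + errA2 * (e * (w * z ^+ 2)) + errA3 * (w * tail_sq z) + errA4 * (mtau * w) +
    (errB1 / k ^+ 2 + errB2 * (y ^+ 2 / k ^+ 2) + errB3 * (V ^+ 2 / k ^+ 3) + errB4 * (W ^+ 2 / k ^+ 3)).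
Proof.
move=> r delta D D' k1 w0 wk b0 b'0 yW sgE mt0 hC dhC hdrift hvar hinv hr hbig htaylor.
have C00 : 0 < C by exact: C0.
have e00 : 0 < e by exact: e0.
set a := (z - mu) / b'; set f := (r - 1) * y.
have k0 : 0 < k by lra.
have t0 := tail_sq_ge0 z.
have bn : b != 0 by rewrite gt_eqF.
have b'n : b' != 0 by rewrite gt_eqF.
have kn : k != 0 by rewrite gt_eqF.
have deltaE : delta = a + f by [].
have bi0 : 0 < (b' ^+ 2)^-1 by rewrite invr_gt0 exprn_gt0.
have k2 : 0 < (k ^+ 2)^-1 by rewrite invr_gt0 exprn_gt0.
have m0 := normr_ge0 mu.
have n2 : `|2| = 2 :> R by rewrite ger0_norm.
pose rem := g1 - g0 - h * delta - dh * delta ^+ 2 / 2.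
(* The five summands: error of the drift, effect of the change of scale on the
   squared increment, error of the variance, fluctuation of the conditional second
   moment of the step, Taylor remainder. *)
have decomp : g1 - g0 - theta * w * (dh - y * h) - h / b' * D - dh / (2 * b' ^+ 2) * D' + mu * dh / b' ^+ 2 * D =
  h * y * (r * (1 + q / k) - 1 + theta * w) + dh / 2 * (delta ^+ 2 - a ^+ 2) +
  dh / 2 * (sg2 / b' ^+ 2 - 2 * theta * w) +
  dh / 2 * (b' ^+ 2)^-1 * (p / k * V - 2 * mu * (q / k * W) + tail_sq z - mtau) + rem.
  rewrite /rem /D' (_ : body_sq z = z ^+ 2 - tail_sq z); last by rewrite (body_tail_sq z) addrK.
  rewrite /D deltaE sgE /a /f yW /r; field.
  by rewrite b'n bn kn.
have ea := two_norm_le_eps_sq a f e0.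
have a2 : a ^+ 2 <= C * w * (2 * z ^+ 2 + 2 * mu ^+ 2).
  rewrite /a exprMn exprVn mulrC; apply: ler_pM => //.
  - exact: ltW.
  - by rewrite sqr_ge0.
  by have := sqr_ge0 (z + mu); rewrite !expr2; nra.
have f2 : f ^+ 2 <= C ^+ 2 * (y ^+ 2 / k ^+ 2).
  have -> : C ^+ 2 * (y ^+ 2 / k ^+ 2) = (C / k) ^+ 2 * y ^+ 2 by field.
  rewrite /f exprMn ler_wpM2r ?sqr_ge0// -(real_normK (num_real (r - 1))).
  by rewrite ler_pXn2r ?nnegrE// divr_ge0 ?(ltW C00) ?(ltW k0).
have yk : `|y| / k ^+ 2 <= (k ^+ 2)^-1 + y ^+ 2 / k ^+ 2.
  have := norm_le_eps_sq y ltr01; rewrite divr1 => h1.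
  have := ler_wpM2r (ltW k2) h1; rewrite mulrDl mul1r; lra.
have E1 : `|h * y * (r * (1 + q / k) - 1 + theta * w)| <= C ^+ 2 * ((k ^+ 2)^-1 + y ^+ 2 / k ^+ 2).
  rewrite !normrM; apply: (@le_trans _ _ (C * `|y| * (C / k ^+ 2))).
    apply: ler_pM => //; exact: ler_wpM2r.
  have -> : C * `|y| * (C / k ^+ 2) = C ^+ 2 * (`|y| / k ^+ 2) by field.
  by rewrite ler_wpM2l ?sqr_ge0.
have dh2 : `|dh / 2| <= C / 2.
  have i2 : 0 <= 2^-1 :> R by rewrite invr_ge0.
  by rewrite normrM (ger0_norm i2) ler_wpM2r.
have C20 : 0 <= C / 2 by rewrite divr_ge0 ?(ltW C00).
have E2 : `|dh / 2 * (delta ^+ 2 - a ^+ 2)| <= C / 2 * (e * a ^+ 2 + (e^-1 + 1) * f ^+ 2).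
  rewrite normrM ler_pM//; rewrite deltaE.
  have -> : (a + f) ^+ 2 - a ^+ 2 = 2 * (a * f) + f ^+ 2 by rewrite !expr2; ring.
  apply: le_trans (ler_normD _ _) _; rewrite (ger0_norm (sqr_ge0 f)) (normrM 2 (a * f)) (normrM a f) n2.
  rewrite [(e^-1 + 1) * _]mulrDl mul1r [e^-1 * _]mulrC !addrA lerD2r mulrA.
  exact: ea.
have E3 : `|dh / 2 * (sg2 / b' ^+ 2 - 2 * theta * w)| <= C ^+ 2 / 2 / k ^+ 2.
  have -> : C ^+ 2 / 2 / k ^+ 2 = C / 2 * (C / k ^+ 2) by field.
  by rewrite normrM ler_pM.
have wsq x : w * (`|x| / k) <= e * w + C / e * (x ^+ 2 / k ^+ 3).
  have h1 := norm_le_eps_sq (x / k) e0.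
  have h2 : w * ((x / k) ^+ 2 / e) <= C / k * ((x / k) ^+ 2 / e).
    by rewrite ler_wpM2r// divr_ge0 ?sqr_ge0 ?(ltW e00).
  have h3 : C / k * ((x / k) ^+ 2 / e) = C / e * (x ^+ 2 / k ^+ 3).
    by field; rewrite kn gt_eqF.
  have := ler_wpM2l (ltW w0) h1; rewrite normrM normfV (gtr0_norm k0) mulrDr; lra.
have E4 : `|dh / 2 * (b' ^+ 2)^-1 * (p / k * V - 2 * mu * (q / k * W) + tail_sq z - mtau)| <=
    C ^+ 2 / 2 * (w * (`|V| / k) + 2 * `|mu| * (w * (`|W| / k)) + w * tail_sq z + mtau * w).
  rewrite normrM; apply: (@le_trans _ _ (C / 2 * (C * w) * (`|V| / k + 2 * `|mu| * (`|W| / k) + tail_sq z + mtau))); last first.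
    rewrite le_eqVlt; apply/orP; left; apply/eqP; by field.
  apply: ler_pM => //.
    by rewrite normrM ler_pM// ger0_norm// (ltW bi0).
  apply: le_trans (ler_normB _ _) _; rewrite (ger0_norm mt0) lerD2r.
  apply: le_trans (ler_normD _ _) _; rewrite (ger0_norm t0) lerD2r.
  apply: le_trans (ler_normB _ _) _; rewrite !normrM normfV (gtr0_norm k0) n2.
  have hV : `|p| / k * `|V| <= `|V| / k.
    rewrite mulrAC mulrC [leRHS]mulrC ler_wpM2l ?invr_ge0 ?(ltW k0)//.
    by rewrite ler_piMl.
  have hW : `|q| / k * `|W| <= `|W| / k.
    rewrite mulrAC mulrC [leRHS]mulrC ler_wpM2l ?invr_ge0 ?(ltW k0)//.
    by rewrite ler_piMl.
  rewrite lerD// ler_wpM2l// mulr_ge0//.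
have E5 : `|rem| <= 2 * e * (a ^+ 2 + f ^+ 2) + C * (16 * (C * w) * tail_sq z + 4 * f ^+ 2).
  apply: le_trans htaylor _.
  have h1 : delta ^+ 2 <= 2 * (a ^+ 2 + f ^+ 2).
    by rewrite deltaE; have := sqr_ge0 (a - f); rewrite !expr2; nra.
  have h2 := large_sum_sq a f eta0; rewrite -deltaE in h2.
  have h3 := big_jump z b'0 hbig; rewrite -/a in h3.
  have h4 : 4 * (b' ^+ 2)^-1 * tail_sq z <= 4 * (C * w) * tail_sq z.
    by rewrite ler_wpM2r// ler_wpM2l.
  have h5 := ler_wpM2l (ltW e0) h1.
  rewrite -mulrA lerD//; first by rewrite (le_trans h5)//; lra.
  rewrite ler_pM2l//; lra.
rewrite decomp.
have N5 := le_trans (ler_normD _ _) (lerD (le_trans (ler_normD _ _) (lerD (le_trans (ler_normD _ _) (lerD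
   (le_trans (ler_normD _ _) (lerD E1 E2)) E3)) E4)) E5).
apply: le_trans N5 _.
have hV := wsq V; have hW := wsq W.
have hV' := ler_wpM2l (divr_ge0 (sqr_ge0 C) (ler0n R 2)) hV.
have hW' : C ^+ 2 / 2 * (2 * `|mu| * (w * (`|W| / k))) <= C ^+ 2 / 2 * (2 * `|mu| * (e * w + C / e * (W ^+ 2 / k ^+ 3))).
  by rewrite ler_wpM2l ?divr_ge0 ?sqr_ge0// ler_wpM2l// mulr_ge0.
have ha : (C / 2 + 2) * e * a ^+ 2 <= (C / 2 + 2) * e * (C * w * (2 * z ^+ 2 + 2 * mu ^+ 2)).
  by rewrite ler_wpM2l// mulr_ge0 ?addr_ge0 ?(ltW e00).
have hf : (C / 2 * (e^-1 + 1) + 2 * e + 4 * C) * f ^+ 2 <=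
    (C / 2 * (e^-1 + 1) + 2 * e + 4 * C) * (C ^+ 2 * (y ^+ 2 / k ^+ 2)).
  have ei : 0 < e^-1 by rewrite invr_gt0.
  have q0 : 0 <= C / 2 * (e^-1 + 1) by rewrite mulr_ge0// addr_ge0 ?(ltW ei).
  by rewrite ler_wpM2l//; lra.
rewrite /errA1 /errA2 /errA3 /errA4 /errB1 /errB2 /errB3 /errB4.
rewrite -subr_ge0.
(* All bounds hold with their slacks [s1], ..., [s4], and the difference of the
   two sides is the sum of the slacks. *)
pose s1 := C ^+ 2 / 2 * (e * w + C / e * (V ^+ 2 / k ^+ 3)) - C ^+ 2 / 2 * (w * (`|V| / k)).
pose s2 := C ^+ 2 / 2 * (2 * `|mu| * (e * w + C / e * (W ^+ 2 / k ^+ 3))) - C ^+ 2 / 2 * (2 * `|mu| * (w * (`|W| / k))).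
pose s3 := (C / 2 + 2) * e * (C * w * (2 * z ^+ 2 + 2 * mu ^+ 2)) - (C / 2 + 2) * e * a ^+ 2.
pose s4 := (C / 2 * (e^-1 + 1) + 2 * e + 4 * C) * (C ^+ 2 * (y ^+ 2 / k ^+ 2)) -
  (C / 2 * (e^-1 + 1) + 2 * e + 4 * C) * f ^+ 2.
have -> : forall X Y : R, X - Y = s1 + s2 + s3 + s4 + (X - Y - s1 - s2 - s3 - s4) by move=> X Y; ring.
have s10 : 0 <= s1 by rewrite /s1 subr_ge0.
have s20 : 0 <= s2 by rewrite /s2 subr_ge0.
have s30 : 0 <= s3 by rewrite /s3 subr_ge0.
have s40 : 0 <= s4 by rewrite /s4 subr_ge0.
rewrite addr_ge0//; first by rewrite (addr_ge0 (addr_ge0 (addr_ge0 s10 s20) s30) s40).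
rewrite le_eqVlt; apply/orP; left; apply/eqP; rewrite /s1 /s2 /s3 /s4.
by field; rewrite kn gt_eqF.
Qed.

End one_step.

(** * Stein's equation along the walk *)

Section eventually.
Implicit Types A B : nat -> Prop.

Definition ultimately A := exists J, forall j, (J <= j)%N -> A j.

Lemma ultimately_and A B : ultimately A -> ultimately B -> ultimately (fun j => A j /\ B j).
Proof.
move=> [J1 H1] [J2 H2]; exists (maxn J1 J2) => j; rewrite geq_max => /andP[j1 j2].
by split; [exact: H1|exact: H2].
Qed.

Lemma ultimately_imp A B : (forall j, A j -> B j) -> ultimately A -> ultimately B.
Proof. by move=> AB [J HJ]; exists J => j /HJ /AB. Qed.

End eventually.

Section stein_along_the_walk.
Context {d : measure_display} {T : measurableType d} {R : realType}.
Variable P : probability T R.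
Variable G : nat -> set (set T).
Hypothesis Gm : forall k, <<s G k >> `<=` measurable.
Hypothesis GS : forall j k, (j <= k)%N -> G j `<=` G k.
Local Notation E := (Rintegral P setT).
Local Notation integrable X := (P.-integrable setT (EFin \o X)).
Variables (Z : nat -> T -> R) (p q : R).
Hypothesis HZ : step_process P G Z p q.
Variables (w : nat -> R) (N : nat) (C0 : R).
Hypothesis Hw : weights w N C0.
Local Notation Lam := (total_weight w N).
Local Notation times := (times (weights_div Hw)).
Local Notation m1 := (E (Z 1%N)).
Local Notation m2 := (E (fun x => Z 1%N x ^+ 2)).
Local Notation mu := (limit_mean p q m1).
Local Notation W := (centered_sum Z p q m1).
Local Notation sg2 := (m2 - mu ^+ 2).

(** The scaling [b] makes [W k / b k] a discretised Ornstein-Uhlenbeck process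
    in the time of [w]: drift [- theta * y], infinitesimal variance
    [2 * theta], hence the standard normal law as stationary law. *)
Record normalization (b : nat -> R) (theta C1 : R) := {
  nz_C : 0 < C1;
  nz_q : `|q| <= 1;
  nz_theta : 0 < theta;
  nz_gt0 : forall k, (N <= k)%N -> 0 < b k;
  nz_drift : forall k, (N <= k)%N ->
    `|b k / b k.+1 * (1 + q / k%:R) - 1 + theta * w k| <= C1 / k%:R ^+ 2;
  nz_var : forall k, (N <= k)%N -> `|sg2 / b k.+1 ^+ 2 - 2 * theta * w k| <= C1 / k%:R ^+ 2;
  nz_inv : forall k, (N <= k)%N -> (b k.+1 ^+ 2)^-1 <= C1 * w k;
  nz_ratio : forall k, (N <= k)%N -> `|b k / b k.+1 - 1| <= C1 / k%:R;
  nz_second : forall k, (N <= k)%N -> E (fun x => W k x ^+ 2) <= C1 * b k ^+ 2;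
  nz_infty : forall M, exists k0, forall k, (k0 <= k)%N -> M <= b k.+1 }.

Variables (b : nat -> R) (theta C1 : R).
Hypothesis Hb : normalization b theta C1.
Definition scaled_sum k x := W k x / b k.
Local Notation Y := scaled_sum.

Let N1 k : (N <= k)%N -> (1 <= k)%N := leq_trans (weights_N Hw).

Let Wf k : filtered G k (W k). Proof. exact (@centered_sum_filtered _ _ _ P G GS Z p q m1 m2 (sp_id HZ) k). Qed.
Let Ws k : sqint P (W k) := centered_sum_sqint (sp_id HZ) k.

Let Yf k : filtered G k (Y k).
Proof. by apply: measurable_funM => //; exact: Wf. Qed.

Let Ys k : sqint P (Y k).
Proof.
have := sqint_scale (b k)^-1 (Ws k).
by congr sqint; apply/funext => x; rewrite /scaled_sum mulrC.
Qed.

Let Y_second k : (N <= k)%N -> E (fun x => Y k x ^+ 2) <= C1.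
Proof.
move=> Nk; have bk := nz_gt0 Hb Nk.
rewrite (_ : (fun x => _) = (fun x => (b k ^+ 2)^-1 * W k x ^+ 2)); last first.
  by apply/funext => x; rewrite /scaled_sum expr_div_n mulrC.
rewrite ExZ; last exact: sqint_sq.
by rewrite mulrC ler_pdivrMr ?exprn_gt0// (nz_second Hb).
Qed.

(** Martingale transforms by predictable coefficients of order [sqrt (w k)]
    have second moments of order [Lam n], hence are negligible. *)
Lemma transform_negligible (D Phi : nat -> T -> R) (gam : nat -> R) (M c2 : R) :
  0 <= M -> 0 <= c2 ->
  martingale_difference P G D 1 -> (forall k, (1 <= k)%N -> E (fun x => D k x ^+ 2) <= M) ->
  (forall k, (N <= k)%N -> filtered G k (Phi k)) ->
  (forall k x, (N <= k)%N -> `|Phi k x| <= gam k) ->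
  (forall k, (N <= k)%N -> gam k ^+ 2 <= c2 * w k) ->
  negligible_along (weights_div Hw) P (fun n x => \sum_(N <= k < n) Phi k x * D k x).
Proof.
move=> M0 c20 mD DM fPhi Phig gw.
have gB k : (N <= k)%N -> gam k <= 1 + c2 * C0.
  move=> Nk; have h1 := gw k Nk; have h2 := ler_wpM2l c20 (weights_bounded Hw Nk).
  have := sqr_ge0 (gam k - 1); rewrite !expr2 in h1 *; nra.
have mDN : martingale_difference P G D N.
  by split=> k *; [exact: (mdiff_filtered mD) (N1 _)|exact: (mdiff_sqint mD) (N1 _)|
    exact: (mdiff_orthogonal mD) (N1 _) _ _].
have mPD : martingale_difference P G (fun k x => Phi k x * D k x) N.
  apply: (@mdiff_mul _ _ _ _ _ Gm GS _ _ _ (1 + c2 * C0) mDN fPhi) => k x Nk.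
  by apply: le_trans (Phig k x Nk) (gB k Nk).
apply: (negligible_second_moment (weights_div Hw) (C := c2 * M)).
- exact: mulr_ge0.
- by move=> n; apply: sqint_sum => k; rewrite mem_index_iota => /andP[Nk _]; exact: (mdiff_sqint mPD).
move=> n; rewrite (mdiff_sum_sq GS n mPD).
apply: (@le_trans _ _ (c2 * M * Lam n)); last by rewrite ler_wpM2l ?lerDr ?mulr_ge0.
rewrite mulr_sumr big_nat [leRHS]big_nat; apply: ler_sum => k /andP[Nk _].
have sD := mdiff_sqint mDN Nk.
apply: le_trans (Ex_bounded_mul_sq (filtered_meas Gm (fPhi k Nk)) (fun x => Phig k x Nk) sD) _.
have ED0 : 0 <= E (fun x => D k x ^+ 2) by apply: Ex_ge0 => x; rewrite sqr_ge0.
rewrite [leRHS]mulrAC; apply: (ler_pM (sqr_ge0 _) ED0 (gw k Nk)).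
exact: DM (N1 Nk).
Qed.

Lemma even_sqr : even_function (fun x : R => x ^+ 2).
Proof. by split=> [||x]; [exact: measurable_funX|rewrite expr0n|rewrite sqrrN]. Qed.

Lemma measurable_norm_le (c : R) : measurable_fun setT (fun x : R => (`|x| <= c)%R%:R : R).
Proof.
have mn : measurable_fun setT (fun x : R => `|x|) by exact: measurableT_comp.
rewrite (_ : (fun x => _) = \1_((fun x : R => `|x|) @^-1` `]-oo, c])).
  by apply: measurable_indic; rewrite -[X in measurable X]setTI; exact: mn.
apply/funext => x; rewrite indicE; congr (nat_of_bool _)%:R.
by apply/idP/idP => [xk|/set_mem /=]; [apply/mem_set|]; rewrite /= in_itv.
Qed.

Lemma body_even (c : R) : even_function (body_sq c).
Proof.
split=> [||x]; last by rewrite /body_sq sqrrN normrN.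
  by apply: measurable_funM; [exact: measurable_funX|exact: measurable_norm_le].
by rewrite /body_sq expr0n mul0r.
Qed.

Lemma body_bound (c x : R) : `|body_sq c x| <= c ^+ 2.
Proof.
rewrite /body_sq; case: (leP `|x| c) => xc; last by rewrite mulr0 normr0 sqr_ge0.
rewrite mulr1 normrX -[leRHS](real_normK (num_real c)) ler_pXn2r ?nnegrE//.
exact: le_trans (ler_norm _).
Qed.

Lemma tail_even (c : R) : 0 <= c -> even_function (tail_sq c).
Proof.
move=> c0; split=> [||x]; last by rewrite /tail_sq sqrrN normrN.
  rewrite (_ : tail_sq c = (fun x => x ^+ 2 - body_sq c x)).
    by apply: measurable_funB; [exact: measurable_funX|exact: even_meas (body_even c)].
  by apply/funext => x; rewrite (body_tail_sq c x) addrC addKr.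
by rewrite /tail_sq expr0n mul0r.
Qed.

Lemma tail_le (c x : R) : tail_sq c x <= x ^+ 2.
Proof. by rewrite /tail_sq ler_piMr ?sqr_ge0// lern1 leq_b1. Qed.

(** Dominated convergence, as the second moment is finite. *)
Lemma tail_mean_small (e : R) : 0 < e -> exists2 c, 0 <= c & E (fun x => tail_sq c (Z 1%N x)) <= e.
Proof.
move=> e0; have sZ := reinf_sqint (sp_id HZ) (leqnn 1).
have mt (n : nat) : measurable_fun setT (fun x => tail_sq n%:R (Z 1%N x)).
  apply: measurableT_comp; first exact: even_meas (tail_even (ler0n R n)).
  exact: (sp_meas HZ).
pose f_ n x : \bar R := (tail_sq n%:R (Z 1%N x))%:E.
have mf_ n : measurable_fun setT (f_ n) by apply/measurable_EFinP; exact: mt.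
have cvgf : {ae P, forall x, [set: T] x -> f_ ^~ x @ \oo --> (cst 0%E : T -> \bar R) x}.
  apply: aeW => x _; apply: (@cvg_trans _ (cst (0%E : \bar R) n @[n --> \oo])); last exact: cvg_cst.
  apply: near_eq_cvg; near=> n; rewrite /f_ /tail_sq /= ltNge.
  suff -> : `|Z 1%N x| <= n%:R by rewrite mulr0.
  near: n; exact: nbhs_infty_ger.
have domf : {ae P, forall x n, [set: T] x -> (`|f_ n x| <= (Z 1%N x ^+ 2)%:E)%E}.
  apply: aeW => x n _; rewrite /f_ /= lee_fin ger0_norm ?tail_le//; exact: tail_sq_ge0.
have [_ _] := dominated_convergence measurableT mf_ (measurable_cst _) cvgf (sqint_sq sZ) domf.
rewrite integral0 => /fine_cvgP[_ /cvgrPdist_le /(_ _ e0) [n _ Hn]].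
exists n%:R => //; have := Hn n (leqnn n).
by rewrite /= sub0r normrN => h; apply: le_trans (ler_norm _) h.
Unshelve. all: by end_near. Qed.

Section stein_function.
Variables (F g h dh : R -> R) (C2 : R).
Hypotheses (C20 : 0 < C2) (cg : continuous g) (ch : continuous h) (cdh : continuous dh).
Hypothesis g_lin : forall y, `|g y| <= C2 * (1 + `|y|).
Hypothesis h_bound : forall y, `|h y| <= C2.
Hypothesis dh_bound : forall y, `|dh y| <= C2.
Hypothesis stein_eq : forall y, dh y - y * h y = F y.
Hypothesis g_taylor : forall e, 0 < e -> exists2 eta, 0 < eta & forall y t,
  `|g (y + t) - g y - h y * t - dh y * t ^+ 2 / 2| <=
     e * t ^+ 2 + C2 * t ^+ 2 * (eta < `|t|)%R%:R.

Let C := C0 + C1 + C2.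
Let C00 : 0 <= C0.
Proof. by apply: le_trans (weights_bounded Hw (leqnn N)); rewrite ltW// (weights_gt0 Hw). Qed.
Let C10 : 0 < C1 := nz_C Hb.
Let C_gt0 : 0 < C. Proof. rewrite /C; have := C00; have := C10; have := C20; lra. Qed.
Let C0C : C0 <= C. Proof. rewrite /C; have := C10; have := C20; lra. Qed.
Let C1C : C1 <= C. Proof. rewrite /C; have := C00; have := C20; lra. Qed.
Let C2C : C2 <= C. Proof. rewrite /C; have := C00; have := C10; lra. Qed.

Let gY_sqint n : sqint P (fun x => g (Y n x)).
Proof.
apply: (@sqint_le _ _ _ _ _ (fun x => C2 + C2 * `|Y n x|)).
- apply: measurableT_comp; first exact: continuous_measurable_fun.
  exact: sqint_meas (Ys n).
- apply: sqint_add; first exact: sqint_cst.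
  apply: sqint_scale; apply: sqint_le (Ys n) _.
    by apply: measurableT_comp => //; exact: sqint_meas (Ys n).
  by move=> x; rewrite normr_id.
- move=> x; rewrite [leRHS]ger0_norm; last by rewrite addr_ge0 ?mulr_ge0 ?(ltW C20).
  by have := g_lin (Y n x); rewrite mulrDr mulr1.
Qed.

Let bc0 : 0 <= 2 * C2 ^+ 2 * (1 + C1).
Proof.
apply: mulr_ge0; first by apply: mulr_ge0 => //; rewrite sqr_ge0.
by apply: addr_ge0 => //; exact: ltW C10.
Qed.

(** [g] grows linearly and [Y] is bounded in mean square. *)
Let boundary_negligible : negligible_along (weights_div Hw) P
  (fun n x => if (N <= n)%N then g (Y n x) else 0).
Proof.
apply: (negligible_second_moment (weights_div Hw) (C := 2 * C2 ^+ 2 * (1 + C1))).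
- exact: bc0.
- by move=> n; case: (leqP N n) => Nn; [exact: gY_sqint|exact: sqint_cst].
- move=> n; have L0 := total_weight_ge0 (weights_gt0 Hw) n.
  have c0 := bc0.
  case: (leqP N n) => Nn; last first.
    rewrite (_ : (fun x => _) = (fun=> 0)) ?Ex_cst; last by apply/funext => x; rewrite expr0n.
    by rewrite mulr_ge0// addr_ge0.
  apply: (@le_trans _ _ (2 * C2 ^+ 2 * (1 + C1))); last by rewrite ler_peMr// lerDl.
  have i1 := integrable_scale (2 * C2 ^+ 2) (integrable_add (integrable_cst P 1) (sqint_sq (Ys n))).
  apply: (@le_trans _ _ (E (fun x => 2 * C2 ^+ 2 * (1 + Y n x ^+ 2)))).
    apply: Ex_le => //.
      exact: sqint_sq (gY_sqint n).
    move=> x; rewrite -(real_normK (num_real (g _))) -(real_normK (num_real (Y n x))).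
    apply: (@le_trans _ _ ((C2 * (1 + `|Y n x|)) ^+ 2)).
      by rewrite ler_pXn2r ?nnegrE ?mulr_ge0 ?addr_ge0 ?(ltW C20).
    rewrite exprMn [leRHS](_ : _ = C2 ^+ 2 * (2 * (1 + `|Y n x| ^+ 2))); last by ring.
    rewrite ler_wpM2l ?sqr_ge0//.
    by have := sqr_ge0 (1 - `|Y n x|); rewrite !expr2; nra.
  rewrite (ExZ _ (integrable_add (integrable_cst P 1) (sqint_sq (Ys n)))).
  rewrite (ExD (integrable_cst P 1) (sqint_sq (Ys n))) Ex_cst ler_wpM2l ?lerD2l ?Y_second//.
  by rewrite mulr_ge0 ?sqr_ge0.
Qed.

Let D := innovation Z p q m1.
Let D_mdiff : martingale_difference P G D 1 := innovation_mdiff GS (sp_id HZ) (sp_q HZ).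
Let D_second k : (1 <= k)%N -> E (fun x => D k x ^+ 2) <= m2.
Proof. exact: (innovation_second GS (sp_id HZ) (sp_q HZ)). Qed.

Let binv k : (N <= k)%N -> (b k.+1 ^+ 2)^-1 <= C * w k.
Proof.
move=> Nk; apply: le_trans (nz_inv Hb Nk) _; rewrite ler_wpM2r//.
by rewrite ltW// (weights_gt0 Hw).
Qed.

Let bgt0 k : (N <= k)%N -> 0 < b k.+1.
Proof. by move=> Nk; apply: (nz_gt0 Hb); exact: leqW. Qed.

Let Qa n x := \sum_(N <= k < n) h (Y k x) / b k.+1 * D k x.

Let hY_filtered k : filtered G k (fun x => h (Y k x)).
Proof. by apply: measurableT_comp; [exact: continuous_measurable_fun|exact: Yf]. Qed.

Let dhY_filtered k : filtered G k (fun x => dh (Y k x)).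
Proof. by apply: measurableT_comp; [exact: continuous_measurable_fun|exact: Yf]. Qed.

Let m2_ge0 : 0 <= m2. Proof. by apply: Ex_ge0 => x; rewrite sqr_ge0. Qed.

Let Qa_negligible : negligible_along (weights_div Hw) P Qa.
Proof.
apply: (@transform_negligible D (fun k x => h (Y k x) / b k.+1) (fun k => C / b k.+1) m2 (C ^+ 2 * C)) => //.
- by rewrite mulr_ge0 ?sqr_ge0 ?(ltW C_gt0).
- by move=> k Nk; apply: measurable_funM => //; exact: hY_filtered.
- move=> k x Nk; rewrite normrM normfV (gtr0_norm (bgt0 Nk)) ler_wpM2r ?invr_ge0 ?(ltW (bgt0 Nk))//.
  exact: le_trans (h_bound _) C2C.
- by move=> k Nk; rewrite expr_div_n -mulrA ler_wpM2l ?sqr_ge0// binv.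
Qed.

(** The squared coefficients are of order [w ^+ 2], and [w] is bounded. *)
Let inv4 k a : (N <= k)%N -> 0 <= a -> (a * (b k.+1 ^+ 2)^-1) ^+ 2 <= a ^+ 2 * C ^+ 3 * w k.
Proof.
move=> Nk a0; have wk := weights_gt0 Hw Nk.
have wC : w k <= C := le_trans (weights_bounded Hw Nk) C0C.
have bi : 0 <= (b k.+1 ^+ 2)^-1 by rewrite invr_ge0 sqr_ge0.
rewrite exprMn -mulrA ler_wpM2l ?sqr_ge0//.
apply: (@le_trans _ _ ((C * w k) ^+ 2)).
  by rewrite ler_pXn2r ?nnegrE ?mulr_ge0 ?(ltW C_gt0) ?(ltW wk)// binv.
rewrite [leLHS](_ : _ = C ^+ 2 * w k * w k); last by ring.
rewrite [leRHS](_ : _ = C ^+ 2 * w k * C); last by ring.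
by rewrite ler_wpM2l// mulr_ge0 ?sqr_ge0 ?(ltW wk).
Qed.

Let Qc n x := \sum_(N <= k < n) (mu * dh (Y k x) / b k.+1 ^+ 2) * D k x.

Let Qc_negligible : negligible_along (weights_div Hw) P Qc.
Proof.
apply: (@transform_negligible D (fun k x => mu * dh (Y k x) / b k.+1 ^+ 2)
  (fun k => (`|mu| * C) * (b k.+1 ^+ 2)^-1) m2 ((`|mu| * C) ^+ 2 * C ^+ 3)) => //.
- by rewrite mulr_ge0 ?sqr_ge0 ?exprn_ge0 ?(ltW C_gt0).
- by move=> k Nk; apply: measurable_funM => //; apply: measurable_funM => //; exact: dhY_filtered.
- move=> k x Nk; rewrite normrM (normrM mu) normfV (ger0_norm (sqr_ge0 _)).
  rewrite ler_wpM2r ?invr_ge0 ?sqr_ge0// ler_wpM2l//.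
  exact: le_trans (dh_bound _) C2C.
- by move=> k Nk; rewrite inv4// mulr_ge0 ?(ltW C_gt0).
Qed.

Section fixed_precision.
Variables (e c : R).
Hypotheses (e0 : 0 < e) (c0 : 0 <= c).

Let phi := body_sq c.
Let tail := tail_sq c.
Let mphi := E (fun x => phi (Z 1%N x)).
Let mtau := E (fun x => tail (Z 1%N x)).
Hypothesis mtau_le : mtau <= e.

Let phi_even := body_even c.
Let tail_ev := tail_even c0.

Let phi_sqint n : sqint P (fun x => phi (Z n x)).
Proof.
apply: (@sqint_bounded _ _ _ _ _ (c ^+ 2)) => [|x].
  by apply: measurableT_comp; [exact: even_meas phi_even|exact: (sp_meas HZ)].
exact: body_bound.
Qed.

Let phi_reinf := sp_even HZ phi_even (phi_sqint 1).

Let tail_integrable : integrable (fun x => tail (Z 1%N x)).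
Proof.
apply: integrable_le (sqint_sq (reinf_sqint (sp_id HZ) (leqnn 1))) _.
  by apply: measurableT_comp; [exact: even_meas tail_ev|exact: (sp_meas HZ)].
by move=> x; rewrite !ger0_norm ?sqr_ge0 ?tail_sq_ge0// tail_le.
Qed.

Let m2E : m2 = mphi + mtau.
Proof.
rewrite /mphi /mtau -ExD//; last exact: sqint_integrable.
by congr (Rintegral P setT); apply/funext => x; exact: body_tail_sq.
Qed.

Let p_lt1 : p < 1. Proof. by case/andP: (sp_p HZ). Qed.

Let V := centered_sum (fun k x => phi (Z k x)) p p mphi.
Let D' := innovation (fun k x => phi (Z k x)) p p mphi.

Let D'_mdiff : martingale_difference P G D' 1 := innovation_mdiff GS phi_reinf p_lt1.

Let Qb n x := \sum_(N <= k < n) (dh (Y k x) / (2 * b k.+1 ^+ 2)) * D' k x.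

Let Qb_negligible : negligible_along (weights_div Hw) P Qb.
Proof.
apply: (@transform_negligible D' (fun k x => dh (Y k x) / (2 * b k.+1 ^+ 2))
  (fun k => C * (b k.+1 ^+ 2)^-1) (E (fun x => phi (Z 1%N x) ^+ 2)) (C ^+ 2 * C ^+ 3)) => //.
- by apply: Ex_ge0 => x; rewrite sqr_ge0.
- by rewrite mulr_ge0 ?sqr_ge0 ?exprn_ge0 ?(ltW C_gt0).
- by move=> k k1; exact: (innovation_second GS phi_reinf p_lt1).
- by move=> k Nk; apply: measurable_funM => //; exact: dhY_filtered.
- move=> k x Nk; have b2 : 0 < b k.+1 ^+ 2 by rewrite exprn_gt0// bgt0.
  rewrite normrM; apply: ler_pM => //; first exact: le_trans (dh_bound _) C2C.
  have b22 : 0 < 2 * b k.+1 ^+ 2 by rewrite mulr_gt0.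
  by rewrite normfV (gtr0_norm b22) lef_pV2 ?posrE// ler_peMl ?(ltW b2)// ler1n.
- by move=> k Nk; rewrite inv4// (ltW C_gt0).
Qed.

Let sumN1 (u : nat -> R) n : (forall k, 0 <= u k) -> \sum_(N <= k < n) u k <= \sum_(1 <= k < n) u k.
Proof.
move=> u0; have [Nn|nN] := leqP N n; last by rewrite big_geq ?(ltnW nN)// sumr_ge0.
by rewrite (@big_cat_nat _ _ _ N 1 n) ?(weights_N Hw)//= lerDr sumr_ge0.
Qed.

(** The part of the one-step error that is summable along almost every
    trajectory. *)
Let err k x := errB1 C / k%:R ^+ 2 + errB2 C e * (Y k x ^+ 2 / k%:R ^+ 2) +
  errB3 C e * (V k x ^+ 2 / k%:R ^+ 3) + errB4 C e mu * (W k x ^+ 2 / k%:R ^+ 3).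

Let B1_ge0 : 0 <= errB1 C.
Proof. by rewrite /errB1; have := sqr_ge0 C; lra. Qed.
Let B2_ge0 : 0 <= errB2 C e.
Proof.
rewrite /errB2 addr_ge0 ?sqr_ge0// mulr_ge0 ?sqr_ge0//.
have C0' := C_gt0; have e0' : 0 < e by exact: e0.
have ei : 0 < e^-1 by rewrite invr_gt0.
have : 0 <= C / 2 * (e^-1 + 1) by apply: mulr_ge0; lra.
lra.
Qed.
Let B3_ge0 : 0 <= errB3 C e.
Proof. by rewrite /errB3 mulr_ge0 ?divr_ge0 ?sqr_ge0 ?(ltW C_gt0) ?(ltW e0). Qed.
Let B4_ge0 : 0 <= errB4 C e mu.
Proof.
by rewrite /errB4 mulr_ge0 ?divr_ge0 ?(ltW C_gt0) ?(ltW e0)// mulr_ge0 ?divr_ge0 ?sqr_ge0// mulr_ge0.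
Qed.

Let ratio_ge0 (a : R) (k n : nat) : 0 <= a ^+ 2 / k%:R ^+ n.
Proof. by apply: divr_ge0; rewrite ?sqr_ge0 ?exprn_ge0. Qed.

Let err_ge0 k x : 0 <= err k x.
Proof.
rewrite /err; apply: addr_ge0; [apply: addr_ge0; [apply: addr_ge0|]|].
- by apply: divr_ge0 => //; rewrite sqr_ge0.
- by apply: mulr_ge0.
- by apply: mulr_ge0.
- by apply: mulr_ge0.
Qed.

Let err_bounded : {ae P, forall x, exists b0, forall n, \sum_(N <= k < n) err k x <= b0}.
Proof.
have cubes zeta q' m0 M0 : reinforced P G zeta p q' m0 M0 -> q' < 1 ->
    {ae P, forall x, exists b0, forall n,
      \sum_(1 <= k < n) centered_sum zeta p q' m0 k x ^+ 2 / k%:R ^+ 3 <= b0}.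
  move=> Hz q'1; have Ws' k := centered_sum_sqint Hz k.
  have sc k : integrable (fun x => centered_sum zeta p q' m0 k x ^+ 2 / k%:R ^+ 3).
    have := integrable_scale (k%:R ^+ 3)^-1 (sqint_sq (Ws' k)).
    by apply: eq_integrable => // x _; rewrite /= mulrC.
  apply: (@ae_summable _ _ _ P _ _ (4 * step_bound p q' m0 M0 / (1 - q'))) => [k _|k x _|n].
  - exact: sc.
  - exact: ratio_ge0.
  - apply: le_trans (centered_second_summable GS Hz q'1 n).
    rewrite big_nat [leRHS]big_nat; apply: ler_sum => k _.
    under eq_Rintegral do rewrite mulrC.
    by rewrite ExZ 1?mulrC//; exact: sqint_sq.
have HY : {ae P, forall x, exists b0, forall n,
      \sum_(N <= k < n) Y k x ^+ 2 / k%:R ^+ 2 <= b0}.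
  apply: (@ae_summable _ _ _ P _ _ (C1 * 2)) => [k Nk|k x _|n].
  - have := integrable_scale (k%:R ^+ 2)^-1 (sqint_sq (Ys k)).
    by apply: eq_integrable => // x _; rewrite /= mulrC.
  - exact: ratio_ge0.
  - apply: (@le_trans _ _ (\sum_(N <= k < n) C1 * (k%:R ^+ 2)^-1)).
      rewrite big_nat [leRHS]big_nat; apply: ler_sum => k /andP[Nk _].
      under eq_Rintegral do rewrite mulrC.
      rewrite ExZ; last exact: sqint_sq.
      by rewrite mulrC ler_wpM2r ?invr_ge0 ?sqr_ge0// Y_second.
    rewrite -mulr_sumr ler_wpM2l ?(ltW C10)//.
    by apply: le_trans (sum_inv_square n); apply: sumN1 => k; rewrite invr_ge0 sqr_ge0.
apply: ae_mp (ae_and HY (ae_and (cubes _ _ _ _ phi_reinf p_lt1) (cubes _ _ _ _ (sp_id HZ) (sp_q HZ)))).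
move=> x [[bY HbY] [[bV HbV] [bW HbW]]].
exists (errB1 C * 2 + errB2 C e * bY + errB3 C e * bV + errB4 C e mu * bW) => n.
rewrite /err !big_split /= -!mulr_sumr; apply: lerD; [apply: lerD; [apply: lerD|]|].
- rewrite ler_wpM2l//; apply: le_trans (sum_inv_square n).
  by apply: sumN1 => k; rewrite invr_ge0 sqr_ge0.
- by rewrite ler_wpM2l.
- rewrite ler_wpM2l//; apply: le_trans (HbV n).
  by apply: sumN1 => k; exact: ratio_ge0.
- rewrite ler_wpM2l//; apply: le_trans (HbW n).
  by apply: sumN1 => k; exact: ratio_ge0.
Qed.

(** What remains of the increment of [g (Y k)] after removal of the drift
    [theta * w k * F (Y k)] and of the three martingale transforms. *)
Let residual k x := g (Y k.+1 x) - g (Y k x) - theta * w k * F (Y k x) -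
  h (Y k x) / b k.+1 * D k x - dh (Y k x) / (2 * b k.+1 ^+ 2) * D' k x +
  mu * dh (Y k x) / b k.+1 ^+ 2 * D k x.

Let bound k x := errA1 C mu * (e * w k) + errA2 C * (e * (w k * Z k.+1 x ^+ 2)) +
  errA3 C * (w k * tail (Z k.+1 x)) + errA4 C * (mtau * w k) + err k x.

Let mtau_ge0 : 0 <= mtau. Proof. by apply: Ex_ge0 => x; exact: tail_sq_ge0. Qed.

Let A1_ge0 : 0 <= errA1 C mu.
Proof.
rewrite /errA1; have c1 := C_gt0; have s0 := sqr_ge0 mu; have n0 := normr_ge0 mu; have sC := sqr_ge0 C.
apply: addr_ge0; apply: mulr_ge0; [apply: mulr_ge0; lra|lra|lra|lra].
Qed.
Let A2_ge0 : 0 <= errA2 C.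
Proof. by rewrite /errA2; have c1 := C_gt0; apply: mulr_ge0 => //; apply: mulr_ge0; lra. Qed.
Let A3_ge0 : 0 <= errA3 C. Proof. by rewrite /errA3; have := sqr_ge0 C; lra. Qed.
Let A4_ge0 : 0 <= errA4 C. Proof. by rewrite /errA4; have := sqr_ge0 C; lra. Qed.

Let D'E k x : D' k x = body_sq c (Z k.+1 x) - mphi - p / k%:R * V k x.
Proof.
rewrite /D' /innovation; congr (_ - _ - _).
by rewrite /limit_mean mulrAC divff ?mul1r// subr_eq0 gt_eqF.
Qed.

Let w_ge0 k : (N <= k)%N -> 0 <= w k. Proof. by move=> Nk; rewrite ltW// (weights_gt0 Hw). Qed.

Let bound_ge0 k x : (N <= k)%N -> 0 <= bound k x.
Proof.
move=> Nk; have w0 := w_ge0 Nk; have e0' : 0 <= e by exact: ltW e0.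
apply: addr_ge0; last exact: err_ge0.
apply: addr_ge0; [apply: addr_ge0; [apply: addr_ge0|]|]; apply: mulr_ge0 => //.
- by apply: mulr_ge0.
- by apply: mulr_ge0 => //; apply: mulr_ge0 => //; rewrite sqr_ge0.
- by apply: mulr_ge0 => //; exact: tail_sq_ge0.
- by apply: mulr_ge0.
Qed.

Let residual_bound : exists k0, forall k x, (k0 <= k)%N -> (N <= k)%N -> `|residual k x| <= bound k x.
Proof.
have [eta eta0 taylor] := g_taylor e0.
have [k0 bk0] := nz_infty Hb (2 * (c + 2 * `|mu|) / eta).
exists k0 => k x kk0 Nk; have k1 := N1 Nk.
have kR : 1 <= k%:R :> R by rewrite ler1n.
have kp : 0 < k%:R :> R by rewrite ltr0n.
have wk := weights_gt0 Hw Nk; have bk := nz_gt0 Hb Nk; have bk' := bgt0 Nk.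
have up a (n : nat) : a <= C1 / k%:R ^+ n -> a <= C / k%:R ^+ n.
  by move=> /le_trans; apply; rewrite ler_wpM2r ?invr_ge0 ?exprn_ge0.
have absp : `|p| <= 1 by case/andP: (sp_p HZ) => p0 p1; rewrite ger0_norm// ltW.
pose delta := (Z k.+1 x - mu) / b k.+1 + (b k / b k.+1 - 1) * Y k x.
have Yn : Y k.+1 x = Y k x + delta.
  rewrite /scaled_sum centered_sum_next /delta /scaled_sum; field.
  by rewrite !gt_eqF.
rewrite /residual -stein_eq /bound /err D'E.
apply: (@step_error _ C e eta c mu sg2 theta p q C_gt0 e0 eta0 c0 absp (nz_q Hb) _ _ _ _ (Y k x) (Z k.+1 x) k%:R (w k) (b k) (b k.+1) (W k x) (V k x)) => //.
- rewrite ler_pdivlMr//; apply: le_trans C0C; apply: le_trans (weights_le Hw Nk).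
  by rewrite mulrC ler_wpM2r ?(ltW wk)// ler_nat.
- by rewrite m2E.
- exact: le_trans (h_bound _) C2C.
- exact: le_trans (dh_bound _) C2C.
- by apply: up; exact: (nz_drift Hb).
- by apply: up; exact: (nz_var Hb).
- exact: binv.
- by have := up _ 1%N; rewrite !expr1; apply; exact: (nz_ratio Hb).
- have := bk0 k kk0; rewrite ler_pdivrMr// => hb; lra.
- rewrite Yn; apply: le_trans (taylor _ _) _; rewrite lerD2l ler_wpM2r//.
  by rewrite ler_wpM2r ?sqr_ge0.
Qed.

(** The point of this constant is that it depends neither on the precision [e]
    nor on the truncation level [c], so that [e] can tend to [0]. *)
Definition stein_const := errA1 C mu + errA2 C * (m2 + 1) + 2 * errA3 C + errA4 C + 5.

(** Telescoping [g (Y k)] and bounding everything but the drift: four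
    negligible terms, and the constants together with the summable errors,
    cost [5 * e * Lam], and the averages of [Z k ^+ 2] and of its tail are
    controlled by [weighted_average_le]. *)
Lemma stein_average_le : {ae P, forall x, ultimately (fun j =>
  theta * `|\sum_(N <= k < times j) w k * F (Y k x)| <= stein_const * e * Lam (times j))}.
Proof.
have [k0 Hk0] := residual_bound.
have tail_ge0' z : 0 <= tail z by exact: tail_sq_ge0.
have L1 := weighted_average_le GS HZ Hw even_sqr (fun x => sqr_ge0 x) (sqint_sq (reinf_sqint (sp_id HZ) (leqnn 1))).
have L2 := weighted_average_le GS HZ Hw tail_ev tail_ge0' tail_integrable.
apply: ae_mp (ae_and boundary_negligible (ae_and Qa_negligible (ae_and Qb_negligible
  (ae_and Qc_negligible (ae_and err_bounded (ae_and L1 L2)))))) => x.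
move=> [/(_ e e0) H1 [/(_ e e0) H2 [/(_ e e0) H3 [/(_ e e0) H4 [[b0 H5] [/(_ 1 ltr01) H6 /(_ e e0) H7]]]]]].
pose k1 := maxn k0 N.
pose R0 := \sum_(N <= k < k1) `|residual k x|.
have R00 : 0 <= R0 by rewrite sumr_ge0.
have [J HJ] := times_dominate (weights_div Hw) (`|g (Y N x)| + R0 + b0) e0.
have HN : exists J, forall j, (J <= j)%N -> (N <= times j)%N.
  exists 1%N => j j1; rewrite leqNgt; apply/negP => tjN.
  have := times_ge (weights_div Hw) j; rewrite /total_weight big_geq ?(ltnW tjN)//.
  by rewrite leNgt exprn_gt0// ltr0n.
apply: ultimately_imp (ultimately_and HN (ultimately_and (ex_intro _ J HJ) (ultimately_and H1 (ultimately_and H2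
  (ultimately_and H3 (ultimately_and H4 (ultimately_and H6 H7))))))).
move=> j [Nj [hJ [h1 [h2 [h3 [h4 [h6 h7]]]]]]].
set n := times j in Nj hJ h1 h2 h3 h4 h6 h7 *.
rewrite Nj in h1.
have tele : \sum_(N <= k < n) (g (Y k.+1 x) - g (Y k x)) = g (Y n x) - g (Y N x).
  by rewrite telescope_sumr.
have main : theta * \sum_(N <= k < n) w k * F (Y k x) =
    g (Y n x) - g (Y N x) - Qa n x - Qb n x + Qc n x - \sum_(N <= k < n) residual k x.
  rewrite -tele /Qa /Qb /Qc mulr_sumr -!sumrB -big_split -sumrB /=.
  by apply: eq_bigr => k _; rewrite /residual; ring.
(* The one-step bound holds from [k0] on; the earlier terms are a constant. *)
have resid : \sum_(N <= k < n) `|residual k x| <= R0 + \sum_(N <= k < n) bound k x.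
  have sb m : 0 <= \sum_(N <= k < m) bound k x.
    by rewrite big_nat sumr_ge0// => k /andP[Nk _]; exact: bound_ge0.
  have [nk1|k1n] := leqP n k1.
    apply: (@le_trans _ _ R0); last by rewrite lerDl.
    by rewrite /R0 [leRHS](@big_cat_nat _ _ _ n)//= lerDl sumr_ge0.
  have Nk1 : (N <= k1)%N by rewrite leq_maxr.
  rewrite (@big_cat_nat _ _ _ k1)//= ?(ltnW k1n)// lerD2l.
  rewrite (@big_cat_nat _ _ _ k1 N n)//= ?(ltnW k1n)//.
  apply: (@le_trans _ _ (\sum_(k1 <= k < n) bound k x)); last by rewrite lerDr.
  rewrite big_nat [leRHS]big_nat; apply: ler_sum => k /andP[kk _].
  by apply: Hk0; [exact: leq_trans (leq_maxl _ _) kk|exact: leq_trans Nk1 kk].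
have sbound : \sum_(N <= k < n) bound k x = errA1 C mu * (e * Lam n) +
    errA2 C * (e * \sum_(N <= k < n) w k * Z k.+1 x ^+ 2) +
    errA3 C * (\sum_(N <= k < n) w k * tail (Z k.+1 x)) + errA4 C * (mtau * Lam n) +
    \sum_(N <= k < n) err k x.
  by rewrite /bound !big_split /= /total_weight !mulr_sumr.
have Ln := total_weight_ge0 (weights_gt0 Hw) n.
have e0' : 0 < e by exact: e0.
have b2 : errA2 C * (e * \sum_(N <= k < n) w k * Z k.+1 x ^+ 2) <= errA2 C * (e * ((m2 + 1) * Lam n)).
  by rewrite ler_wpM2l// ler_wpM2l// ltW.
have b3 : errA3 C * (\sum_(N <= k < n) w k * tail (Z k.+1 x)) <= errA3 C * (2 * e * Lam n).
  rewrite ler_wpM2l//; apply: le_trans h7 _; rewrite ler_wpM2r//.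
  by have : mtau <= e := mtau_le; rewrite -/mtau; lra.
have b4 : errA4 C * (mtau * Lam n) <= errA4 C * (e * Lam n).
  by rewrite ler_wpM2l// ler_wpM2r.
have b5 := H5 n.
have tri : theta * `|\sum_(N <= k < n) w k * F (Y k x)| <=
    `|g (Y n x)| + `|g (Y N x)| + `|Qa n x| + `|Qb n x| + `|Qc n x| + \sum_(N <= k < n) `|residual k x|.
  have th0 : 0 <= theta by exact: ltW (nz_theta Hb).
  rewrite -{1}(ger0_norm th0) -normrM main.
  apply: le_trans (ler_normB _ _) _; apply: lerD; last exact: ler_norm_sum.
  apply: le_trans (ler_normD _ _) _; rewrite lerD2r.
  apply: le_trans (ler_normB _ _) _; rewrite lerD2r.
  apply: le_trans (ler_normB _ _) _; rewrite lerD2r.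
  exact: ler_normB.
apply: le_trans tri _; rewrite sbound in resid; rewrite /stein_const.
have -> : (errA1 C mu + errA2 C * (m2 + 1) + 2 * errA3 C + errA4 C + 5) * e * Lam n =
   errA1 C mu * (e * Lam n) + errA2 C * (e * ((m2 + 1) * Lam n)) + errA3 C * (2 * e * Lam n) +
   errA4 C * (e * Lam n) + 5 * (e * Lam n) by ring.
move: h1 h2 h3 h4 hJ b2 b3 b4 b5 resid.
set x1 := `|g (Y n x)|; set x2 := `|g (Y N x)|; set x3 := `|Qa n x|; set x4 := `|Qb n x|.
set x5 := `|Qc n x|; set x6 := \sum_(N <= k < n) `|residual k x|.
set y1 := errA2 C * _; set y2 := errA2 C * _; set y3 := errA3 C * _; set y4 := errA3 C * _.
set y5 := errA4 C * _; set y6 := errA4 C * _; set y7 := errA1 C mu * _; set y8 := \sum_(_ <= _ < _) err _ _.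
set l := e * Lam n; clearbody x1 x2 x3 x4 x5 x6 y1 y2 y3 y4 y5 y6 y7 y8 l.
by move=> *; lra.
Qed.

End fixed_precision.

End stein_function.

End stein_along_the_walk.

(** * From compact support to bounded continuous functions *)

Section cutoff.
Context {R : realType}.

Definition cutoff (n : nat) (x : R) : R := Num.max 0 (Num.min 1 (n.+1%:R - `|x|)).

Lemma continuous_cutoff n : continuous (cutoff n).
Proof.
apply: max_fun_continuous; first exact: cst_continuous.
apply: min_fun_continuous; first exact: cst_continuous.
by move=> x; apply: cvgB; [exact: cvg_cst|exact: norm_continuous].
Qed.

Lemma cutoff_ge0 n x : 0 <= cutoff n x. Proof. by rewrite le_max lexx. Qed.

Lemma cutoff_le1 n x : cutoff n x <= 1.
Proof. by rewrite ge_max ler01 ge_min lexx. Qed.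

Lemma cutoff_in n x : `|x| <= n%:R -> cutoff n x = 1.
Proof.
move=> xn; rewrite /cutoff min_l; last by rewrite lerBrDr -natr1 addrC lerD2r.
by rewrite max_r.
Qed.

Lemma cutoff_out n x : n.+1%:R <= `|x| -> cutoff n x = 0.
Proof. by move=> xn; rewrite /cutoff max_l// ge_min subr_le0 xn orbT. Qed.

(** Dominated convergence under the normal law. *)
Lemma gaussian_mean_cutoff (f : R -> R) (B e : R) : continuous f -> (forall y, `|f y| <= B) -> 0 < e ->
  exists K, forall n, (K <= n)%N ->
    `|gauss_mean f - gauss_mean (fun y => f y * cutoff n y)| <= e.
Proof.
move=> cf fB e0; have cfn n : continuous (fun y => f y * cutoff n y).
  by move=> x; apply: cvgM; [exact: cf|exact: continuous_cutoff].
have fnB n y : `|f y * cutoff n y| <= B.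
  rewrite normrM (ger0_norm (cutoff_ge0 n y)); apply: le_trans (fB y).
  by rewrite ler_piMr// cutoff_le1.
pose N := normal_prob (0 : R) 1.
have [] := @dominated_convergence _ _ R N setT measurableT (fun n => EFin \o (fun y => f y * cutoff n y)) (EFin \o f) (cst B%:E).
- by move=> n; apply/measurable_EFinP; exact: continuous_measurable_fun.
- by apply/measurable_EFinP; exact: continuous_measurable_fun.
- apply: aeW => y _; apply: (@cvg_trans _ (((f y)%:E : \bar R) @[_ --> \oo])); last exact: cvg_cst.
  apply: near_eq_cvg; near=> n; rewrite /= cutoff_in ?mulr1//.
  by near: n; exact: nbhs_infty_ger.
- apply: measurable_bounded_integrable => //.
  + by rewrite (le_lt_trans (probability_le1 _ _))// ltry.
  + by apply: (@bounded_funP _ (fun=> B) `|B|) => y.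
- by apply: aeW => y n _; rewrite /= lee_fin.
move=> _ _ cv; have bf := bounded_funP fB.
have fi : N.-integrable setT (EFin \o f).
  by apply: measurable_bounded_integrable => //; [rewrite (le_lt_trans (probability_le1 _ _))// ltry|exact: continuous_measurable_fun].
have finE : (\int[N]_x (f x)%:E)%E = (fine (\int[N]_x (f x)%:E)%E)%:E by rewrite fineK//; exact: integrable_fin_num.
move: cv; rewrite /comp /= finE => /fine_cvgP[_ /cvgrPdist_le /(_ _ e0) [K _ HK]].
exists K => n /HK /=; rewrite -(integral_normal_prob cf bf).
rewrite -(integral_normal_prob (cfn n) (bounded_funP (fnB n))).
by rewrite /gaussian_mean unlock.
Unshelve. all: by end_near. Qed.

End cutoff.

Section almost_sure_clt.
Context {d : measure_display} {T : measurableType d} {R : realType}.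
Variable P : probability T R.
Variable G : nat -> set (set T).
Hypothesis Gm : forall k, <<s G k >> `<=` measurable.
Hypothesis GS : forall j k, (j <= k)%N -> G j `<=` G k.
Variables (Z : nat -> T -> R) (p q : R).
Hypothesis HZ : step_process P G Z p q.
Variables (w : nat -> R) (N : nat) (C0 : R).
Hypothesis Hw : weights w N C0.
Variables (b : nat -> R) (theta C1 : R).
Hypothesis Hb : normalization P Z p q w N b theta C1.
Local Notation Lam := (total_weight w N).
Local Notation times := (times (weights_div Hw)).
Local Notation Y := (scaled_sum P Z p q b).

(** [stein_average_le] at the precisions proportional to [1 / (i + 1)], each
    on an event of full probability. *)
Lemma almost_sure_clt_compact_support (f : R -> R) (K : R) : continuous f -> (forall y, K <= `|y| -> f y = 0) ->
  {ae P, forall x, forall e, 0 < e -> ultimately (fun n =>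
    `|\sum_(N <= k < n) w k * (f (Y k x) - gauss_mean f)| <= e * Lam n)}.
Proof.
move=> cf f0; have [Cf Cf0 fC] := bounded_compact_support cf f0.
have [g [h [dh [C C_gt0 [[cg ch cdh] gC hC dhE taylor]]]]] := stein_test_function cf f0.
have hb y : `|h y| <= C by case: (hC y).
have dhb y : `|dh y| <= C by case: (hC y).
have th0 := nz_theta Hb.
pose sc := `|stein_const P Z p q C0 C1 C| + 1.
have sc0 : 0 < sc by rewrite /sc ltr_wpDl.
pose e_ (i : nat) := theta / sc / i.+1%:R.
have e_0 i : 0 < e_ i by rewrite /e_ !divr_gt0.
have H i : {ae P, forall x, ultimately (fun j =>
    `|\sum_(N <= k < times j) w k * (f (Y k x) - gauss_mean f)| <= i.+1%:R^-1 * Lam (times j))}.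
  have [c c0 cs] := tail_mean_small HZ (e_0 i).
  have := stein_average_le Gm GS HZ Hw Hb C_gt0 cg ch cdh gC hb dhb dhE taylor (e_0 i) c0 cs.
  apply: ae_mp => x; apply: ultimately_imp => j.
  rewrite mulrC -ler_pdivlMr// => /le_trans; apply.
  have L0 := total_weight_ge0 (weights_gt0 Hw) (times j).
  rewrite ler_pdivrMr// [leRHS]mulrAC ler_wpM2r//.
  apply: (@le_trans _ _ (sc * e_ i)).
    by rewrite ler_wpM2r ?(ltW (e_0 i))// /sc (le_trans (ler_norm _))// lerDl.
  by rewrite /e_ mulrA mulrCA divff ?gt_eqF// mulr1 mulrC.
apply: ae_mp (ae_foralln H) => x Hx.
apply: (@interpolate R w N (weights_gt0 Hw) (weights_div Hw) (fun k => f (Y k x) - gauss_mean f) (Cf + `|gauss_mean f|)) => [k|e e0].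
  by apply: le_trans (ler_normB _ _) _; rewrite lerD2r.
have [J HJ] := Hx (Num.bound e^-1); exists J => j /HJ /le_trans; apply.
rewrite ler_wpM2r ?(total_weight_ge0 (weights_gt0 Hw))// -[leRHS]invrK lef_pV2 ?posrE ?invr_gt0//.
apply: le_trans (ltW (archi_boundP _)) _; first by rewrite invr_ge0 ltW.
by rewrite ler_nat.
Qed.

(** The mass that the empirical averages put outside a large interval is
    controlled by the compactly supported case, applied to the cutoff. *)
Theorem almost_sure_clt (f : R -> R) (B : R) : continuous f -> (forall y, `|f y| <= B) ->
  {ae P, forall x, forall e, 0 < e -> ultimately (fun n =>
    `|\sum_(N <= k < n) w k * f (Y k x) - gauss_mean f * Lam n| <= e * Lam n)}.
Proof.
move=> cf fB.
have aux (L s a r : R) : `|s - a * L| <= r * L -> (1 - a) * L <= r * L -> L - s <= 2 * r * L.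
  by rewrite ler_norml => /andP[]; lra.
have B0 : 0 <= B := le_trans (normr_ge0 _) (fB 0).
have B2 : 0 < 2 + 2 * B by rewrite ltr_wpDr// mulr_ge0.
have one_B (y : R) : `|(fun=> 1 : R) y| <= 1 by rewrite normr1.
have H1 n := almost_sure_clt_compact_support (@continuous_cutoff R n) (fun y => @cutoff_out R n y).
have cfn n : continuous (fun y => f y * cutoff n y).
  by move=> x; apply: cvgM; [exact: cf|exact: continuous_cutoff].
have H2 n : {ae P, forall x, forall e, 0 < e -> ultimately (fun m =>
    `|\sum_(N <= k < m) w k * (f (Y k x) * cutoff n (Y k x) - gauss_mean (fun y => f y * cutoff n y))| <= e * Lam m)}.
  apply: (@almost_sure_clt_compact_support (fun y => f y * cutoff n y) n.+1%:R) => // y /cutoff_out ->.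
  by rewrite mulr0.
apply: ae_mp (ae_and (ae_foralln H1) (ae_foralln H2)) => x [{}H1 {}H2] e; move: (e : R) => {}e e0.
pose e1 := e / (2 + 2 * B).
have e10 : 0 < e1 by rewrite divr_gt0.
have [K1 HK1] := gaussian_mean_cutoff (@cst_continuous _ _ (1:R)) one_B e10.
have [K2 HK2] := gaussian_mean_cutoff cf fB e10.
pose n := maxn K1 K2.
have h1 := HK1 n (leq_maxl _ _); have h2 := HK2 n (leq_maxr _ _).
have chiE : (fun y : R => (fun=> 1 : R) y * cutoff n y) = cutoff n by apply/funext => y; rewrite mul1r.
rewrite chiE gauss_mean_cst in h1.
apply: ultimately_imp (ultimately_and (H1 n e1 e10) (H2 n e1 e10)) => m [hm1 hm2].
have L0 := total_weight_ge0 (weights_gt0 Hw) m.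
set c1 := gauss_mean (cutoff n) in h1 hm1; set c2 := gauss_mean (fun y => f y * cutoff n y) in h2 hm2.
set c := gauss_mean f in h2 *.
pose s1 := \sum_(N <= k < m) w k * cutoff n (Y k x).
pose s2 := \sum_(N <= k < m) w k * (f (Y k x) * cutoff n (Y k x)).
have e1E : s1 - c1 * Lam m = \sum_(N <= k < m) w k * (cutoff n (Y k x) - c1).
  by rewrite /s1 /total_weight mulr_sumr -sumrB; apply: eq_bigr => k _; ring.
have e2E : s2 - c2 * Lam m = \sum_(N <= k < m) w k * (f (Y k x) * cutoff n (Y k x) - c2).
  by rewrite /s2 /total_weight mulr_sumr -sumrB; apply: eq_bigr => k _; ring.
have rest : `|\sum_(N <= k < m) w k * f (Y k x) - s2| <= B * (Lam m - s1).
  rewrite /s2 /s1 /total_weight -!sumrB mulr_sumr.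
  apply: le_trans (ler_norm_sum _ _ _) _; rewrite big_nat [leRHS]big_nat.
  apply: ler_sum => k /andP[Nk _]; have wk := weights_gt0 Hw Nk.
  have -> : w k * f (Y k x) - w k * (f (Y k x) * cutoff n (Y k x)) =
     w k * (f (Y k x) * (1 - cutoff n (Y k x))) by ring.
  have -> : B * (w k - w k * cutoff n (Y k x)) = w k * (B * (1 - cutoff n (Y k x))) by ring.
  have c10 : 0 <= 1 - cutoff n (Y k x) by rewrite subr_ge0 cutoff_le1.
  by rewrite normrM (gtr0_norm wk) ler_wpM2l ?(ltW wk)// normrM (ger0_norm c10) ler_wpM2r.
rewrite -e1E in hm1; rewrite -e2E in hm2.
have s1L : Lam m - s1 <= 2 * e1 * Lam m.
  have h3 : (1 - c1) * Lam m <= e1 * Lam m.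
    by rewrite ler_wpM2r//; apply: le_trans (ler_norm _) h1.
  exact: aux hm1 h3.
have h4 : `|(c2 - c) * Lam m| <= e1 * Lam m.
  by rewrite normrM (ger0_norm L0) ler_wpM2r// distrC.
have h5 := ler_wpM2l B0 s1L.
have -> : e * Lam m = B * (2 * e1 * Lam m) + e1 * Lam m + e1 * Lam m.
  by rewrite /e1; field; rewrite gt_eqF.
set S := \sum_(N <= k < m) w k * f (Y k x) in rest *.
have -> : S - c * Lam m = (S - s2) + (s2 - c2 * Lam m) + (c2 - c) * Lam m by ring.
apply: le_trans (ler_normD _ _) _; apply: lerD h4; apply: le_trans (ler_normD _ _) _.
by apply: lerD hm2; exact: le_trans rest h5.
Qed.

End almost_sure_clt.

(** * The two reinforced walks *)

Section walks.
Context {d : measure_display} {T : measurableType d} {R : realType}.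
Variables (P : probability T R) (X : nat -> {RV P >-> R})
  (eps : nat -> {RV P >-> bool}) (U : nat -> {RV P >-> nat}) (p : R).
Hypotheses (hp : 0 <= p < 1) (hin : reinforcement_inputs X eps U p).
Hypothesis hX2 : ('E_P[fun w => (X 1%N w ^+ 2)%R] < +oo)%E.
Local Notation E := (Rintegral P setT).

(** A class generating the sigma-algebra of the inputs up to time [k], which
    determine the walk up to time [k]. *)
Definition history_sigma (k : nat) := cylinders (input_sigma X eps U) (past k).

Lemma history_sigma_measurable k : <<s history_sigma k >> `<=` measurable.
Proof.
apply: sigma_cylinders_measurable (@past_index k) => i _; exact: input_sigma_measurable.
Qed.

Lemma history_sigmaS j k : (j <= k)%N -> history_sigma j `<=` history_sigma k.
Proof.
move=> jk; apply: cylindersS => i [ii ij]; split=> //; exact: leq_trans jk.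
Qed.

Lemma sqint_X1 : sqint P (X 1%N).
Proof.
split; first exact: measurable_funPT.
apply/integrableP; split.
  by apply/measurable_EFinP; apply: measurable_funX; exact: measurable_funPT.
under eq_integral do rewrite /= ger0_norm ?sqr_ge0//.
by move: hX2; rewrite unlock.
Qed.

(** A function [psi] with [psi (s * x) = t * psi x] sends the steps to a
    sequence reinforced with sign [t]: the identity has [t = s], even
    functions have [t = 1]. *)
Lemma step_processP (g : R -> R) (s : R) : (forall x, g x = s * x) -> s = 1 \/ s = -1 ->
  step_process P history_sigma (step X eps U g) p (s * p).
Proof.
move=> gE sE; have /andP[p0 p1] := hp.
have step1 : step X eps U g 1%N = X 1%N by apply/funext.
have reinf (psi : R -> R) t : measurable_fun setT psi -> psi 0 = 0 -> t = 1 \/ t = -1 ->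
    (forall x, psi (s * x) = t * psi x) -> sqint P (fun w => psi (X 1%N w)) ->
    reinforced P history_sigma (fun k w => psi (step X eps U g k w)) p (t * p)
      (E (fun w => psi (X 1%N w))) (E (fun w => psi (X 1%N w) ^+ 2)).
  move=> mpsi psi0 tE psis sX; split=> [k k1|k k1|k k1|k Phi k1 fPhi sPhi].
  - have a := adapted_step (P := P) (X := X) (eps := eps) (U := U) gE k1.
    exact: (measurableT_comp mpsi (a : filtered (history_sigma) k (step X eps U g k))).
  - by have [] := step_sqint hp hin gE k1 mpsi psi0 tE psis sX.
  - by have [] := step_sqint hp hin gE k1 mpsi psi0 tE psis sX.
  - have aPhi : adapted X eps U k Phi := fPhi.
    exact: (@step_expectation _ _ _ P X eps U p hp hin g s gE Phi psi t k k1 aPhi sPhi mpsi psi0 tE psis sX).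
split=> //.
- by case: sE => ->; rewrite ?mul1r// mulN1r; lra.
- exact: step_measurable gE.
- by rewrite step1; apply: (reinf id s) => //; exact: sqint_X1.
- move=> phi [mphi phi0 phis]; rewrite step1 => sphi.
  have := reinf phi 1 mphi phi0 (or_introl erefl); rewrite mul1r; apply=> // x.
  by rewrite mul1r; case: sE => ->; rewrite ?mul1r// mulN1r phis.
- move=> phi k [mphi phi0 phis] phi_ge0 k1; rewrite step1.
  apply: (step_law hp hin gE) => // x.
  by case: sE => ->; rewrite ?mul1r// mulN1r phis.
Qed.

Lemma moment1 : moment P (X 1%N) 1 = E (X 1%N).
Proof. by rewrite /moment unlock. Qed.

Lemma moment2 : moment P (X 1%N) 2 = E (fun w => X 1%N w ^+ 2).
Proof. by rewrite /moment unlock. Qed.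

End walks.

(** * Logarithmic scales and normalizing sequences *)

Section total_weight_log.
Context {R : realType}.
Variables (w L : nat -> R) (N : nat).
Hypothesis w_gt0 : forall k, (N <= k)%N -> 0 < w k.
Hypothesis L_up : forall k, (N <= k)%N -> L k.+1 - L k <= w k.
Hypothesis L_lo : forall k, (N <= k)%N -> w k.+1 <= L k.+1 - L k.
Local Notation Lam := (total_weight w N).

(** Comparison of a sum with increments of [L] on both sides, as in the
    integral test. *)
Lemma total_weight_between n : (N <= n)%N ->
  L n.+1 - L N <= Lam n.+1 /\ Lam n.+1 <= w N + L n - L N.
Proof.
move=> Nn; have step m : (N <= m)%N -> Lam m.+1 = Lam m + w m.
  by move=> Nm; rewrite /total_weight big_nat_recr.
rewrite -(subnKC Nn); elim: (n - N)%N => [|m [h1 h2]].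
  rewrite addn0 (step N (leqnn N)) [Lam N]big_geq// add0r addrK.
  by split=> //; exact: L_up.
have Nm : (N <= N + m)%N by exact: leq_addr.
rewrite addnS (step (N + m).+1 (leqW Nm)).
by have := L_up (leqW Nm); have := L_lo Nm; move: h1 h2; split; lra.
Qed.

Lemma total_weight_near : exists C, forall n, (N <= n)%N -> `|Lam n.+1 - L n| <= C.
Proof.
exists (w N + `|L N|) => n Nn; have [h1 h2] := total_weight_between Nn.
have wN := w_gt0 (leqnn N).
have := ler_norm (L N); have := ler_norm (- L N); rewrite normrN ler_norml => h3 h4.
have := L_lo Nn; have := w_gt0 (leqW Nn) => h5 h6.
by apply/andP; split; lra.
Qed.

End total_weight_log.

Section square_root_scale.
Context {d : measure_display} {T : measurableType d} {R : realType}.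
Variable P : probability T R.
Local Notation E := (Rintegral P setT).
Variables (Z : nat -> T -> R) (p q : R) (B : nat -> R) (N : nat) (theta a c : R).
Local Notation m1 := (E (Z 1%N)).
Local Notation m2 := (E (fun x => Z 1%N x ^+ 2)).
Local Notation mu := (limit_mean p q m1).
Local Notation W := (centered_sum Z p q m1).
Hypotheses (N1 : (1 <= N)%N) (q1 : `|q| <= 1) (th0 : 0 < theta) (a0 : 0 < a) (c1 : 1 <= c).
Hypothesis aE : m2 - mu ^+ 2 = 2 * theta * a ^+ 2.
Hypothesis B_gt0 : forall k, (N <= k)%N -> 0 < B k.
Hypothesis B_le : forall k, (N <= k)%N -> B k <= B k.+1.
Hypothesis B_ratio : forall k, (N <= k)%N -> 1 - B k / B k.+1 <= c / k%:R.
Hypothesis B_drift : forall k, (N <= k)%N ->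
  `|1 - B k / B k.+1 - (2 * q / k%:R + 2 * theta * (B k)^-1)| <= c / k%:R ^+ 2.
Hypothesis B_inv : forall k, (N <= k)%N -> `|(B k.+1)^-1 - (B k)^-1| <= c / k%:R ^+ 2.
Hypothesis B_second : forall k, (N <= k)%N -> E (fun x => W k x ^+ 2) <= c * B k.
Hypothesis B_infty : forall M, exists k0, forall k, (k0 <= k)%N -> M <= B k.+1.

(** Both scalings are [a * sqrt B] with weights [1 / B]. Writing
    [r = b k / b k.+1], the expansion [r = 1 - (1 - r ^+ 2) / 2 - (1 - r) ^+ 2
    / 2] reduces the drift condition to one on the ratio
    [r ^+ 2 = B k / B k.+1], free of square roots. *)
Lemma sqrt_normalization : exists C1,
  normalization P Z p q (fun k => (B k)^-1) N (fun k => a * Num.sqrt (B k)) theta C1.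
Proof.
have a2 : 0 < a ^+ 2 by rewrite exprn_gt0.
have ai : 0 < (a ^+ 2)^-1 by rewrite invr_gt0.
have c0 : 0 < c := lt_le_trans ltr01 c1.
pose C1 := c ^+ 2 + 2 * c + 2 * theta * c + (a ^+ 2)^-1 + c / a ^+ 2.
have t1 : 0 <= c ^+ 2 by rewrite sqr_ge0.
have t2 : 0 <= 2 * theta * c by rewrite !mulr_ge0// ltW.
have t3 : 0 <= c / a ^+ 2 by rewrite divr_ge0// ltW.
have B1 k : (N <= k)%N -> 0 < B k.+1 by move=> Nk; apply: B_gt0; exact: leqW.
have kR k : (N <= k)%N -> 0 < k%:R :> R by move=> Nk; rewrite ltr0n (leq_trans N1).
have up k (n : nat) x : (N <= k)%N -> x <= C1 -> x / k%:R ^+ n <= C1 / k%:R ^+ n.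
  by move=> Nk xC; rewrite ler_wpM2r// invr_ge0 exprn_ge0.
have sB k : (N <= k)%N -> (a * Num.sqrt (B k)) ^+ 2 = a ^+ 2 * B k.
  by move=> Nk; rewrite exprMn sqr_sqrtr// ltW// B_gt0.
pose r k := a * Num.sqrt (B k) / (a * Num.sqrt (B k.+1)).
have r0 k : 0 <= r k by rewrite divr_ge0// mulr_ge0 ?sqrtr_ge0// ltW.
have r2 k : (N <= k)%N -> r k ^+ 2 = B k / B k.+1.
  move=> Nk; rewrite /r expr_div_n (sB k Nk) (sB k.+1 (leqW Nk)).
  by field; rewrite !gt_eqF ?B1.
have y0 k : (N <= k)%N -> 0 <= 1 - r k ^+ 2.
  by move=> Nk; rewrite r2// subr_ge0 ler_pdivrMr ?B1// mul1r B_le.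
have r1 k : (N <= k)%N -> r k <= 1.
  by move=> /y0; rewrite subr_ge0 -[leRHS](expr1n _ 2) ler_pXn2r ?nnegrE.
have ry k : (N <= k)%N -> 1 - r k <= 1 - r k ^+ 2.
  by move=> Nk; rewrite lerD2l lerN2 expr2 ler_piMr// r1.
have rc k : (N <= k)%N -> 1 - r k <= c / k%:R.
  by move=> Nk; apply: le_trans (ry k Nk) _; rewrite r2// B_ratio.
exists C1; split => //.
- by rewrite /C1; lra.
- by move=> k Nk; rewrite mulr_gt0// sqrtr_gt0 B_gt0.
- move=> k Nk; rewrite -/(r k); have h1 := B_drift Nk; rewrite -r2// in h1.
  have k2 : 0 < (k%:R ^+ 2)^-1 :> R by rewrite invr_gt0 exprn_gt0// kR.
  have h2 : (1 - r k) ^+ 2 <= c ^+ 2 / k%:R ^+ 2.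
    by rewrite -expr_div_n ler_pXn2r ?nnegrE ?rc ?subr_ge0 ?r1// divr_ge0// ltW.
  have h3 : `|q / k%:R * (1 - r k)| <= c / k%:R ^+ 2.
    rewrite normrM (ger0_norm (_ : 0 <= 1 - r k)); last by rewrite subr_ge0 r1.
    rewrite normrM normfV (gtr0_norm (kR k Nk)).
    have -> : c / k%:R ^+ 2 = k%:R^-1 * (c / k%:R) by field; rewrite gt_eqF// kR.
    have ki : 0 <= k%:R^-1 :> R by rewrite invr_ge0.
    apply: (ler_pM _ _ _ (rc k Nk)); [exact: mulr_ge0|by rewrite subr_ge0 r1|].
    by rewrite ler_piMl.
  apply: (@le_trans _ _ ((c ^+ 2 + 2 * c) / k%:R ^+ 2)); last by apply: up => //; rewrite /C1; lra.
  have -> : r k * (1 + q / k%:R) - 1 + theta * (B k)^-1 =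
    - ((1 - r k) ^+ 2 / 2) - q / k%:R * (1 - r k) -
    (1 - r k ^+ 2 - (2 * q / k%:R + 2 * theta * (B k)^-1)) / 2 by field; rewrite ?gt_eqF ?kR ?B_gt0.
  have -> : (c ^+ 2 + 2 * c) / k%:R ^+ 2 = c ^+ 2 / k%:R ^+ 2 + 2 * (c / k%:R ^+ 2) by ring.
  move: h1 h2 h3 (sqr_ge0 (1 - r k)).
  rewrite !ler_norml; move: ((1 - r k) ^+ 2) (q / k%:R * (1 - r k)) (1 - r k ^+ 2 - _) (c / k%:R ^+ 2) (c ^+ 2 / k%:R ^+ 2).
  by move=> x1 x2 x3 x4 x5 /andP[? ?] ? /andP[? ?] ?; apply/andP; split; lra.
- move=> k Nk; rewrite (sB k.+1 (leqW Nk)) aE.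
  have -> : 2 * theta * a ^+ 2 / (a ^+ 2 * B k.+1) - 2 * theta * (B k)^-1 =
     2 * theta * ((B k.+1)^-1 - (B k)^-1).
    have b1 := B1 k Nk; have b0 := B_gt0 Nk; have a0' : 0 < a by exact: a0.
    by field; rewrite !gt_eqF.
  have tt0 : 0 <= 2 * theta by rewrite mulr_ge0// ltW.
  rewrite normrM ger0_norm//; apply: le_trans (ler_wpM2l tt0 (B_inv Nk)) _.
  by rewrite mulrA; apply: up => //; rewrite /C1; lra.
- move=> k Nk; rewrite (sB k.+1 (leqW Nk)) invfM.
  have Bi : (B k.+1)^-1 <= (B k)^-1.
    rewrite lef_pV2 ?posrE; [exact: B_le|exact: B1|exact: B_gt0].
  have Bi0 : 0 <= (B k.+1)^-1 by rewrite invr_ge0 ltW// B1.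
  apply: (ler_pM (ltW ai) Bi0 _ Bi).
  by rewrite /C1; lra.
- move=> k Nk; rewrite -/(r k) distrC ger0_norm ?subr_ge0 ?r1//.
  apply: le_trans (rc k Nk) _; have := @up k 1%N c Nk; rewrite expr1; apply.
  by rewrite /C1; lra.
- move=> k Nk; rewrite (sB k Nk) mulrA; apply: le_trans (B_second Nk) _.
  rewrite ler_wpM2r// ?(ltW (B_gt0 Nk))// -ler_pdivrMr//.
  by rewrite /C1; lra.
- move=> M; have [k0 Hk0] := B_infty ((M / a) ^+ 2); exists k0 => k /Hk0 h.
  rewrite -ler_pdivrMl// mulrC; apply: le_trans (ler_norm _) _.
  by rewrite -sqrtr_sqr ler_wsqrtr.
Qed.

End square_root_scale.

(** * The weights [1 / k] and [1 / (k ln k)] *)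

Section log_averages.
Context {R : realType}.
Implicit Types (w L : nat -> R).

Definition diverges L := forall M, exists k0, forall k, (k0 <= k)%N -> M <= L k.

(** Replaces the total weight by its logarithmic equivalent [L] and shifts the
    index, since the sums include their last term. *)
Lemma log_average_cvg w L N (S : nat -> R) (C c : R) :
  (forall n, (N <= n)%N -> `|total_weight w N n.+1 - L n| <= C) -> diverges L ->
  (forall e, 0 < e -> ultimately (fun n => `|S n - c * total_weight w N n| <= e * total_weight w N n)) ->
  (L n)^-1 * S n.+1 @[n --> \oo] --> c.
Proof.
move=> LC Linf HS; apply/cvgrPdist_le => e e0.
have C0 : 0 <= C := le_trans (normr_ge0 _) (LC N (leqnn N)).
have e20 : 0 < e / 2 by rewrite divr_gt0.
have [J HJ] := HS _ e20; have [J' HJ'] := Linf (Num.max 1 ((`|c| * C + e / 2 * C) / (e / 2))).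
exists (maxn N (maxn J J')) => // n /=; rewrite !geq_max => /and3P[Nn Jn J'n].
have := HJ' n J'n; rewrite ge_max => /andP[L1]; rewrite ler_pdivrMr// => hL.
have L0 : 0 < L n := lt_le_trans ltr01 L1.
have h1 := HJ n.+1 (leqW Jn); have h2 := LC n Nn.
have -> : c - (L n)^-1 * S n.+1 = (L n)^-1 * (c * L n - S n.+1) by field; rewrite gt_eqF.
have Li : 0 < (L n)^-1 by rewrite invr_gt0.
rewrite normrM (gtr0_norm Li) mulrC ler_pdivrMr//.
set Lam := total_weight w N n.+1 in h1 h2.
have -> : c * L n - S n.+1 = - (S n.+1 - c * Lam) - c * (Lam - L n) by ring.
apply: le_trans (ler_normB _ _) _; rewrite normrN normrM.
have h3 : `|c| * `|Lam - L n| <= `|c| * C by rewrite ler_wpM2l.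
have h4 : e / 2 * Lam <= e / 2 * (L n + C).
  by rewrite ler_wpM2l ?(ltW e20)//; move: h2; rewrite ler_norml => /andP[]; lra.
apply: le_trans (lerD (le_trans h1 h4) h3) _.
have -> : e * L n = L n * (e / 2) + e / 2 * L n by field.
by move: hL; rewrite mulrDr; lra.
Qed.

(** Concavity of the logarithm, applied below both to [ln] and to [ln] of
    [ln]. *)
Lemma ln_sub_le (x y : R) : 0 < x -> 0 < y -> ln y - ln x <= y / x - 1.
Proof.
move=> x0 y0; rewrite -ln_div ?posrE//.
have -> : y / x = 1 + (y / x - 1) by ring.
apply: le_trans (le_ln1Dx _) _; last by lra.
by have := divr_gt0 y0 x0; lra.
Qed.

Lemma ln_step (k : nat) : (1 <= k)%N ->
  k.+1%:R^-1 <= ln k.+1%:R - ln k%:R :> R /\ ln k.+1%:R - ln k%:R <= k%:R^-1 :> R.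
Proof.
move=> k1; have k0 : 0 < k%:R :> R by rewrite ltr0n.
have k10 : 0 < k.+1%:R :> R by rewrite ltr0n.
split.
  have := ln_sub_le k10 k0; have -> : k%:R / k.+1%:R - 1 = - k.+1%:R^-1 :> R.
    by rewrite -natr1; field; rewrite gt_eqF// natr1.
  by rewrite -[leLHS]opprB lerN2.
apply: le_trans (ln_sub_le k0 k10) _.
have -> : k.+1%:R / k%:R - 1 = k%:R^-1 :> R by rewrite -natr1; field; rewrite gt_eqF.
exact: lexx.
Qed.

Lemma half_le_ln (k : nat) : (2 <= k)%N -> 1 / 2 <= ln k%:R :> R.
Proof.
move=> k2; apply: (@le_trans _ _ (ln 2)).
  by have [] := @ln_step 1 isT; rewrite ln1 subr0 div1r.
by rewrite ler_ln ?posrE ?ltr0n ?ler_nat// (leq_trans _ k2).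
Qed.

Lemma lnln_step (k : nat) : (2 <= k)%N ->
  (k.+1%:R * ln k.+1%:R)^-1 <= ln (ln k.+1%:R) - ln (ln k%:R) :> R /\
  ln (ln k.+1%:R) - ln (ln k%:R) <= (k%:R * ln k%:R)^-1 :> R.
Proof.
move=> k2; have k1 : (1 <= k)%N by exact: ltnW.
have l0 : 0 < ln k%:R :> R by apply: lt_le_trans (half_le_ln k2); rewrite divr_gt0.
have l10 : 0 < ln k.+1%:R :> R by apply: lt_le_trans (half_le_ln (leqW k2)); rewrite divr_gt0.
have [h1 h2] := ln_step k1; split.
  rewrite invfM -lerN2 opprB; apply: le_trans (ln_sub_le l10 l0) _.
  have -> : ln k%:R / ln k.+1%:R - 1 = - ((ln k.+1%:R - ln k%:R) / ln k.+1%:R) :> R.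
    by field; rewrite gt_eqF.
  by rewrite lerN2 ler_wpM2r// invr_ge0 ltW.
apply: le_trans (ln_sub_le l0 l10) _.
have -> : ln k.+1%:R / ln k%:R - 1 = (ln k.+1%:R - ln k%:R) / ln k%:R :> R.
  by field; rewrite gt_eqF.
by rewrite invfM ler_wpM2r// invr_ge0 ltW.
Qed.

Lemma ln_diverges : diverges (fun k => ln k%:R).
Proof.
move=> M; exists (Num.bound (expR M)) => k Hk.
have kM : expR M <= k%:R.
  by apply: le_trans (ltW (archi_boundP (expR_ge0 M))) _; rewrite ler_nat.
by rewrite -[leLHS](expRK M) ler_ln ?posrE ?expR_gt0// (lt_le_trans (expR_gt0 M)).
Qed.

Lemma lnln_diverges : diverges (fun k => ln (ln k%:R)).
Proof.
move=> M; have [k0 Hk0] := ln_diverges (expR M); exists k0 => k /Hk0 h.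
by rewrite -[leLHS](expRK M) ler_ln ?posrE ?expR_gt0// (lt_le_trans (expR_gt0 M)).
Qed.

Lemma diverging_total_weight w L N C :
  (forall n, (N <= n)%N -> `|total_weight w N n.+1 - L n| <= C) -> diverges L ->
  forall M, exists n, M <= total_weight w N n.
Proof.
move=> LC Linf M; have [k0 Hk0] := Linf (M + C); exists (maxn N k0).+1.
have := LC _ (leq_maxl N k0); have := Hk0 _ (leq_maxr N k0).
by rewrite ler_norml => h /andP[]; lra.
Qed.

Lemma harmonic_near : exists C, forall n, (1 <= n)%N ->
  `|total_weight (fun k => k%:R^-1) 1 n.+1 - ln n%:R| <= C :> R.
Proof.
apply: (@total_weight_near _ _ (fun n => ln n%:R)) => [k k1|k k1|k k1].
- by rewrite invr_gt0 ltr0n.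
- by have [] := ln_step k1.
- by have [] := ln_step k1.
Qed.

Lemma weights_harmonic : weights (fun k => k%:R^-1 : R) 1 2.
Proof.
have [C HC] := harmonic_near.
split=> // [k k1|k k1|k k1|].
- by rewrite invr_gt0 ltr0n.
- have k0 : 0 < k%:R :> R by rewrite ltr0n.
  have h : 1 <= k%:R :> R by rewrite ler1n.
  by rewrite ler_pdivrMr// -natr1; lra.
- have k0 : 0 < k%:R :> R by rewrite ltr0n.
  rewrite -natr1 -subr_ge0.
  have -> : k%:R^-1 - ((k%:R + 1)^-1 + (k%:R + 1)^-1 / (k%:R + 1)) = (k%:R * (k%:R + 1) ^+ 2)^-1 :> R.
    by field; rewrite !gt_eqF// addr_gt0.
  by rewrite invr_ge0 mulr_ge0 ?sqr_ge0// ltW.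
- exact: diverging_total_weight HC ln_diverges.
Qed.

Lemma loglog_near : exists C, forall n, (2 <= n)%N ->
  `|total_weight (fun k => (k%:R * ln k%:R)^-1) 2 n.+1 - ln (ln n%:R)| <= C :> R.
Proof.
apply: (@total_weight_near _ _ (fun n => ln (ln n%:R))) => [k k1|k k1|k k1].
- rewrite invr_gt0 mulr_gt0 ?ltr0n ?(ltnW k1)//.
  by apply: lt_le_trans (half_le_ln k1); rewrite divr_gt0.
- by have [] := lnln_step k1.
- by have [] := lnln_step k1.
Qed.

Lemma weights_loglog : weights (fun k => (k%:R * ln k%:R)^-1 : R) 2 4.
Proof.
have [C HC] := loglog_near.
have k0 k : (2 <= k)%N -> 0 < k%:R :> R by move=> k2; rewrite ltr0n ltnW.
have l0 k : (2 <= k)%N -> 0 < ln k%:R :> R.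
  by move=> k2; apply: lt_le_trans (half_le_ln k2); rewrite divr_gt0.
have kl0 k : (2 <= k)%N -> 0 < k%:R * ln k%:R :> R by move=> k2; rewrite mulr_gt0 ?k0 ?l0.
split=> // [k k2|k k2|k k2|].
- by rewrite invr_gt0 kl0.
- rewrite ler_pdivrMr ?kl0//.
  have h1 : 1 <= k%:R :> R by rewrite ler1n ltnW.
  have : k%:R * (1 / 2) <= k%:R * ln k%:R :> R by rewrite ler_wpM2l// half_le_ln.
  by rewrite -[k.+1%:R]natr1; lra.
- have kp := k0 k k2; have lp := l0 k k2; have lp1 := l0 k.+1 (leqW k2).
  rewrite !invfM mulrAC -mulrDl; apply: ler_pM.
  + by rewrite addr_ge0// ?divr_ge0// ?invr_ge0.
  + by rewrite invr_ge0 ltW.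
  + exact: (weights_decr weights_harmonic (ltnW k2 : (1 <= k)%N)).
  + by rewrite lef_pV2 ?posrE// ler_ln ?posrE ?ltr0n ?ler_nat// ltnW.
- exact: diverging_total_weight HC lnln_diverges.
Qed.

End log_averages.

(** * The diffusive and critical regimes *)

Section growth.
Context {R : realType}.
Variables (v : nat -> R) (q K : R).
Hypotheses (K0 : 0 <= K) (v0 : forall k, 0 <= v k) (v1 : v 1%N <= K).
Hypothesis v_next : forall k, (1 <= k)%N -> v k.+1 <= (1 + 2 * q / k%:R) * v k + K.

(** Here [q] may be negative enough for the factor [1 + 2 q / k] to be
    negative at [k = 1], which is the second case of the induction. *)
Lemma diffusive_growth k : q < 1 / 2 -> (1 <= k)%N -> v k <= K * (1 + (1 - 2 * q)^-1) * k%:R.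
Proof.
move=> q2; have q0 : 0 < 1 - 2 * q by lra.
pose A := K * (1 + (1 - 2 * q)^-1).
have A0 : 0 <= A by rewrite mulr_ge0// addr_ge0// invr_ge0 ltW.
have KA : K <= A by rewrite ler_peMr// lerDl invr_ge0 ltW.
have KA' : K <= A * (1 - 2 * q).
  by rewrite /A -mulrA mulrDl mulVf ?gt_eqF// mul1r ler_peMr// lerDr ltW.
rewrite -/A; elim: k => [//|k IH _]; have [->|k1] := eqVneq k 0%N; first by rewrite mulr1 (le_trans v1).
rewrite -lt0n in k1; have {}IH := IH k1; have kR : 0 < k%:R :> R by rewrite ltr0n.
apply: le_trans (v_next k1) _; rewrite -[k.+1%:R]natr1.
have [c0|c0] := leP 0 (1 + 2 * q / k%:R).
  apply: le_trans (lerD (ler_wpM2l c0 IH) (lexx K)) _.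
  have -> : (1 + 2 * q / k%:R) * (A * k%:R) = A * k%:R + 2 * q * A by field; rewrite gt_eqF.
  by rewrite mulrDr mulr1; lra.
have : (1 + 2 * q / k%:R) * v k <= 0 by rewrite mulr_le0_ge0// ltW.
have : 0 <= A * k%:R by rewrite mulr_ge0.
by rewrite mulrDr mulr1; lra.
Qed.

(** At [q = 1 / 2] the ratio [v k / k] grows by at most [K / (k + 1)] in each
    step, hence logarithmically. *)
Lemma critical_growth k : q = 1 / 2 -> (1 <= k)%N -> v k <= K * (k%:R * (1 + ln k%:R)).
Proof.
move=> qE; elim: k => [//|k IH _]; have [->|k1] := eqVneq k 0%N.
  by rewrite ln1 addr0 mulr1 mulr1.
rewrite -lt0n in k1; have {}IH := IH k1; have kR : 0 < k%:R :> R by rewrite ltr0n.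
have [h1 _] := @ln_step R k k1.
have q0 : 0 <= 1 + 2 * q / k%:R by rewrite qE addr_ge0// divr_ge0// mulr_ge0// divr_ge0.
apply: le_trans (v_next k1) _; apply: le_trans (lerD (ler_wpM2l q0 IH) (lexx K)) _.
have -> : (1 + 2 * q / k%:R) * (K * (k%:R * (1 + ln k%:R))) + K =
    K * (k.+1%:R * (1 + ln k%:R + k.+1%:R^-1)).
  by rewrite qE -[k.+1%:R]natr1; field; rewrite !gt_eqF// addr_gt0.
by rewrite ler_wpM2l// ler_wpM2l//; move: h1; rewrite -addrA lerD2l lerBrDl.
Qed.

(** Relative increments of [x * ln x] between [x] and [x + 1], with [l] and
    [l'] standing for the two logarithms: they agree with
    [1 / x + 1 / (x * l)] up to order [1 / x ^+ 2]. *)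
Lemma loglog_scale (x l l' : R) : 1 <= x -> 1 / 2 <= l -> (x + 1)^-1 <= l' - l -> l' - l <= x^-1 ->
  [/\ x * l <= (x + 1) * l',
      1 - x * l / ((x + 1) * l') <= 3 / x,
      `|1 - x * l / ((x + 1) * l') - (x^-1 + (x * l)^-1)| <= 13 / x ^+ 2 &
      `|((x + 1) * l')^-1 - (x * l)^-1| <= 6 / x ^+ 2].
Proof.
move=> x1 l2; have x0 : 0 < x by lra.
have x10 : 0 < x + 1 by lra.
rewrite -[(x + 1)^-1]mul1r -[x^-1]mul1r ler_pdivrMr// ler_pdivlMr// mul1r.
have l0 : 0 < l by lra.
pose dl := l' - l; have -> : l' = l + dl by rewrite /dl; ring.
rewrite [l + dl - l](_ : _ = dl); last by ring.
clearbody dl => {l'} h1 h2.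
have dl0 : 0 < dl by rewrite -(pmulr_lgt0 _ x10) (lt_le_trans ltr01).
pose D := (x + 1) * (l + dl); rewrite -/D.
have D0 : 0 < D by rewrite mulr_gt0// addr_gt0.
have xl0 : 0 < x * l by rewrite mulr_gt0.
have xd0 : 0 < x * dl by rewrite mulr_gt0.
have DE : D - x * l = l + (x + 1) * dl by rewrite /D; ring.
have Dxl : x * l <= D by rewrite -subr_ge0 DE addr_ge0// ?ltW// mulr_gt0.
have num : x * (D - x * l) <= 3 * D.
  rewrite DE /D; have := ler_wpM2l (ltW x0) h2; have := mulr_gt0 x0 l0.
  by have := mulr_gt0 x0 dl0; nra.
split=> //.
- have -> : 1 - x * l / D = (D - x * l) / D by field; rewrite gt_eqF.
  by rewrite ler_pdivrMr// mulrAC ler_pdivlMr// mulrC.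
- have -> : 1 - x * l / D - (x^-1 + (x * l)^-1) =
    - (l ^+ 2 + l * (x + 1 - (x ^+ 2 - 1) * dl) + (x + 1) * dl) / (x * l * D).
    by rewrite /D; field; rewrite !gt_eqF// addr_gt0.
  have A1 : 0 <= x + 1 - (x ^+ 2 - 1) * dl.
    by have := ler_wpM2l (ltW x10) h2; nra.
  have A2 : x + 1 - (x ^+ 2 - 1) * dl <= 2.
    have x10' : 0 <= x - 1 by rewrite subr_ge0.
    by have := ler_wpM2l x10' h1; nra.
  have A3 : (x + 1) * dl <= 2 by nra.
  have A4 := ler_wpM2l (ltW l0) A2.
  have A5 : 0 <= l * (x + 1 - (x ^+ 2 - 1) * dl) by rewrite mulr_ge0// ltW.
  have A6 : 0 <= (x + 1) * dl by rewrite mulr_ge0// ltW.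
  have l2' := sqr_ge0 l.
  have xlD : 0 < x * l * D by rewrite mulr_gt0.
  rewrite normrM normrN normfV (gtr0_norm xlD) ger0_norm; last by rewrite !addr_ge0.
  rewrite ler_pdivrMr// mulrAC ler_pdivlMr ?exprn_gt0//.
  have xlxl : x * l * (x * l) <= x * l * D by rewrite ler_wpM2l// ltW.
  apply: (@le_trans _ _ (13 * l ^+ 2 * x ^+ 2)); last first.
    by rewrite [leLHS](_ : _ = 13 * (x * l * (x * l))); [rewrite ler_wpM2l|ring].
  rewrite ler_wpM2r ?sqr_ge0//.
  move: A4 A3; set a := l * _; set b := _ * dl => A4 A3.
  have : l * (1 / 2) <= l * l by rewrite ler_wpM2l// ltW.
  by rewrite expr2; nra.
- have Di : D^-1 <= (x * l)^-1 by rewrite lef_pV2.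
  rewrite distrC ger0_norm ?subr_ge0//.
  have -> : (x * l)^-1 - D^-1 = (D - x * l) / (x * l * D) by field; rewrite !gt_eqF.
  rewrite ler_pdivrMr; last by rewrite mulr_gt0.
  rewrite mulrAC ler_pdivlMr ?exprn_gt0//.
  have -> : (D - x * l) * x ^+ 2 = x * (x * (D - x * l)) by ring.
  have -> : 6 * (x * l * D) = x * (6 * l * D) by ring.
  rewrite ler_wpM2l ?(ltW x0)//; apply: le_trans num _; rewrite ler_wpM2r ?(ltW D0)//; lra.
Qed.

End growth.

Section walk_limits.
Context {d : measure_display} {T : measurableType d} {R : realType}.
Variables (P : probability T R) (X : nat -> {RV P >-> R})
  (eps : nat -> {RV P >-> bool}) (U : nat -> {RV P >-> nat}) (p : R).
Hypotheses (hp : 0 <= p < 1) (hin : reinforcement_inputs X eps U p).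
Hypothesis hX2 : ('E_P[fun w => (X 1%N w ^+ 2)%R] < +oo)%E.
Variables (f : R -> R).
Hypotheses (hfb : bounded_fun (f : R -> R^o)) (hfc : continuous f).
Variables (g : R -> R) (s : R).
Hypotheses (gE : forall x, g x = s * x) (sE : s = 1 \/ s = -1).
Local Notation E := (Rintegral P setT).
Local Notation Z := (step X eps U g).
Local Notation q := (s * p).
Local Notation mu := (limit_mean p q (moment P (X 1%N) 1)).
Variable sg : R.
Hypotheses (sg0 : 0 < sg) (sgE : sg ^+ 2 = moment P (X 1%N) 2 - mu ^+ 2).
Local Notation W k w := (\sum_(1 <= j < k.+1) Z j w - k%:R * mu).

Let HZ := step_processP hp hin hX2 gE sE.
Let Gm := @history_sigma_measurable _ _ _ P X eps U.
Let GS := @history_sigmaS _ _ _ P X eps U.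

Let WE k w : centered_sum Z p q (E (Z 1%N)) k w = W k w.
Proof.
rewrite /centered_sum sumrB sumr_const_nat subn1 /= -[X in _ - X = _]mulr_natl.
by rewrite moment1.
Qed.

Let f_bounded : exists B, forall y, `|f y| <= B.
Proof.
case: hfb => M [_ HM]; exists (`|M| + 1) => y; apply: HM => //.
by apply: le_lt_trans (ler_norm M) _; rewrite ltrDl.
Qed.

Let q_le1 : `|q| <= 1.
Proof.
have /andP[p0 p1] := hp.
by case: sE => ->; rewrite ?mul1r ?mulN1r ?normrN ger0_norm// ltW.
Qed.

Let second_next k : (1 <= k)%N -> _ := centered_second_next GS (sp_id HZ) (sp_q HZ) (k := k).
Let K0 : 0 <= _ := step_bound_ge0 (sp_id HZ).

Let var_E (theta a : R) : a ^+ 2 = sg ^+ 2 / (2 * theta) -> 0 < theta ->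
  E (fun x => Z 1%N x ^+ 2) - limit_mean p q (E (Z 1%N)) ^+ 2 = 2 * theta * a ^+ 2.
Proof.
move=> -> th0; rewrite sgE moment2 moment1; field.
by rewrite gt_eqF.
Qed.

(** Here [b k = a sqrt k] with [a = sg / sqrt (1 - 2 q)] and
    [theta = (1 - 2 q) / 2]. *)
Lemma diffusive_walk_clt : q < 1 / 2 ->
  {ae P, forall w, (ln n%:R)^-1 * (\sum_(1 <= k < n.+1) k%:R^-1 *
      f (Num.sqrt (1 - 2 * q) / (sg * Num.sqrt k%:R) * W k w)) @[n --> \oo]
    --> gaussian_mean f}.
Proof.
move=> q2; have q0 : 0 < 1 - 2 * q by lra.
pose theta : R := (1 - 2 * q) / 2; have th0 : 0 < theta by rewrite divr_gt0.
pose a := sg / Num.sqrt (1 - 2 * q).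
have s0 : 0 < Num.sqrt (1 - 2 * q) by rewrite sqrtr_gt0.
have a0 : 0 < a by rewrite divr_gt0.
have aE : a ^+ 2 = sg ^+ 2 / (2 * theta).
  rewrite /a expr_div_n sqr_sqrtr ?(ltW q0)// /theta; congr (_ / _).
  by rewrite [RHS]mulrC divfK.
pose K := step_bound p q (E (Z 1%N)) (E (fun w => Z 1%N w ^+ 2)).
have K0' : 0 <= K := K0.
pose c := K * (1 + (1 - 2 * q)^-1) + 1.
have c1 : 1 <= c by rewrite lerDr mulr_ge0// addr_ge0// invr_ge0 ltW.
have kR k : (1 <= k)%N -> 0 < k%:R :> R by move=> k1; rewrite ltr0n.
have inv_le k : (1 <= k)%N -> 0 <= (k%:R^-1 - k.+1%:R^-1 : R) <= 1 / k%:R ^+ 2.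
  move=> k1; have kp := kR k k1; rewrite -natr1.
  have -> : k%:R^-1 - (k%:R + 1)^-1 = (k%:R * (k%:R + 1))^-1 :> R.
    by field; rewrite !gt_eqF// addr_gt0.
  have k2 : 0 < k%:R * (k%:R + 1) :> R by rewrite mulr_gt0// addr_gt0.
  rewrite invr_ge0 (ltW k2)/= div1r lef_pV2 ?posrE ?exprn_gt0//.
  by rewrite expr2 ler_wpM2l ?(ltW kp)// lerDl.
have ratio k : (1 <= k)%N -> 1 - k%:R / k.+1%:R = k.+1%:R^-1 :> R.
  by move=> k1; rewrite -natr1; field; rewrite gt_eqF// addr_gt0// kR.
have c2 k : (1 <= k)%N -> 1 / k%:R ^+ 2 <= c / k%:R ^+ 2.
  by move=> k1; rewrite ler_wpM2r// invr_ge0 sqr_ge0.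
have [|||||||C1 Hb] := @sqrt_normalization _ _ _ P Z p q (fun k => k%:R) 1 theta a c isT q_le1 th0 a0 c1 (var_E aE th0).
- exact: kR.
- by move=> k _; rewrite ler_nat.
- move=> k k1; rewrite ratio//; apply: (@le_trans _ _ k%:R^-1).
    by rewrite lef_pV2 ?posrE ?kR// ler_nat.
  by rewrite ler_peMl// invr_ge0.
- move=> k k1; rewrite ratio// /theta.
  have -> : k.+1%:R^-1 - (2 * q / k%:R + 2 * ((1 - 2 * q) / 2) * k%:R^-1) =
     - (k%:R^-1 - k.+1%:R^-1) by field; rewrite !gt_eqF ?kR.
  have /andP[i0 i1] := inv_le k k1.
  by rewrite normrN ger0_norm// (le_trans i1)// c2.
- move=> k k1; have /andP[i0 i1] := inv_le k k1.
  by rewrite distrC ger0_norm// (le_trans i1)// c2.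
- move=> k k1; apply: le_trans (_ : K * (1 + (1 - 2 * q)^-1) * k%:R <= _).
    apply: (@diffusive_growth R (fun k => E (fun x => centered_sum Z p q (E (Z 1%N)) k x ^+ 2)) q K K0' _ _ _ k q2 k1).
    + by move=> k'; exact: (centered_second_ge0 P Z p q).
    + exact: (centered_second1 (sp_id HZ)).
    + exact: second_next.
  by rewrite ler_wpM2r// lerDl.
- move=> M; exists (Num.bound `|M|) => k Hk; apply: le_trans (ler_norm M) _.
  apply: le_trans (ltW (archi_boundP (normr_ge0 M))) _.
  by rewrite ler_nat leqW.
have [B fB] := f_bounded; have [C HC] := @harmonic_near R.
apply: filterS (almost_sure_clt Gm GS HZ weights_harmonic Hb hfc fB) => w Hw.
rewrite (integral_normal_prob hfc (bounded_funP fB)).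
have := log_average_cvg HC ln_diverges Hw.
under [in X in X -> _]eq_fun do under eq_bigr do rewrite /scaled_sum WE.
apply: cvg_trans; apply: near_eq_cvg; near=> n; congr (_ * _).
rewrite big_nat [RHS]big_nat; apply: eq_bigr => k /andP[k1 _].
congr (_ * f _); rewrite /a; field.
by rewrite !gt_eqF// sqrtr_gt0 kR.
Unshelve. all: by end_near. Qed.

(** Here [b k = sg sqrt (k ln k)] and [theta = 1 / 2]: the drift of order
    [1 / k] of the walk is cancelled by the growth of [sqrt k], and only the
    logarithm in the scaling leaves a drift. *)
Lemma critical_walk_clt : q = 1 / 2 ->
  {ae P, forall w, (ln (ln n%:R))^-1 * (\sum_(2 <= k < n.+1) (k%:R * ln k%:R)^-1 *
      f (W k w / (sg * Num.sqrt (k%:R * ln k%:R)))) @[n --> \oo]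
    --> gaussian_mean f}.
Proof.
move=> qE; pose theta : R := 1 / 2; have th0 : 0 < theta by rewrite divr_gt0.
have two : 2 * (1 / 2) = 1 :> R by rewrite mul1r divff.
have aE : sg ^+ 2 = sg ^+ 2 / (2 * theta) by rewrite /theta two divr1.
pose K := step_bound p q (E (Z 1%N)) (E (fun w => Z 1%N w ^+ 2)).
have K0' : 0 <= K := K0.
pose c := 3 * K + 13.
have c0 : 0 <= 3 * K by rewrite mulr_ge0.
have c1 : 1 <= c by rewrite /c; lra.
have kR k : (2 <= k)%N -> 0 < k%:R :> R by move=> k2; rewrite ltr0n ltnW.
have scale k (k2 : (2 <= k)%N) := @loglog_scale R k%:R (ln k%:R) (ln k.+1%:R).
have {}scale k : (2 <= k)%N -> [/\ k%:R * ln k%:R <= k.+1%:R * ln k.+1%:R :> R,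
      1 - k%:R * ln k%:R / (k.+1%:R * ln k.+1%:R) <= 3 / k%:R :> R,
      `|1 - k%:R * ln k%:R / (k.+1%:R * ln k.+1%:R) - (k%:R^-1 + (k%:R * ln k%:R)^-1)| <= 13 / k%:R ^+ 2 :> R &
      `|(k.+1%:R * ln k.+1%:R)^-1 - (k%:R * ln k%:R)^-1| <= 6 / k%:R ^+ 2 :> R].
  move=> k2; have [h1 h2] := @ln_step R k (ltnW k2).
  by move: (scale k k2); rewrite natr1; apply => //; [rewrite ler1n ltnW|exact: half_le_ln].
have up a k (n : nat) : a <= 13 -> a / k%:R ^+ n <= c / k%:R ^+ n.
  by move=> a13; rewrite ler_wpM2r ?invr_ge0 ?exprn_ge0// /c; lra.
have [|||||||C1 Hb] := @sqrt_normalization _ _ _ P Z p q (fun k => k%:R * ln k%:R) 2 theta sg c isT q_le1 th0 sg0 c1 (var_E aE th0).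
- by move=> k k2; rewrite mulr_gt0 ?kR// (lt_le_trans _ (half_le_ln k2))// divr_gt0.
- by move=> k /scale[].
- move=> k /scale[_ h _ _]; apply: le_trans h _.
  by have := @up 3 k 1%N; rewrite expr1; apply; lra.
- move=> k /scale[_ _ h _]; apply: le_trans _ (up 13 k 2%N (lexx _)); apply: le_trans h.
  by rewrite qE /theta two !mul1r.
- by move=> k /scale[_ _ _ h]; apply: le_trans h _; apply: up; lra.
- move=> k k2; apply: le_trans (_ : K * (k%:R * (1 + ln k%:R)) <= _).
    apply: (@critical_growth R (fun k => E (fun x => centered_sum Z p q (E (Z 1%N)) k x ^+ 2)) q K K0' _ _ k qE (ltnW k2)).
    + exact: (centered_second1 (sp_id HZ)).
    + exact: second_next.
  have l2 := @half_le_ln R k k2; have kl0 : 0 <= k%:R * ln k%:R :> R by rewrite mulr_ge0//; lra.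
  apply: (@le_trans _ _ (3 * K * (k%:R * ln k%:R))).
    have -> : 3 * K * (k%:R * ln k%:R) = K * (k%:R * (3 * ln k%:R)) by ring.
    by rewrite ler_wpM2l// ler_wpM2l//; lra.
  by rewrite ler_wpM2r// /c; lra.
- move=> M; have [k0 Hk0] := @ln_diverges R `|M|; exists k0 => k Hk.
  have l1 := Hk0 k.+1 (leqW Hk); apply: le_trans (ler_norm M) _; apply: le_trans l1 _.
  by rewrite ler_peMl// ?ler1n// (le_trans _ (Hk0 k.+1 (leqW Hk))).
have [B fB] := f_bounded; have [C HC] := @loglog_near R.
apply: filterS (almost_sure_clt Gm GS HZ weights_loglog Hb hfc fB) => w Hw.
rewrite (integral_normal_prob hfc (bounded_funP fB)).
have := log_average_cvg HC lnln_diverges Hw.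
apply: cvg_trans; apply: near_eq_cvg; near=> n; congr (_ * _).
by apply: eq_bigr => k _; rewrite /scaled_sum WE.
Unshelve. all: by end_near. Qed.

End walk_limits.

Unset Implicit Arguments.

Theorem theorem2p2 (R : realType) (d : measure_display) (T : measurableType d)
  (P : probability T R) (X : nat -> {RV P >-> R})
  (eps : nat -> {RV P >-> bool}) (U : nat -> {RV P >-> nat}) (p : R)
  (hp : 0 <= p < 1) (hinputs : reinforcement_inputs X eps U p)
  (hX2 : ('E_P[fun w => (X 1%N w ^+ 2)%R] < +oo)%E)
  (f : R -> R) (hfb : bounded_fun (f : R -> R^o)) (hfc : continuous f) :
  let m1 := moment P (X 1%N) 1 in
  let sg := sigma P (X 1%N) in
  let muc := mucheck P (X 1%N) p in
  let sgc := sigmacheck P (X 1%N) p in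
  [/\ 0 < sg -> p < 1 / 2 ->
      {ae P, forall w,
        (ln n%:R)^-1 * (\sum_(1 <= k < n.+1) k%:R^-1 *
          f (Num.sqrt (1 - 2 * p) / (sg * Num.sqrt k%:R) *
             (Shat X eps U k w - k%:R * m1))) @[n --> \oo]
        --> gaussian_mean f},
      0 < sg -> p = 1 / 2 ->
      {ae P, forall w,
        (ln (ln n%:R))^-1 * (\sum_(2 <= k < n.+1) (k%:R * ln k%:R)^-1 *
          f ((Shat X eps U k w - k%:R * m1) /
             (sg * Num.sqrt (k%:R * ln k%:R)))) @[n --> \oo]
        --> gaussian_mean f} &
      0 < sgc ->
      {ae P, forall w,
        (ln n%:R)^-1 * (\sum_(1 <= k < n.+1) k%:R^-1 *
          f (Num.sqrt (1 + 2 * p) / (sgc * Num.sqrt k%:R) *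
             (Scheck X eps U k w - k%:R * muc))) @[n --> \oo]
        --> gaussian_mean f}].
Proof.
move=> m1 sg muc sgc; have /andP[p0 p1] := hp.
have hat_mean : limit_mean p (1 * p) m1 = m1.
  by rewrite /limit_mean mul1r mulrAC divff ?mul1r// subr_eq0 gt_eqF.
have check_mean : limit_mean p (-1 * p) m1 = muc.
  by rewrite /limit_mean mulN1r opprK.
have id_mul (x : R) : id x = 1 * x by rewrite mul1r.
have opp_mul (x : R) : - x = -1 * x by rewrite mulN1r.
have sqrE (x : R) : 0 < Num.sqrt x -> Num.sqrt x ^+ 2 = x.
  by rewrite sqrtr_gt0 => /ltW; exact: sqr_sqrtr.
split=> [sg0 p2|sg0 p2|sg0].
- have := diffusive_walk_clt hp hinputs hX2 hfb hfc id_mul (or_introl erefl) sg0.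
  by rewrite hat_mean mul1r; apply=> //; exact: sqrE.
- have := critical_walk_clt hp hinputs hX2 hfb hfc id_mul (or_introl erefl) sg0.
  by rewrite hat_mean mul1r; apply=> //; exact: sqrE.
- have := diffusive_walk_clt hp hinputs hX2 hfb hfc opp_mul (or_intror erefl) sg0.
  rewrite check_mean mulN1r mulrN opprK; apply; first exact: sqrE.
  by lra.
Qed.
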